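(* Let $T$ be a transport path from $\mu^-=\sum_{i=1}^M m_i'\delta_{x_i}$ to $\mu^+=\sum_{j=1}^N m_j\delta_{y_j}$, where $\mu^\pm$ are finite atomic measures of equal mass on $X$ and $M,N\in\mathbb{N}\cup\{\infty\}$. For any good decomposition $\eta$ of $T$, there exists a better decomposition $\eta_\infty$ of $T$ such that $\eta_\infty\prec\!\prec\eta$.
   Context: $X\subset\mathbb{R}^m$ is compact and convex. $x_i\in X$ are pairwise distinct, $y_j\in X$ are pairwise distinct, $m_i',m_j>0$, and $\sum_{i=1}^M m_i'=\sum_{j=1}^N m_j<\infty$. A rectifiable 1-current $T=\underline{\underline{\tau}}(W,\theta,\xi)$ in $\mathbb{R}^m$ is $T(\omega)=\int_W\langle\omega(x),\xi(x)\rangle\theta(x)\,d\mathcal{H}^1(x)$ for smooth compactly supported 1-forms $\omega$, where $W$ is $\mathcal{H}^1$-measurable and countably 1-rectifiable, $\theta>0$ is locally $\mathcal{H}^1$-integrable, and $\xi$ is an $\mathcal{H}^1$-measurable unit vector field spanning the approximate tangent line of $W$ a.e. Its boundary is $\partial T(f)=T(df)$, and $\mathbf{M}$ denotes mass. $T$ is normal if $\mathbf{M}(T)+\mathbf{M}(\partial T)<\infty$. A transport path from $\mu^-$ to $\mu^+$ is a rectifiable 1-current $T$ with $\partial T=\mu^+-\mu^-$. $\Gamma$ is the space of 1-Lipschitz curves $\gamma:[0,\infty)\to\mathbb{R}^m$ that are eventually constant; $p_0(\gamma)=\gamma(0)$, $p_\infty(\gamma)=\lim_{t\to\infty}\gamma(t)$.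 With $t_0(\gamma)=\sup\{t:\gamma\text{ constant on }[0,t]\}$ and $t_\infty(\gamma)=\inf\{t:\gamma\text{ constant on }[t,\infty)\}$, $\gamma$ is simple if $\gamma(s)\ne\gamma(t)$ for all $t_0(\gamma)\le s<t\le t_\infty(\gamma)$. For simple $\gamma$, $I_\gamma=\underline{\underline{\tau}}(\mathrm{Im}(\gamma),\gamma'/|\gamma'|,1)$ is the unit-multiplicity 1-current carried by the image of $\gamma$, oriented by $\gamma$. $\Gamma_{x,y}=\{\gamma\in\Gamma:p_0(\gamma)=x,\ p_\infty(\gamma)=y\}$. A good decomposition of a normal 1-current $T$ is a finite positive measure $\eta$ on $\Gamma$, supported on non-constant simple curves, with $T=\int_\Gamma I_\gamma\,d\eta(\gamma)$ (i.e. $T(\omega)=\int_\Gamma I_\gamma(\omega)\,d\eta$ for all $\omega$), $\mathbf{M}(T)=\int_\Gamma\mathbf{M}(I_\gamma)\,d\eta=\int_\Gamma\mathcal{H}^1(\mathrm{Im}(\gamma))\,d\eta$, and $\mathbf{M}(\partial T)=\int_\Gamma\mathbf{M}(\partial I_\gamma)\,d\eta=2\eta(\Gamma)$. For a finite positive measure $\eta$ on $\Gamma$, $S_{i,j}(\eta)=\frac{1}{\eta(\Gamma_{x_i,y_j})}\int_{\Gamma_{x_i,y_j}}I_\gamma\,d\eta$ if $\eta(\Gamma_{x_i,y_j})>0$, and $S_{i,j}(\eta)=0$ otherwise. A good decomposition $\eta$ of $T$ is a better decomposition if for all $1\le i_1<i_2\le M$ and $1\le j_1<j_2\le N$, the equality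 $S_{i_1,j_1}(\eta)-S_{i_1,j_2}(\eta)-S_{i_2,j_1}(\eta)+S_{i_2,j_2}(\eta)=0$ implies $\eta(\Gamma_{x_{i_1},y_{j_1}})=\eta(\Gamma_{x_{i_1},y_{j_2}})=\eta(\Gamma_{x_{i_2},y_{j_1}})=\eta(\Gamma_{x_{i_2},y_{j_2}})=0$. $\tilde\eta\prec\!\prec\eta$ means: for each pair $(i,j)$ there is $a_{i,j}\ge0$ with $\int_{\Gamma_{x_i,y_j}}I_\gamma\,d\tilde\eta=a_{i,j}\int_{\Gamma_{x_i,y_j}}I_\gamma\,d\eta$. When $M=\infty$, indices $i\le M$ range over all positive integers (similarly for $N$). *)

(* Defs.v *)
From HB Require Import structures.
From mathcomp Require Import all_boot all_order all_algebra.
From mathcomp Require Import all_classical all_reals all_analysis.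
From mathcomp Require Import measurable_realfun.

Set Implicit Arguments.
Unset Strict Implicit.
Unset Printing Implicit Defensive.

Import Order.TTheory GRing.Theory Num.Theory.
Import numFieldNormedType.Exports.

Local Open Scope classical_set_scope.
Local Open Scope ring_scope.

(* The library norm on 'rV[R]_m is the sup norm, which induces the right
   topology; metric notions use the Euclidean norm [enorm]. *)
Section Euclidean.
Context {R : realType} {m : nat}.
Implicit Types u v : 'rV[R]_m.

Definition dotp u v : R := \sum_(i < m) u 0 i * v 0 i.

Definition enorm u : R := Num.sqrt (dotp u u).

(* [maxe 0] only matters for the empty set, where [ereal_sup] is -oo. *)
Definition ediam (A : set 'rV[R]_m) : \bar R :=
  maxe 0%E (ereal_sup [set (enorm (p.1 - p.2))%:E | p in A `*` A]).

Definition hausdorff1_content (delta : R) (A : set 'rV[R]_m) : \bar R :=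
  ereal_inf [set (\sum_(0 <= k <oo) ediam (U k))%E |
    U in [set U : (set 'rV[R]_m)^nat |
      A `<=` \bigcup_k U k /\ forall k, (ediam (U k) <= delta%:E)%E]].

(* The limit as delta tends to 0 is a supremum, by monotonicity. *)
Definition hausdorff1 (A : set 'rV[R]_m) : \bar R :=
  ereal_sup [set hausdorff1_content delta A | delta in [set d : R | 0 < d]].

End Euclidean.

Section HausdorffOuterMeasure.
Context {R : realType} {m : nat}.
Local Open Scope ereal_scope.
Implicit Types (A B : set 'rV[R]_m) (d : R).

Lemma ediam_ge0 A : 0 <= ediam A.
Proof. by rewrite /ediam le_max lexx. Qed.

Lemma ediam0 : ediam (set0 : set 'rV[R]_m) = 0.
Proof.
by rewrite /ediam set0X image_set0 ereal_sup0; apply/max_idPl; rewrite leNye.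
Qed.

Lemma hausdorff1_content_ge0 d A : 0 <= hausdorff1_content d A.
Proof.
by apply: le_ereal_inf_tmp => _ [U _ <-]; apply: nneseries_ge0 => k _ _;
  exact: ediam_ge0.
Qed.

Lemma hausdorff1_content0 d : (0 < d)%R ->
  hausdorff1_content d (set0 : set 'rV[R]_m) = 0.
Proof.
move=> d0; apply/eqP; rewrite eq_le hausdorff1_content_ge0 andbT.
apply: ereal_inf_lbound; exists (fun=> set0) => /=.
  by split => // k; rewrite ediam0 lee_fin ltW.
by rewrite eseries0 // => k _ _; rewrite ediam0.
Qed.

Lemma le_hausdorff1_content d A B : A `<=` B ->
  hausdorff1_content d A <= hausdorff1_content d B.
Proof.
move=> AB; apply: le_ereal_inf_tmp => _ [U [BU dU] <-]; apply: ereal_inf_lbound.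
by exists U => //; split => //; exact: (subset_trans AB).
Qed.

Lemma hausdorff1_content_sigma_subadditive d :
  sigma_subadditive (@hausdorff1_content R m d).
Proof.
move=> A; set mu := @hausdorff1_content R m d.
have mu_ge0 B : 0 <= mu B by exact: hausdorff1_content_ge0.
have [[i ioo]|] := pselect (exists i, mu (A i) = +oo).
  by rewrite (eseries_pinfty _ _ ioo) ?leey// => n _;
    rewrite -ltNye (lt_le_trans _ (mu_ge0 _)).
rewrite -forallNE => Aoo.
suff add2e (e : {posnum R}) :
    mu (\bigcup_n A n) <= \sum_(i <oo) mu (A i) + e%:num%:E.
  by apply/lee_addgt0Pr => _/posnumP[].
rewrite (le_trans _ (epsilon_trick _ _ _))//.
pose P n (B : (set 'rV[R]_m)^nat) :=
  (A n `<=` \bigcup_k B k /\ forall k, ediam (B k) <= d%:E) /\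
  \sum_(k <oo) ediam (B k) <= mu (A n) + (e%:num / (2 ^ n.+1)%:R)%:E.
have [G PG] : {G : ((set 'rV[R]_m)^nat)^nat & forall n, P n (G n)}.
  apply: (@choice _ _ P) => n; rewrite /P /mu /hausdorff1_content.
  set S := (X in ereal_inf X); move infS : (ereal_inf S) => iS.
  case: iS infS => [r Sr|Soo|Soo].
  - have en1 : (0 < e%:num / (2 ^ n.+1)%:R)%R by [].
    have /(lb_ereal_inf_adherent en1) : ereal_inf S \is a fin_num by rewrite Sr.
    move=> [x [B AB muBx] xS].
    by exists B; split => //; rewrite muBx -Sr; exact/ltW.
  - by have := Aoo n; rewrite /mu /hausdorff1_content Soo.
  - by have := mu_ge0 (A n); rewrite /mu /hausdorff1_content Soo.
have G_ge0 x : 0 <= (@ediam R m \o uncurry G) x by exact: ediam_ge0.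
apply: (@le_trans _ _ (\esum_(i in setT) (@ediam R m \o uncurry G) i)).
  apply: ereal_inf_lbound => /=.
  have /card_esym/ppcard_eqP[f] := card_nat2.
  exists (uncurry G \o f).
    split=> [t [i _]|k] /=; last by case: (f k) => i j /=; exact: (PG i).1.2.
    move=> /(PG i).1.1 [j _ Gijt]; exists (f^-1%FUN (i, j)) => //=.
    by rewrite invK ?inE.
  rewrite -(esum_pred_image (@ediam R m \o uncurry G) _ xpredT) ?[fun=> _]set_true//.
  by rewrite image_eq.
rewrite (_ : esum _ _ = \sum_(i <oo) \sum_(j <oo) ediam (G i j)); last first.
  pose J : nat -> set (nat * nat) := fun i => [set (i, j) | j in setT].
  rewrite (_ : setT = \bigcup_k J k); last first.
    by rewrite predeqE => -[a b]; split => // _; exists a => //; exists b.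
  rewrite esum_bigcupT //=; last first.
    apply/trivIsetP => i j _ _ ij.
    rewrite predeqE => -[n k] /=; split => //= -[] [_] _ [<-{n} _].
    by move=> [k' _] [] /esym/eqP; rewrite (negbTE ij).
  rewrite -(image_id [set: nat]) -fun_true esum_pred_image//; last first.
    by move=> n _; apply: esum_ge0 => p _; exact: ediam_ge0.
  apply: eq_eseriesr => /= j _.
  rewrite -(esum_pred_image (@ediam R m \o uncurry G) (pair j) predT) /=.
  - by rewrite fun_true.
  - by move=> n _; exact: ediam_ge0.
  - by move=> n k _ _; exact: (@can_inj _ _ _ snd).
apply: lee_nneseries => [n _ _|n _].
- by apply: nneseries_ge0 => j _ _; exact: ediam_ge0.
- exact: (PG n).2.
Qed.

Lemma hausdorff1_0 : hausdorff1 (set0 : set 'rV[R]_m) = 0.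
Proof.
apply/eqP; rewrite eq_le; apply/andP; split.
  by apply: ge_ereal_sup => _ [d /= d0 <-]; rewrite hausdorff1_content0.
by apply: ereal_sup_ubound; exists 1%R => //=; rewrite hausdorff1_content0.
Qed.

Lemma hausdorff1_ge0 A : 0 <= hausdorff1 A.
Proof.
apply: (le_trans (hausdorff1_content_ge0 1 A)).
by apply: ereal_sup_ubound; exists 1%R => /=.
Qed.

Lemma le_hausdorff1 :
  {homo (@hausdorff1 R m) : A B / A `<=` B >-> A <= B}.
Proof.
move=> A B AB; apply: ge_ereal_sup => _ [d /= d0 <-].
apply: (le_trans (le_hausdorff1_content d AB)).
by apply: ereal_sup_ubound; exists d.
Qed.

Lemma hausdorff1_sigma_subadditive : sigma_subadditive (@hausdorff1 R m).
Proof.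
move=> A; apply: ge_ereal_sup => _ [d /= d0 <-].
apply: (le_trans (hausdorff1_content_sigma_subadditive d A)).
apply: lee_nneseries => [n _ _|n _]; first exact: hausdorff1_content_ge0.
by apply: ereal_sup_ubound; exists d.
Qed.

HB.instance Definition _ := isOuterMeasure.Build R 'rV[R]_m (@hausdorff1 R m)
  hausdorff1_0 hausdorff1_ge0 le_hausdorff1 hausdorff1_sigma_subadditive.

End HausdorffOuterMeasure.

Section Currents.
Context {R : realType} {m : nat}.
Notation V := 'rV[R]_m.

(* H^1 on its sigma-algebra of Caratheodory-measurable sets. *)
Definition H1_outer : {outer_measure set V -> \bar R} := @hausdorff1 R m.

Definition H1_space := caratheodory_type H1_outer.

Definition H1 : {measure set H1_space -> \bar R} :=
  [the {measure set _ -> \bar R} of (H1_outer : set H1_space -> \bar R)].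

Definition partial (i : 'I_m) (f : V -> R) : V -> R :=
  fun x => 'D_(delta_mx 0 i : V) (f : V -> R^o) x.

Fixpoint differentiable_class (k : nat) (f : V -> R) : Prop :=
  continuous f /\
  if k is k'.+1 then
    forall i : 'I_m,
      (forall x, derivable (f : V -> R^o) x (delta_mx 0 i : V)) /\
      differentiable_class k' (partial i f)
  else True.

Definition smooth (f : V -> R) := forall k, differentiable_class k f.

Definition test_function (f : V -> R) :=
  smooth f /\ compact (closure [set x | f x != 0]).

(* A 1-form is given by its coefficients in the basis dx_1, ..., dx_m. *)
Definition test_form (omega : V -> V) :=
  (forall i : 'I_m, smooth (fun x => omega x 0 i)) /\
  compact (closure [set x | omega x != 0]).

Definition gradient (f : V -> R) : V -> V :=
  fun x => \row_(i < m) partial i f x.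

(* A 1-current is only ever evaluated at test forms; its values at other
   arguments are irrelevant. *)
Definition current1 := (V -> V) -> R.

Definition boundary (T : current1) : (V -> R) -> R := fun f => T (gradient f).

(* The comass of a covector is its Euclidean norm. *)
Definition mass1 (T : current1) : \bar R :=
  ereal_sup [set (T omega)%:E | omega in
    [set omega | test_form omega /\ forall x, enorm (omega x) <= 1]].

Definition mass0 (S : (V -> R) -> R) : \bar R :=
  ereal_sup [set (S f)%:E | f in
    [set f | test_function f /\ forall x, `|f x| <= 1]].

Definition normal_current (T : current1) : Prop :=
  (mass1 T + mass0 (boundary T) < +oo)%E.

Definition countably_1rectifiable (W : set V) :=
  exists (f : nat -> R -> V) (W0 : set V),
    [/\ forall k, exists L, forall s t, enorm (f k s - f k t) <= L * `|s - t|,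
        hausdorff1 W0 = 0%E &
        W `<=` W0 `|` \bigcup_k range (f k)].

Definition tau (W : set V) (theta : V -> R) (xi : V -> V) : current1 :=
  fun omega => \int[H1]_(x in W) (dotp (omega x) (xi x) * theta x).

(* The line spanned by v is the approximate tangent line of W at x with respect
   to theta: the blow-ups of theta H^1 restricted to W converge weakly to
   theta(x) H^1 restricted to the line.  The left-hand side below is
   \int_{(W - x)/r} phi(z) theta(x + r z) dH^1(z) after rescaling. *)
Definition approximate_tangent (W : set V) (theta : V -> R) (x v : V) :=
  forall phi : V -> R, continuous phi ->
    compact (closure [set z | phi z != 0]) ->
    r^-1 * (\int[H1]_(y in W) (phi (r^-1 *: (y - x)) * theta y))
      @[r --> 0^'+] -->
    theta x * (\int[H1]_(z in [set s *: v | s in [set: R]]) phi z).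

Definition rectifiable_data (W : set V) (theta : V -> R) (xi : V -> V) :=
  [/\ measurable (W : set H1_space) /\ countably_1rectifiable W,
      forall x, W x -> 0 < theta x,
      forall K, compact K -> H1.-integrable (W `&` K) (EFin \o theta),
      (forall i, measurable_fun (W : set H1_space) (fun x => xi x 0 i)) /\
      (forall x, W x -> enorm (xi x) = 1) &
      {ae H1, forall x, W x -> approximate_tangent W theta x (xi x)}].

Definition rectifiable_current (T : current1) :=
  exists W theta xi, rectifiable_data W theta xi /\
    forall omega, test_form omega -> T omega = tau W theta xi omega.

Definition borel_space := g_sigma_algebraType (@open V).

Definition transport_path (mu_minus mu_plus : {measure set borel_space -> \bar R})
    (T : current1) :=
  rectifiable_current T /\
  forall f, test_function f ->
    boundary T f = \int[mu_plus]_x f x - \int[mu_minus]_x f x.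

End Currents.
Arguments current1 : clear implicits.
Arguments borel_space : clear implicits.
Arguments H1_outer : clear implicits.
Arguments H1_space : clear implicits.
Arguments H1 : clear implicits.

Section AtomicMeasure.
Context {R : realType} {m : nat}.

(* [None] encodes infinitely many atoms; atoms are numbered from 0. *)
Definition in_range (M : option nat) (i : nat) : bool :=
  if M is Some n then (i < n)%N else true.

Definition weight (M : option nat) (w : nat -> {posnum R}) (i : nat) :
    {nonneg R} :=
  if in_range M i then ((w i)%:num)%:nng else 0%:nng.

Definition atomic_measure (M : option nat) (w : nat -> {posnum R})
    (x : nat -> 'rV[R]_m) : {measure set (borel_space R m) -> \bar R} :=
  mseries (fun i => mscale (weight M w i) (@dirac _ (borel_space R m) (x i) R))
    0.

End AtomicMeasure.

(* Curves are parametrized by [0, +oo[ and extended by their initial value to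
   negative times, so that equality and u.c.c. convergence on the whole line and
   on [0, +oo[ agree. *)
Record curve (R : realType) (m : nat) := Curve {
  curve_fun :> R -> 'rV[R]_m;
  curve_neg : forall t, t < 0 -> curve_fun t = curve_fun 0;
  curve_lip : forall s t, 0 <= s -> 0 <= t ->
    enorm (curve_fun s - curve_fun t) <= `|s - t|;
  curve_const : exists2 t0, 0 <= t0 &
    forall t, t0 <= t -> curve_fun t = curve_fun t0 }.

HB.instance Definition _ R m := gen_eqMixin (curve R m).
HB.instance Definition _ R m := gen_choiceMixin (curve R m).

Lemma enorm0 (R : realType) (m : nat) : enorm (0 : 'rV[R]_m) = 0.
Proof.
by rewrite /enorm /dotp big1 ?sqrtr0 // => i _; rewrite mxE mul0r.
Qed.

Definition zero_curve (R : realType) (m : nat) : curve R m.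
Proof.
apply: (@Curve R m (fun=> 0)) => //; last by exists 0.
by move=> s t _ _; rewrite subrr enorm0.
Defined.

HB.instance Definition _ R m := isPointed.Build (curve R m) (zero_curve R m).

Definition curve_to_fun (R : realType) (m : nat) (g : curve R m) :
  {family compact, R -> 'rV[R]_m} := g.

(* Gamma with its Borel sigma-algebra for uniform convergence on compact sets. *)
HB.instance Definition _ R m :=
  Topological.copy (curve R m) (initial_topology (@curve_to_fun R m)).

Definition Gamma (R : realType) (m : nat) :=
  g_sigma_algebraType (@open (curve R m)).

Section Curves.
Context {R : realType} {m : nat}.
Implicit Types (g : curve R m) (x y : 'rV[R]_m).

Definition p0 g : 'rV[R]_m := g 0.
Definition pinfty g : 'rV[R]_m := lim (g t @[t --> +oo]).

Definition Gamma_between x y : set (Gamma R m) :=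
  [set g : Gamma R m | p0 g = x /\ pinfty g = y].

Definition curve_image g : set 'rV[R]_m := [set g t | t in `[0, +oo[].

(* Extended reals: for a constant curve [t0] is +oo and [tinfty] is 0. *)
Definition t0 g : \bar R :=
  ereal_sup [set t%:E | t in
    [set t : R | 0 <= t /\ forall s, 0 <= s <= t -> g s = g 0]].
Definition tinfty g : \bar R :=
  ereal_inf [set t%:E | t in
    [set t : R | 0 <= t /\ forall s, t <= s -> g s = g t]].

Definition simple_curve g :=
  forall s t : R, (t0 g <= s%:E)%E -> s < t -> (t%:E <= tinfty g)%E ->
    g s <> g t.

Definition nonconstant g := exists s t : R, [/\ 0 <= s, 0 <= t & g s <> g t].

(* For a nonconstant simple g, a point of the image has exactly one parameter
   between t0 and tinfty. *)
Definition curve_param g x : R :=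
  get [set t : R | [/\ (t0 g <= t%:E)%E, (t%:E <= tinfty g)%E & g t = x]].

Definition curve_direction g x : 'rV[R]_m :=
  let v := derive1 (g : R -> 'rV[R]_m) (curve_param g x) in (enorm v)^-1 *: v.

(* Set to 0 on curves that are not simple, where I_g is undefined. *)
Definition curve_current g : current1 R m := fun omega =>
  if `[< simple_curve g >]
  then tau (curve_image g) (fun=> 1) (curve_direction g) omega else 0.

Implicit Types eta : {finite_measure set (Gamma R m) -> \bar R}.

Definition curve_integral eta (A : set (Gamma R m)) : current1 R m :=
  fun omega => \int[eta]_(g in A) curve_current g omega.

(* Integrability and measurability of the integrands is made explicit because
   the library integral is total. *)
Definition good_decomposition eta (T : current1 R m) : Prop :=
  normal_current T /\
  {ae eta, forall g : Gamma R m, nonconstant g /\ simple_curve g} /\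
  (forall omega, test_form omega ->
    eta.-integrable setT (fun g => (curve_current g omega)%:E) /\
    T omega = curve_integral eta setT omega) /\
  [/\ measurable_fun setT
        ((fun g => mass1 (curve_current g)) : Gamma R m -> \bar R),
      measurable_fun setT
        ((fun g => hausdorff1 (curve_image g)) : Gamma R m -> \bar R),
      mass1 T = (\int[eta]_g mass1 (curve_current g))%E &
      (\int[eta]_g mass1 (curve_current g) =
       \int[eta]_g hausdorff1 (curve_image g))%E] /\
  [/\ measurable_fun setT
        ((fun g => mass0 (boundary (curve_current g))) : Gamma R m -> \bar R),
      mass0 (boundary T) =
        (\int[eta]_g mass0 (boundary (curve_current g)))%E &
      (\int[eta]_g mass0 (boundary (curve_current g)) = 2%:E * eta setT)%E].

Variables (M N : option nat) (x y : nat -> 'rV[R]_m).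

Definition S_current eta (i j : nat) : current1 R m := fun omega =>
  if (0 < eta (Gamma_between (x i) (y j)))%E
  then (fine (eta (Gamma_between (x i) (y j))))^-1 *
       curve_integral eta (Gamma_between (x i) (y j)) omega
  else 0.

Definition better_decomposition eta (T : current1 R m) : Prop :=
  good_decomposition eta T /\
  forall i1 i2 j1 j2,
    in_range M i1 -> in_range M i2 -> in_range N j1 -> in_range N j2 ->
    (i1 < i2)%N -> (j1 < j2)%N ->
    (forall omega, test_form omega ->
      S_current eta i1 j1 omega - S_current eta i1 j2 omega
      - S_current eta i2 j1 omega + S_current eta i2 j2 omega = 0) ->
    [/\ eta (Gamma_between (x i1) (y j1)) = 0%E,
        eta (Gamma_between (x i1) (y j2)) = 0%E,
        eta (Gamma_between (x i2) (y j1)) = 0%E &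
        eta (Gamma_between (x i2) (y j2)) = 0%E].

Definition decomposition_le eta' eta : Prop :=
  forall i j, in_range M i -> in_range N j ->
  exists2 a : R, 0 <= a &
    forall omega, test_form omega ->
      curve_integral eta' (Gamma_between (x i) (y j)) omega =
      a * curve_integral eta (Gamma_between (x i) (y j)) omega.

End Curves.

(* Main.v *)
Require Import Defs.
From HB Require Import structures.
From mathcomp Require Import all_boot all_order all_algebra.
From mathcomp Require Import all_classical all_reals all_analysis.
From mathcomp Require Import measurable_realfun.
From mathcomp Require Import ring lra.

Set Implicit Arguments.
Unset Strict Implicit.
Unset Printing Implicit Defensive.

Import Order.TTheory GRing.Theory Num.Theory.
Import numFieldNormedType.Exports.

Local Open Scope classical_set_scope.
Local Open Scope ring_scope.

(** Cut the space of curves into countably many measurable cells: the sets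
    [Gamma_between (x i) (y j)], which are disjoint because the points are
    distinct, and the set of all other curves.  Multiplying [eta] by a constant
    a_k >= 0 on the k-th cell A_k gives a measure nu for which [decomposition_le]
    holds by construction.  It remains to choose the a_k so that nu is again a
    good decomposition of T, and a better one.

    Let I_k be the current that the cell A_k contributes to T, L_k its
    contribution to the mass of T, E_k = eta (A_k) and W_k = L_k + 2 E_k.  The
    measure nu represents T exactly if sum_k (a_k - 1) I_k = 0.  If so, convexity
    of the mass gives M(T) <= sum_k a_k L_k and M(dT) <= 2 sum_k a_k E_k, whence
    sum_k a_k W_k >= M(T) + M(dT) ([total_weight_min]), and equality forces
    equality in both places, which makes nu good ([good_reweighted]).  So good
    reweightings are the solutions of least total weight of a system of linear
    equations in nonnegative unknowns.  At an extreme point of the set of these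
    solutions, the currents I_k of the cells that nu charges satisfy no finite
    linear relation: a small multiple of such a relation could be added to, and
    subtracted from, the solution.  The equality between the S_{i,j} in the
    definition of a better decomposition is a finite relation between the I_k of
    four distinct cells, and its coefficients are nonzero exactly on the cells
    that nu charges.  Hence nu charges none of the four.

    An extreme point exists, although the unknowns are infinitely many and mass
    could escape to infinity along a sequence of solutions: [extreme_point]
    minimizes a strictly concave functional whose coefficients grow along the
    cells, so slowly that the solution a_k = 1 has a finite value, and so fast
    that a bounded value controls the tails.

    The rest is about the current I_g of one simple curve g.  With a and b the
    times between which g is injective, I_g(omega) is the integral over ]a, b] of
    the pairing of omega(g t) with the velocity of g ([curve_current_arc]).
    Therefore M(I_g) is at most the length of the image of g, and, by the chain
    rule, dI_g is the difference of the Dirac masses at the end points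
    ([curve_current_gradient]), so that M(dI_g) <= 2.  As the integrals of both
    sides of these two inequalities agree for a good decomposition, equality
    holds for almost every curve; this is what survives the reweighting.  The
    formula for I_g is an instance of the area formula, proved in [curve_speed]
    for injective Lipschitz arcs by comparing two measures on the parameters: the
    length of the image and the integral of the speed. *)

(** * Euclidean geometry and Hausdorff measure *)
Section EuclideanNorm.
Context {R : realType} {m : nat}.
Implicit Types (u v : 'rV[R]_m) (c : R).

Lemma dotpC u v : dotp u v = dotp v u.
Proof. by apply: eq_bigr => i _; rewrite mulrC. Qed.

Lemma dotpDl u1 u2 v : dotp (u1 + u2) v = dotp u1 v + dotp u2 v.
Proof. by rewrite -big_split/=; apply: eq_bigr => i _; rewrite mxE mulrDl. Qed.

Lemma dotpZl c u v : dotp (c *: u) v = c * dotp u v.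
Proof. by rewrite mulr_sumr; apply: eq_bigr => i _; rewrite mxE mulrA. Qed.

Lemma dotpNl u v : dotp (- u) v = - dotp u v.
Proof. by rewrite -scaleN1r dotpZl mulN1r. Qed.

Lemma dotpDr u v1 v2 : dotp u (v1 + v2) = dotp u v1 + dotp u v2.
Proof. by rewrite !(dotpC u) dotpDl. Qed.

Lemma dotpZr c u v : dotp u (c *: v) = c * dotp u v.
Proof. by rewrite !(dotpC u) dotpZl. Qed.

Lemma dotpNr u v : dotp u (- v) = - dotp u v.
Proof. by rewrite !(dotpC u) dotpNl. Qed.

Lemma dotp_ge0 u : 0 <= dotp u u.
Proof. by apply: sumr_ge0 => i _; rewrite -expr2 sqr_ge0. Qed.

Lemma enorm_ge0 u : 0 <= enorm u.
Proof. exact: sqrtr_ge0. Qed.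

Lemma enorm_sqr u : enorm u ^+ 2 = dotp u u.
Proof. by rewrite sqr_sqrtr// dotp_ge0. Qed.

Lemma enormZ c u : enorm (c *: u) = `|c| * enorm u.
Proof.
by rewrite /enorm dotpZl dotpZr mulrA -expr2 sqrtrM ?sqr_ge0// sqrtr_sqr.
Qed.

Lemma enormN u : enorm (- u) = enorm u.
Proof. by rewrite -scaleN1r enormZ normrN normr1 mul1r. Qed.

Lemma enormB u v : enorm (u - v) = enorm (v - u).
Proof. by rewrite -enormN opprB. Qed.

Lemma coord_le_enorm u i : `|u 0 i| <= enorm u.
Proof.
rewrite -sqrtr_sqr ler_wsqrtr// /dotp (bigD1 i)//= expr2 lerDl.
by apply: sumr_ge0 => j _; rewrite -expr2 sqr_ge0.
Qed.

Lemma enorm_eq0 u : enorm u = 0 -> u = 0.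
Proof.
move=> u0; apply/rowP => i; rewrite mxE; apply/eqP.
by rewrite -normr_le0 (le_trans (coord_le_enorm u i))// u0.
Qed.

(** Cauchy-Schwarz, by expanding the square of the vector |v| u - |u| v. *)
Lemma dotp_le u v : dotp u v <= enorm u * enorm v.
Proof.
have [/enorm_eq0->|u0] := eqVneq (enorm u) 0.
  by rewrite enorm0 mul0r -(scale0r (0 : 'rV[R]_m)) dotpZl mul0r.
have [/enorm_eq0->|v0] := eqVneq (enorm v) 0.
  by rewrite enorm0 mulr0 -(scale0r (0 : 'rV[R]_m)) dotpZr mul0r.
have := dotp_ge0 (enorm v *: u - enorm u *: v).
rewrite dotpDl !dotpDr !dotpNl !dotpNr !dotpZl !dotpZr -!enorm_sqr (dotpC v u).
have {u0}: 0 < enorm u by rewrite lt_neqAle eq_sym u0 enorm_ge0.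
have {v0}: 0 < enorm v by rewrite lt_neqAle eq_sym v0 enorm_ge0.
move: (enorm u) (enorm v) (dotp u v) => a b d b0 a0.
have ab : 0 < a * b by rewrite mulr_gt0.
move=> h; rewrite -(ler_pM2l ab); nra.
Qed.

Lemma abs_dotp_le u v : `|dotp u v| <= enorm u * enorm v.
Proof. by rewrite ler_norml dotp_le andbT lerNl -dotpNl -(enormN u) dotp_le. Qed.

Lemma enormD u v : enorm (u + v) <= enorm u + enorm v.
Proof.
rewrite -ler_sqr ?nnegrE ?addr_ge0 ?enorm_ge0//.
rewrite enorm_sqr dotpDl !dotpDr (dotpC v u) -!enorm_sqr.
have := dotp_le u v; nra.
Qed.

Lemma enorm_triangle v u1 u2 : enorm (u1 - u2) <= enorm (u1 - v) + enorm (v - u2).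
Proof. by rewrite (le_trans _ (enormD _ _))// addrA subrK. Qed.

(** The balls of the topology are those of the sup norm, which is at most the
    Euclidean norm. *)
Lemma enorm_ball u v c : 0 < c -> enorm (u - v) < c -> ball u c v.
Proof.
move=> c0 uv; split => // i j; rewrite ord1.
by apply: le_lt_trans uv; have := coord_le_enorm (u - v) j; rewrite !mxE.
Qed.

Lemma enorm_le_sum u : enorm u <= \sum_i `|u 0 i|.
Proof.
have s0 (r : seq 'I_m) : 0 <= \sum_(i <- r) `|u 0 i| by apply: sumr_ge0.
rewrite -ler_sqr ?nnegrE ?enorm_ge0// enorm_sqr /dotp.
elim: (index_enum _) => [|i r IH]; first by rewrite !big_nil expr0n.
rewrite !big_cons; have := s0 r; have := normr_ge0 (u 0 i).
have -> : u 0 i * u 0 i = `|u 0 i| ^+ 2 by rewrite real_normK ?num_real.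
move: IH; set a := \sum_(_ <- _) _; set b := \sum_(_ <- _) _; set d := `|_|; nra.
Qed.

End EuclideanNorm.

Lemma dotp_continuous {R : realType} {m : nat} (u : 'rV[R]_m) :
  continuous (dotp u).
Proof.
rewrite /dotp; elim: (index_enum _) => [|i r IH] v.
  rewrite (_ : (fun _ => _) = cst 0); first exact: cst_continuous.
  by apply/funext => w; rewrite big_nil.
rewrite (_ : (fun _ => _) =
    (fun w : 'rV[R]_m => u 0 i * w 0 i + \sum_(j <- r) u 0 j * w 0 j)); last first.
  by apply/funext => w; rewrite big_cons.
have h : {for v, continuous (fun w : 'rV[R]_m => u 0 i * w 0 i)}.
  exact: (continuousM (@cst_continuous _ _ (u 0 i) v) (@coord_continuous _ _ _ 0 i v)).
exact: (continuousD h (IH v)).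
Qed.

Section Diameter.
Context {R : realType} {m : nat}.
Implicit Types A B : set 'rV[R]_m.

Lemma ediam_le A (d : R) : 0 <= d ->
  (forall x y, A x -> A y -> enorm (x - y) <= d) -> (ediam A <= d%:E)%E.
Proof.
move=> d0 Ad; rewrite /ediam ge_max lee_fin d0/=.
by apply: ge_ereal_sup => _ [[x y]/= [Ax Ay] <-]; rewrite lee_fin Ad.
Qed.

Lemma le_ediam A x y : A x -> A y -> ((enorm (x - y))%:E <= ediam A)%E.
Proof.
move=> Ax Ay; rewrite /ediam le_max; apply/orP; right.
by apply: ereal_sup_ubound; exists (x, y).
Qed.

End Diameter.

Section MetricOuterMeasure.
Context {R : realType} {m : nat}.
Local Open Scope ereal_scope.
Notation H := (@hausdorff1 R m).
Implicit Types A B C X : set 'rV[R]_m.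

Lemma le_hausdorff1_content_delta (d1 d2 : R) A : (d1 <= d2)%R ->
  hausdorff1_content d2 A <= hausdorff1_content d1 A.
Proof.
move=> d12; apply: le_ereal_inf_tmp => _ [U [AU dU] <-]; apply: ereal_inf_lbound.
by exists U => //; split => // k; rewrite (le_trans (dU k))// lee_fin.
Qed.

(** A set of diameter less than r meets at most one of A and B, so every cover of
    the union splits into a cover of A and a cover of B. *)
Lemma hausdorff1_content_separated (r d : R) A B : (d < r)%R ->
  (forall x y, A x -> B y -> r <= enorm (x - y))%R ->
  hausdorff1_content d A + hausdorff1_content d B <= hausdorff1_content d (A `|` B).
Proof.
move=> dr AB; apply: le_ereal_inf_tmp => _ [U [ABU dU] <-].
pose only C k := if `[< U k `&` C !=set0 >] then U k else set0.
have onlyd C k : ediam (only C k) <= d%:E.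
  rewrite /only; case: ifP => // _; rewrite ediam0.
  by apply: le_trans (dU k); exact: ediam_ge0.
have onlyC C : C `<=` A `|` B -> C `<=` \bigcup_k only C k.
  move=> CAB x Cx; have [k _ Ukx] := ABU _ (CAB _ Cx).
  by exists k => //; rewrite /only asboolT//; exists x.
apply: (@le_trans _ _ (\sum_(0 <= k <oo) ediam (only A k) + \sum_(0 <= k <oo) ediam (only B k))).
  by apply: leeD; apply: ereal_inf_lbound; [exists (only A)|exists (only B)] => //;
    split => //; apply: onlyC => x; [left|right].
rewrite -nneseriesD; [|by move=> *; exact: ediam_ge0..].
apply: lee_nneseries => [k _ _|k _]; first by rewrite adde_ge0 ?ediam_ge0.
rewrite /only; case: asboolP => [[x [Ux Ax]]|_]; case: asboolP => [[y [Uy By]]|_];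
  rewrite ?ediam0 ?adde0 ?add0e ?ediam_ge0//.
have := le_ediam Ux Uy => /le_trans/(_ (dU k)).
by rewrite lee_fin => /(le_trans (AB _ _ Ax By)); rewrite leNgt dr.
Qed.

Lemma hausdorff1_separated (r : R) A B : (0 < r)%R ->
  (forall x y, A x -> B y -> r <= enorm (x - y))%R -> H A + H B <= H (A `|` B).
Proof.
move=> r0 AB.
have [->|] := eqVneq (H (A `|` B)) +oo; first by rewrite leey.
rewrite -ltey => ABy.
have fH C : C `<=` A `|` B -> H C \is a fin_num.
  by move=> CAB; rewrite ge0_fin_numE ?hausdorff1_ge0//
    (le_lt_trans (le_hausdorff1 CAB)).
have fA : H A \is a fin_num by apply: fH => x; left.
have fAB : H (A `|` B) \is a fin_num by apply: fH.
have key (d1 d2 : R) : (0 < d1)%R -> (0 < d2)%R ->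
    hausdorff1_content d1 A + hausdorff1_content d2 B <= H (A `|` B).
  move=> d10 d20; pose d := Num.min (Num.min d1 d2) (r / 2)%R.
  have d0 : (0 < d)%R by rewrite !lt_min d10 d20 divr_gt0.
  have dr : (d < r)%R by rewrite gt_min; apply/orP; right; lra.
  apply: (@le_trans _ _ (hausdorff1_content d A + hausdorff1_content d B)).
    by apply: leeD; apply: le_hausdorff1_content_delta; rewrite /d !ge_min lexx ?orbT.
  apply: le_trans (hausdorff1_content_separated dr AB) _.
  by apply: ereal_sup_ubound; exists d.
have fcB (d : R) : (0 < d)%R -> hausdorff1_content d B \is a fin_num.
  move=> d0; rewrite ge0_fin_numE ?hausdorff1_content_ge0//.
  apply: le_lt_trans ABy; apply: (@le_trans _ _ (H B)).
    by apply: ereal_sup_ubound; exists d.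
  by apply: le_hausdorff1 => x; right.
rewrite -leeBrDl//; apply: ge_ereal_sup => _ [d2 /= d20 <-].
rewrite leeBrDl// -leeBrDr ?fcB//; apply: ge_ereal_sup => _ [d1 /= d10 <-].
by rewrite leeBrDr ?fcB// key.
Qed.

Lemma hausdorff1_separated_sum (F : nat -> set 'rV[R]_m) X N :
  (forall n, F n `<=` X) ->
  (forall n, exists2 r : R, (0 < r)%R & forall x y, F n x ->
     (\bigcup_(k in `I_n) F k) y -> (r <= enorm (x - y))%R) ->
  \sum_(0 <= k < N) H (F k) <= H X.
Proof.
move=> FX sep; apply: (@le_trans _ _ (H (\bigcup_(k in `I_N) F k))); last first.
  by apply: le_hausdorff1 => x [k _ /FX].
elim: N => [|N IH]; first by rewrite big_geq// hausdorff1_ge0.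
rewrite big_nat_recr//=; have [r r0 rsep] := sep N.
apply: le_trans (leeD2r _ IH) _; rewrite addeC.
apply: le_trans (hausdorff1_separated r0 rsep) _.
apply: le_hausdorff1 => x [FNx|[k /= kN Fkx]]; first by exists N => /=.
by exists k => //=; rewrite ltnS ltnW.
Qed.

(** As for every metric outer measure.  Outside of C, the set X is the union of
    its parts at distance at least 1/n from C, which are separated from C.  The
    shells F n between consecutive parts have summable measures, because shells
    whose indices differ by 2 or more are separated; so for large n the n-th part
    misses little of X outside of C. *)
Lemma closed_caratheodory C :
  (forall x, (forall r : R, (0 < r)%R -> exists2 c, C c & (enorm (x - c) < r)%R) -> C x) ->
  (H1_outer R m).-caratheodory C.
Proof.
move=> Ccl; apply: le_caratheodory_measurable => X.
change (H (X `&` C) + H (X `&` ~` C) <= H X).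
have [->|] := eqVneq (H X) +oo; first by rewrite leey.
rewrite -ltey => Xy.
pose U n := [set x : 'rV[R]_m | exists2 c, C c & (enorm (x - c) < n.+1%:R^-1)%R].
have Ule n1 n2 : (n1 <= n2)%N -> U n2 `<=` U n1.
  move=> n12 x [c Cc xc]; exists c => //; apply: lt_le_trans xc _.
  by rewrite lef_pV2 ?posrE// ler_nat ltnS.
pose F n := X `&` (U n `\` U n.+1).
have FX n : F n `<=` X by move=> x [].
have Fsep i j : (i.+2 <= j)%N -> exists2 r : R, (0 < r)%R & forall x y, F j x ->
     forall k, (k.+2 <= j)%N -> F k y -> (r <= enorm (x - y))%R.
  case: j => [|[|j]]//= _.
  exists (j.+2%:R^-1 - j.+3%:R^-1)%R; first by rewrite subr_gt0 ltf_pV2 ?posrE// ltr_nat.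
  move=> x y [_ [[c Cc xc] _]] k kj [_ [_ yU]].
  have : ~ U j.+1 y by move=> Uy; apply: yU; apply: Ule Uy; rewrite !ltnS in kj *.
  move=> yUj; rewrite leNgt; apply/negP => xy; apply: yUj; exists c => //.
  rewrite -(subrK j.+3%:R^-1 j.+2%:R^-1)%R.
  by rewrite (le_lt_trans (enorm_triangle x y c))// ltrD// enormB.
(* the shells with indices of one parity are pairwise separated *)
have par b N : \sum_(0 <= k < N) H (F (b + k.*2)%N) <= H X.
  apply: hausdorff1_separated_sum => [n|[|n]]; first exact: FX.
    by exists 1%R => // x y _ [k].
  have [|r r0 rsep] := @Fsep 0%N (b + n.+1.*2)%N; first by rewrite doubleS !addnS.
  exists r => // x y Fx [k /= kn Fky]; apply: rsep Fky => //.
  by rewrite -!addnS leq_add2l doubleS !ltnS leq_double.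
have sumF N : \sum_(0 <= k < N) H (F k) <= H X + H X.
  apply: (@le_trans _ _ (\sum_(0 <= k < N.*2) H (F k))).
    rewrite [leRHS](big_cat_nat (n := N))//= -?addnn ?leq_addr// leeDl// sume_ge0// => k _.
    exact: hausdorff1_ge0.
  apply: (@le_trans _ _ (\sum_(0 <= k < N) H (F (0 + k.*2)%N) +
                       \sum_(0 <= k < N) H (F (1 + k.*2)%N))); last first.
    by apply: leeD.
  elim: N => [|N IH]; first by rewrite !big_geq// adde0.
  rewrite doubleS (big_nat_recr N.*2.+1)//= (big_nat_recr N.*2)//=.
  rewrite [X in _ <= X + _](big_nat_recr N)//= [X in _ <= _ + X](big_nat_recr N)//=.
  by rewrite add0n add1n -addeA [leRHS]addeACA leeD2r.
have sFy : \sum_(0 <= k <oo) H (F k) < +oo.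
  apply: (@le_lt_trans _ _ (H X + H X)); last by rewrite lte_add_pinfty.
  apply: lime_le; first by apply: is_cvg_nneseries => *; exact: hausdorff1_ge0.
  by apply: nearW.
have tail := nneseries_tail_cvg sFy (fun k _ => hausdorff1_ge0 (F k)).
have step n : H (X `&` C) + H (X `&` ~` C) <= H X + \sum_(n <= k <oo) H (F k).
  apply: (@le_trans _ _ (H (X `&` C) + (H (X `\` U n) + \sum_(n <= k <oo) H (F k)))).
    apply: leeD2l; apply: (@le_trans _ _ (H ((X `\` U n) `|` \bigcup_k F (n + k)%N))).
      apply: le_hausdorff1 => x [Xx Cx].
      have [Unx|Unx] := pselect (U n x); last by left.
      right; suff [k Uk Uk1] : exists2 k, U (n + k)%N x & ~ U (n + k.+1)%N x.
        by exists k => //; split => //; split => //; rewrite -addnS.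
      apply: contrapT => h; apply: Cx; apply: Ccl => r r0.
      have Uall k : U (n + k)%N x.
        elim: k => [|k IH]; first by rewrite addn0.
        by apply: contrapT => nU; apply: h; exists k.
      have [k _ /(_ _ (leqnn _)) hk] := near_infty_natSinv_lt (PosNum r0).
      have [c Cc xc] := Ule _ _ (leq_addl n k) _ (Uall k).
      by exists c => //; exact: lt_trans xc hk.
    apply: le_trans (outer_measureU2 (H1_outer R m) _ _) _.
    apply: leeD2l; apply: le_trans (hausdorff1_sigma_subadditive _) _.
    rewrite -(@nneseries_addn _ (fun k => H (F k)) n) => [|k]; last exact: hausdorff1_ge0.
    by apply: lee_nneseries => [k _ _|k _]; rewrite ?hausdorff1_ge0// addnC.
  rewrite addeA leeD2r//.
  have n0 : (0 < n.+1%:R^-1 :> R)%R by rewrite invr_gt0.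
  apply: le_trans (hausdorff1_separated n0 _) _; last by apply: le_hausdorff1 => x [[]|[]].
  move=> x y [_ Cx] [_ Uy]; rewrite leNgt; apply/negP => xy; apply: Uy.
  by exists x => //; rewrite enormB.
have lim : H X + \sum_(n <= k <oo) H (F k) @[n --> \oo] --> H X + 0.
  by apply: cvgeD => //; [rewrite fin_num_adde_defl|exact: cvg_cst].
rewrite adde0 in lim; rewrite -(cvg_lim _ lim)//.
by apply: lime_ge; [apply/cvg_ex; exists (H X)|exact: nearW].
Qed.

Lemma compact_measurable_H1 C : compact C -> measurable (C : set (H1_space R m)).
Proof.
move=> cC; apply: closed_caratheodory => x xC.
have clC : closed C by apply: compact_closed => //; exact: norm_hausdorff.
apply: clC => B /nbhs_ballP[r /= r0 rB].
have [c Cc xc] := xC r r0; exists c; split => //; apply: rB.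
exact: enorm_ball.
Qed.

End MetricOuterMeasure.

Section HausdorffCurve.
Context {R : realType} {m : nat}.
Notation H := (@hausdorff1 R m).
Implicit Types g : R -> 'rV[R]_m.

(** Cut the interval into n + 1 equal pieces.  The image of each piece has diameter
    at most the increment of L, and these increments add up; they are below the
    prescribed scale for large n because L is 1-Lipschitz. *)
Lemma hausdorff1_curve_le g (L : R -> R) (s t : R) : s <= t ->
  (forall a b, s <= a -> a <= b -> b <= t -> enorm (g b - g a) <= L b - L a) ->
  (forall a b, s <= a -> a <= b -> b <= t -> L b - L a <= b - a) ->
  (H (g @` `[s, t]) <= (L t - L s)%:E)%E.
Proof.
move=> st gL L1; apply: ge_ereal_sup => _ [d /= d0 <-].
have Lmono a b : s <= a -> a <= b -> b <= t -> 0 <= L b - L a.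
  by move=> sa ab bt; apply: le_trans (gL _ _ sa ab bt); exact: enorm_ge0.
have [n nd] : exists n : nat, (t - s) / n.+1%:R <= d.
  exists (Num.trunc ((t - s) / d)).
  rewrite ler_pdivrMr// -ler_pdivrMl// mulrC ltW//.
  by apply: truncnS_gt; rewrite ?num_real.
set h := (t - s) / n.+1%:R in nd.
have h0 : 0 <= h by rewrite divr_ge0// subr_ge0.
have hn : h * n.+1%:R = t - s by rewrite mulfVK.
pose p k : R := s + h * k%:R.
have p0 : p 0%N = s by rewrite /p mulr0 addr0.
have pn : p n.+1 = t by rewrite /p hn; lra.
have pS k : p k.+1 = p k + h by rewrite /p -natr1; ring.
have sp k : s <= p k by rewrite lerDl mulr_ge0.
have pt k : (k <= n.+1)%N -> p k <= t.
  by move=> kn; rewrite -pn lerD2l ler_wpM2l// ler_nat.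
pose U k := if (k <= n)%N then g @` `[p k, p k.+1] else set0.
have dU k : (k <= n)%N -> (ediam (U k) <= (L (p k.+1) - L (p k))%:E)%E.
  move=> kn; rewrite /U kn.
  have pp : p k <= p k.+1 by rewrite pS lerDl.
  apply: ediam_le; first by rewrite Lmono// pt.
  suff key a b : p k <= a -> a <= b -> b <= p k.+1 ->
      enorm (g b - g a) <= L (p k.+1) - L (p k).
    move=> _ _ [a /= /[!in_itv]/= /andP[a1 a2] <-] [b /= /[!in_itv]/= /andP[b1 b2] <-].
    by have [ab|/ltW ab] := leP a b; [rewrite enormB|]; apply: key.
  move=> pa ab bp.
  have bt : b <= t by rewrite (le_trans bp)// pt.
  have sa : s <= a by rewrite (le_trans (sp k)).
  apply: le_trans (gL _ _ sa ab bt) _.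
  have := Lmono _ _ (sp k) pa (le_trans ab bt).
  have := Lmono _ _ (le_trans sa ab) bp (pt k.+1 kn); lra.
apply: (@le_trans _ _ (\sum_(0 <= k <oo) ediam (U k))%E).
  apply: ereal_inf_lbound; exists U => //; split.
    suff cov k : (k <= n.+1)%N -> forall a, s <= a <= p k ->
        exists2 j, (j < k)%N \/ (j = 0)%N & p j <= a <= p j.+1.
      move=> _ [a /= /[!in_itv]/= /andP[sa at_] <-].
      have [|j jn /andP[j1 j2]] := cov n.+1 (leqnn _) a; first by rewrite sa pn.
      have {}jn : (j <= n)%N by case: jn => [|->].
      by exists j => //; rewrite /U jn; exists a => //=; rewrite in_itv/= j1.
    elim: k => [_ a|k IH kn a].
      rewrite p0 => /andP[sa as_]; exists 0%N; first by right.
      by rewrite p0 sa (le_trans as_)// sp.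
    move=> /andP[sa ap]; have [apk|/ltW pka] := leP a (p k).
      have [|j jk ?] := IH (ltnW kn) a; first by rewrite sa.
      by exists j => //; case: jk => [jk|]; [left; rewrite ltnS ltnW|right].
    by exists k; [left|rewrite pka].
  move=> k; rewrite /U; case: ifPn => kn; last by rewrite ediam0 lee_fin ltW.
  have := dU k kn; rewrite /U kn => /le_trans; apply; rewrite lee_fin.
  apply: le_trans nd; apply: le_trans (L1 _ _ (sp k) _ (pt k.+1 kn)) _.
    by rewrite pS lerDl.
  by rewrite pS; lra.
rewrite (nneseries_split 0%N n.+1)//=; last by move=> *; exact: ediam_ge0.
rewrite add0n [X in (_ + X)%E]eseries0 ?adde0; last first.
  by move=> k nk _; rewrite /U leqNgt nk/= ediam0.
apply: (@le_trans _ _ (\sum_(0 <= k < n.+1) (L (p k.+1) - L (p k))%:E)%E).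
  rewrite big_nat [leRHS]big_nat; apply: lee_sum => k /andP[_ kn]; exact: dU.
rewrite sumEFin lee_fin telescope_sumr// p0 pn; lra.
Qed.

(** Orthogonal projection to the line through the two end points does not increase
    diameters, and by the intermediate value theorem the projected arc contains
    the whole segment. *)
Lemma hausdorff1_curve_ge g (s t : R) : s <= t -> continuous g ->
  ((enorm (g t - g s))%:E <= H (g @` `[s, t]))%E.
Proof.
move=> st cg; have [->|d0] := eqVneq (enorm (g t - g s)) 0; first exact: hausdorff1_ge0.
set d := enorm _ in d0 *.
have {}d0 : 0 < d by rewrite lt_neqAle eq_sym d0 enorm_ge0.
pose e := d^-1 *: (g t - g s).
have e1 : enorm e = 1 by rewrite enormZ ger0_norm ?invr_ge0 ?enorm_ge0// mulVf// gt_eqF.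
apply: (@le_trans _ _ (hausdorff1_content 1 (g @` `[s, t]))); last first.
  by apply: ereal_sup_ubound; exists 1 => //=.
apply: le_ereal_inf_tmp => _ [U [gU dU] <-].
have fU k : ediam (U k) \is a fin_num.
  by rewrite ge0_fin_numE ?ediam_ge0// (le_lt_trans (dU k))// ltry.
pose c k := inf [set dotp e x | x in U k].
(* an interval as long as the diameter of U k, around the projection of U k *)
pose I k : set (measurableTypeR R) := if `[< U k !=set0 >] then `[c k, c k + fine (ediam (U k))]%classic else set0.
have dU0 k : 0 <= fine (ediam (U k)) by rewrite fine_ge0// ediam_ge0.
have UI k x : U k x -> I k (dotp e x).
  move=> Ukx; rewrite /I asboolT; last by exists x.
  have lb y : U k y -> dotp e x - fine (ediam (U k)) <= dotp e y.
    move=> Uky; have := le_ediam Ukx Uky.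
    rewrite -[ediam _]fineK// lee_fin => h.
    have := dotp_le e (x - y); rewrite e1 mul1r dotpDr dotpNr; lra.
  rewrite /= in_itv/=; apply/andP; split.
    by apply: inf_lbound; [exists (dotp e x - fine (ediam (U k))) => _ [y Uy <-]; exact: lb|exists x].
  rewrite -lerBlDr; apply: lb_le_inf; first by exists (dotp e x), x.
  by move=> _ [y Uy <-]; exact: lb.
have lI k : (lebesgue_measure (I k) <= ediam (U k))%E.
  rewrite /I; case: ifP => _; last by rewrite measure0 ediam_ge0.
  rewrite lebesgue_measure_itv/= lte_fin ltrDl; case: ifP => [_|_]; last exact: ediam_ge0.
  by rewrite -EFinD addrAC subrr add0r fineK.
have mI k : measurable (I k : set (measurableTypeR R)) by rewrite /I; case: ifP.
pose q a := dotp e (g a).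
have qst : q t - q s = d.
  have dn : d != 0 by rewrite gt_eqF.
  by rewrite /q -dotpNr -dotpDr dotpZl -enorm_sqr -/d expr2 mulrA mulVf// mul1r.
have cq : {within `[s, t], continuous q}.
  apply: continuous_subspaceT => a.
  by apply: (@continuous_comp _ _ _ g (dotp e)); [exact: cg|exact: dotp_continuous].
have Icov : `[q s, q t] `<=` \bigcup_k I k.
  move=> v /= /[!in_itv]/= /andP[v1 v2].
  have [|a /[!in_itv]/= ast av] := @IVT _ q s t v st cq.
    by rewrite ge_min v1 le_max v2 orbT.
  have [k _ Uk] : (\bigcup_k U k) (g a) by apply: gU; exists a.
  by exists k => //; rewrite -av; exact: UI.
apply: (@le_trans _ _ (lebesgue_measure `[q s, q t]%classic)).
  by rewrite lebesgue_measure_itv/= lte_fin -subr_gt0 qst d0 -EFinD qst.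
apply: (le_trans (@measure_sigma_subadditive _ _ (measurableTypeR R) lebesgue_measure _ _ mI _ Icov)) => //.
by apply: lee_nneseries => [k _ _|k _]; [exact: measure_ge0|exact: lI].
Qed.

End HausdorffCurve.

(** * Measures of bounded density and Lipschitz functions *)
Lemma lipschitz_continuous {R : realType} (u : R -> R) (C : R) :
  (forall s t, `|u s - u t| <= C * `|s - t|) -> continuous u.
Proof.
move=> uC x; apply/cvgrPdist_lt => e e0.
have D0 : 0 < `|C| + 1 by rewrite ltr_wpDl.
near=> y; apply: (le_lt_trans (uC x y)).
apply: (@le_lt_trans _ _ ((`|C| + 1) * `|x - y|)).
  by rewrite ler_wpM2r// (le_trans (ler_norm _))// lerDl.
rewrite -ltr_pdivlMl// mulrC; near: y.
by apply: (@cvgr_dist_lt _ _ _ (nbhs x) _ id x cvg_id); rewrite divr_gt0.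
Unshelve. all: by end_near. Qed.

Section Density.
Context {R : realType}.
Notation lam := (@lebesgue_measure R).
Local Open Scope ereal_scope.

(** Lebesgue measure is an infimum over covers by half-open intervals, so a bound on
    these intervals carries over to all Borel sets. *)
Lemma le_lebesgue_measure (nu : {measure set (measurableTypeR R) -> \bar R}) (C : R) :
  (0 < C)%R ->
  (forall a b : R, (a < b)%R -> nu `]a, b]%classic <= (C * (b - a))%:E) ->
  forall A : set (measurableTypeR R), measurable A -> nu A <= C%:E * lam A.
Proof.
move=> C0 nuC A mA.
rewrite -lee_pdivrMl//.
apply: le_ereal_inf_tmp => _ [F [mF AF] <-].
have mF' k : measurable (F k : set (measurableTypeR R)) by exact: sub_sigma_algebra.
have l0 k : 0 <= wlength idfun (F k) by exact: (wlength_ge0 (idfun : cumulative R R)).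
rewrite lee_pdivrMl// -nneseriesZl//.
apply: le_trans (measure_sigma_subadditive nu mF' mA AF) _.
apply: lee_nneseries => [k _ _|k _]; first exact: measure_ge0.
have /ocitvP[->|[[a b]/= ab ->]] := mF k; first by rewrite measure0 mule_ge0// lee_fin ltW.
rewrite (le_trans (nuC _ _ ab))// wlength_itv/= lte_fin ab -EFinD -EFinM//.
Qed.

Lemma null_dominates_lebesgue (nu : {measure set (measurableTypeR R) -> \bar R}) (C : R) :
  (0 < C)%R ->
  (forall a b : R, (a < b)%R -> nu `]a, b]%classic <= (C * (b - a))%:E) ->
  nu `<< lam.
Proof.
move=> C0 nuC; apply/null_content_dominatesP => A mA A0; apply/eqP; rewrite eq_le measure_ge0 andbT.
by rewrite (le_trans (le_lebesgue_measure C0 nuC mA))// [lam A]A0 mule0.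
Qed.

(** The Radon-Nikodym density; by Lebesgue differentiation it is almost everywhere
    the derivative of the distribution function. *)
Lemma finite_measure_density (nu : {finite_measure set (measurableTypeR R) -> \bar R}) :
  nu `<< lam -> exists rho : R -> R,
  [/\ lam.-integrable setT (EFin \o rho),
      forall A : set (measurableTypeR R), measurable A -> nu A = \int[lam]_(x in A) (rho x)%:E,
      {ae lam, forall t, is_derive t (1%R : R) (fun x => fine (nu `]-oo, x]%classic) : R^o) (rho t)} &
      forall (E : set (measurableTypeR R)) (f : R -> \bar R), measurable E ->
        nu.-integrable E f ->
        \int[lam]_(x in E) (f x * (rho x)%:E) = \int[nu]_(x in E) f x].
Proof.
move=> nl; pose RN := Radon_Nikodym (charge_of_finite_measure nu) lam.
have fRN x : RN x \is a fin_num by exact: Radon_Nikodym_fin_num.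
have RNE : EFin \o (fine \o RN) = RN by apply/funext => x /=; rewrite fineK.
have irho : lam.-integrable setT (EFin \o (fine \o RN)).
  by rewrite RNE; exact: Radon_Nikodym_integrable.
have nuE (A : set (measurableTypeR R)) : measurable A -> nu A = \int[lam]_(x in A) (fine (RN x))%:E.
  move=> mA; under eq_integral do rewrite fineK//.
  by rewrite /RN -Radon_Nikodym_integral.
exists (fine \o RN); split => //.
- have : {ae lam, forall x, derivable ((fun x => \int[lam]_(t in `]-oo, x]) (fine (RN t)))%R : R -> R^o) x 1%R /\
       ((fun x => \int[lam]_(t in `]-oo, x]) (fine (RN t)))%R^`()%classic x = fine (RN x)%R)}.
    apply: FTC1Ny => [y|]; first exact: integrableS irho.
    by apply: open_integrable_locally => //; exact: openT.
  apply: (@filterS _ _ (ae_filter_ringOfSetsType lam)) => t [d1 d2].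
  have -> : (fun x => fine (nu `]-oo, x]%classic)) = (fun x => \int[lam]_(t in `]-oo, x]) (fine (RN t)))%R.
    by apply/funext => x; rewrite nuE.
  by apply: DeriveDef; [exact: d1|rewrite -derive1E; exact: d2].
- move=> E f mE fE; under eq_integral do rewrite fineK//.
  exact: Radon_Nikodym_change_of_variables.
Qed.

Lemma lebesgue_stieltjes_itv (f : cumulative R R) (a b : R) : (a <= b)%R ->
  lebesgue_stieltjes_measure f `]a, b]%classic = (f b - f a)%:E.
Proof.
move=> ab; rewrite /lebesgue_stieltjes_measure /measure_extension measurable_mu_extE/=; last exact: is_ocitv.
by rewrite wlength_itv_bnd.
Qed.

(** After adding C t, the function u is nondecreasing, hence defines a Stieltjes
    measure; this measure is at most a multiple of Lebesgue measure, and its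
    density is the derivative looked for, up to the constant C. *)
Lemma lipschitz_density (u : R -> R) (C a b : R) : (a < b)%R ->
  (forall s t, `|u s - u t| <= C * `|s - t|)%R ->
  exists h : R -> R,
  [/\ measurable_fun setT h, lam.-integrable `]a, b] (EFin \o h),
      forall s t, (a <= s)%R -> (s <= t)%R -> (t <= b)%R ->
        (u t - u s = \int[lam]_(x in `]s, t]) h x)%R &
      {ae lam, forall t, (a < t < b)%R -> is_derive t (1%R : R) (u : R -> R^o) (h t)}].
Proof.
move=> ab uC.
have C0 : (0 <= C)%R.
  have := uC a b; have : (0 < `|a - b|)%R by rewrite normr_gt0 subr_eq0 lt_eqF.
  move=> d0 h; have : (0 <= C * `|a - b|)%R by apply: le_trans h.
  by rewrite pmulr_lge0.
pose v t : R := (u t + C * t)%R.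
have vb s t : (s <= t)%R -> (0 <= v t - v s <= (C + C) * (t - s))%R.
  move=> st; have := uC t s; rewrite (@ger0_norm _ (t - s)) ?subr_ge0// ler_norml /v.
  move: st; set z := (C * (t - s))%R; move=> st /andP[h1 h2].
  have E1 : (u t + C * t - (u s + C * s) = u t - u s + z)%R by rewrite /z; ring.
  have E2 : ((C + C) * (t - s) = z + z)%R by rewrite /z; ring.
  by rewrite E1 E2; apply/andP; split; lra.
have vnd : {homo v : x y / (x <= y)%R}.
  by move=> x y xy; rewrite -subr_ge0; have /andP[] := vb _ _ xy.
have vrc : right_continuous v.
  apply: right_continuousW; apply: (@lipschitz_continuous _ _ (C + C)%R) => s t.
  wlog st : s t / (s <= t)%R.
    move=> h; have [|/ltW] := leP s t; first exact: h.
    by rewrite distrC (distrC s); exact: h.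
  have /andP[h1 h2] := vb _ _ st.
  by rewrite distrC (distrC s) ger0_norm// (ger0_norm (_ : 0 <= t - s)%R)// subr_ge0.
pose V : cumulative R R := HB.pack v (isCumulative.Build R _ R v vnd vrc).
pose mI : measurable (`]a, b]%classic : set (measurableTypeR R)) := measurable_itv _.
have fI : lebesgue_stieltjes_measure V `]a, b]%classic < +oo.
  by rewrite lebesgue_stieltjes_itv ?ltW// ltry.
pose nu : {finite_measure set (measurableTypeR R) -> \bar R} := mfrestr mI fI.
have nuE (A : set R) : nu A = lebesgue_stieltjes_measure V (A `&` `]a, b]%classic) by [].
have nuI s t : (a <= s)%R -> (s <= t)%R -> (t <= b)%R -> nu `]s, t]%classic = (v t - v s)%:E.
  move=> as_ st tb; rewrite nuE setIidl ?lebesgue_stieltjes_itv//.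
  by apply: subset_itv; rewrite bnd_simp.
have nuC s t : (s < t)%R -> nu `]s, t]%classic <= ((C + C + 1) * (t - s))%:E.
  move=> st; rewrite nuE.
  apply: (@le_trans _ _ (lebesgue_stieltjes_measure V `]s, t]%classic)).
    by apply: le_measure; rewrite ?inE//=; apply: measurableI.
  rewrite (lebesgue_stieltjes_itv V (ltW st)) lee_fin.
  have /andP[_ h] := vb _ _ (ltW st); apply: le_trans h _.
  by apply: ler_wpM2r; [rewrite subr_ge0 ltW|rewrite lerDl].
have /finite_measure_density[rho [irho rhoE rhoD _]] : nu `<< lam.
  by apply: (null_dominates_lebesgue _ nuC); rewrite ltr_wpDl// addr_ge0.
have sub s t : (a <= s)%R -> (t <= b)%R -> `]s, t] `<=` `]a, b].
  by move=> as_ tb; apply: subset_itv; rewrite bnd_simp.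
have lamf s t : lam `]s, t]%classic < +oo.
  by rewrite lebesgue_measure_itv/=; case: ifP => // _; rewrite -EFinD ltry.
have ic (A : set R) s t : A = `]s, t]%classic -> lam.-integrable A (EFin \o cst C).
  move=> ->; apply: measurable_bounded_integrable; [exact: measurable_itv|exact: lamf|exact: measurable_cst|].
  by exists `|C|%R; split; [exact: normr_real|move=> M CM x _ /=; exact: ltW].
exists (fun t => rho t - C)%R; split.
- by apply: measurable_funB => //; apply/measurable_EFinP; exact: measurable_int irho.
- under [X in integrable _ _ X]eq_fun do rewrite /= EFinB.
  by apply: integrableB => //; [exact: integrableS irho|exact: ic].
- move=> s t as_ st tb; rewrite RintegralB//; [|exact: integrableS irho|exact: ic].
  rewrite Rintegral_cst// /Rintegral -rhoE// nuI//= lebesgue_measure_itv/= lte_fin.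
  rewrite /v; move: st; rewrite le_eqVlt => /predU1P[->|st]; first by rewrite ltxx/=; ring.
  by rewrite st/=; ring.
- move: rhoD; apply: (@filterS _ _ (ae_filter_ringOfSetsType lam)) => t ht /andP[a_t tb].
  have D : is_derive t (1%R : R) (((fun x => fine (nu `]-oo, x]%classic)) : R -> R^o) + cst (v a) -
      C \*: (id : R -> R^o))%R (rho t + 0 - C *: 1)%R.
    by apply: is_deriveB.
  rewrite addr0 scaler1 in D; apply: near_eq_is_derive D.
  near=> x.
  have : x \in `]a, b[ by near: x; apply: near_in_itvoo; rewrite in_itv/= a_t.
  rewrite in_itv/= => /andP[/ltW ax /ltW xb].
  have -> : u x = (v x - C * x)%R by rewrite /v addrK.
  rewrite /= !fctE/=; congr (_ - _)%R.
  rewrite nuE (_ : _ `&` _ = `]a, x]%classic); last first.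
    apply/seteqP; split => y /=; rewrite !in_itv/=.
      by move=> [-> /andP[-> _]].
    by move=> /andP[-> yx]; rewrite yx; split=> //; exact: le_trans xb.
  by rewrite lebesgue_stieltjes_itv//= subrK.
Unshelve. all: by end_near. Qed.

End Density.

(** * Test functions and test forms *)
Section SmoothFunctions.
Context {R : realType} {m : nat}.
Notation V := 'rV[R]_m.

Lemma cvg_finite_sum (T : Type) (F : set_system T) (I : Type) (r : seq I)
    (f : I -> T -> R) (l : I -> R) : Filter F ->
  (forall i, f i x @[x --> F] --> l i) ->
  \sum_(i <- r) f i x @[x --> F] --> \sum_(i <- r) l i.
Proof.
move=> FF fl; elim: r => [|i r IH].
  rewrite big_nil (_ : (fun _ => _) = cst 0); first exact: cvg_cst.
  by apply/funext => x; rewrite big_nil.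
rewrite big_cons (_ : (fun _ => _) = (fun x => f i x + \sum_(j <- r) f j x)).
  exact: (cvgD (fl i) IH).
by apply/funext => x; rewrite big_cons.
Qed.

Lemma rV_norm_le (x : V) (e : R) : 0 <= e -> (forall j, `|x 0 j| <= e) -> `|x| <= e.
Proof.
move=> e0 xe; rewrite [leLHS]/Num.norm /= mx_normrE.
by apply: bigmax_le => // -[i j] _ /=; rewrite ord1.
Qed.

Lemma rV_coord_le (x : V) j : `|x 0 j| <= `|x|.
Proof.
rewrite [leRHS]/Num.norm /= mx_normrE.
exact: (le_bigmax _ (fun ij : 'I_1 * 'I_m => `|x ij.1 ij.2|) (0, j)).
Qed.

Lemma partial_is_derive (f : V -> R) i (z : V) s :
  (forall x, derivable (f : V -> R^o) x (delta_mx 0 i : V)) ->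
  is_derive s (1 : R) (fun s => f (z + s *: delta_mx 0 i) : R^o)
    (partial i f (z + s *: delta_mx 0 i)).
Proof.
move=> df.
have E : (fun h : R => h^-1 *: ((f (z + (h *: (1 : R) + s) *: delta_mx 0 i) : R^o) -
             f (z + s *: delta_mx 0 i))) =
         (fun h : R => h^-1 *: ((f : V -> R^o) (h *: (delta_mx 0 i : V) +
             (z + s *: delta_mx 0 i)) - f (z + s *: delta_mx 0 i))).
  apply/funext => h; congr (_ *: (f _ - _)).
  by rewrite scalerDl [h *: 1]mulr1 addrCA.
apply: DeriveDef.
  by rewrite /derivable E; exact: df.
by rewrite /partial /derive E.
Qed.

(** Pass from a to b by changing one coordinate at a time, and use the mean value
    theorem along each axis. *)
Lemma coordinate_mean_value (f : V -> R) (a b : V) :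
  (forall i x, derivable (f : V -> R^o) x (delta_mx 0 i : V)) ->
  exists c : 'I_m -> V, (forall i, `|c i - a| <= `|b - a|) /\
    f b - f a = \sum_i partial i f (c i) * (b 0 i - a 0 i).
Proof.
move=> df; pose z k : V := \row_j if (j < k)%N then b 0 j else a 0 j.
have z0 : z 0%N = a by apply/rowP => j; rewrite mxE.
have zm : z m = b by apply/rowP => j; rewrite mxE ltn_ord.
have zS (i : 'I_m) : z i.+1 = z i + (b 0 i - a 0 i) *: delta_mx 0 i.
  apply/rowP => j; rewrite !mxE eqxx/= ltnS leq_eqVlt eq_sym.
  have [->|ij] := eqVneq i j; first by rewrite eqxx/= ltnn mulr1 addrC subrK.
  by rewrite (negbTE (_ : nat_of_ord i != j))//= mulr0 addr0.
have step (i : 'I_m) : exists c : V, `|c - a| <= `|b - a| /\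
    f (z i.+1) - f (z i) = partial i f c * (b 0 i - a 0 i).
  set d := b 0 i - a 0 i.
  have bnd s : `|s| <= `|d| -> `|z i + s *: delta_mx 0 i - a| <= `|b - a|.
    move=> sd; apply: rV_norm_le => // j; rewrite !mxE eqxx/=.
    have [->|ij] := eqVneq j i.
      rewrite ltnn mulr1 addrAC subrr add0r (le_trans sd)//.
      by have := rV_coord_le (b - a) i; rewrite !mxE.
    rewrite mulr0 addr0; case: ifP => _; last by rewrite subrr normr0.
    by have := rV_coord_le (b - a) j; rewrite !mxE.
  pose u s := f (z i + s *: delta_mx 0 i).
  have du s : is_derive s (1 : R) (u : R -> R^o) (partial i f (z i + s *: delta_mx 0 i)).
    exact: partial_is_derive.
  have u0 : u 0 = f (z i) by rewrite /u scale0r addr0.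
  have ud : u d = f (z i.+1) by rewrite /u zS.
  have cu (A : set R) : {within A, continuous u}.
    apply: continuous_subspaceT => s; apply/differentiable_continuous/derivable1_diffP.
    by have [] := du s.
  rewrite -u0 -ud; have [d0|d0|d0] := ltgtP d 0.
  - have [c /[!in_itv]/= /andP[dc c0] E] := MVT d0 (fun x _ => du x) (cu _).
    exists (z i + c *: delta_mx 0 i); split.
      by apply: bnd; rewrite !ltr0_norm// lerN2 ltW.
    rewrite -opprB E sub0r mulrN opprK //.
  - have [c /[!in_itv]/= /andP[c0 dc] E] := MVT d0 (fun x _ => du x) (cu _).
    exists (z i + c *: delta_mx 0 i); split.
      by apply: bnd; rewrite !gtr0_norm// ltW.
    by rewrite E subr0.
  - exists (z i + 0 *: delta_mx 0 i); split; first by apply: bnd; rewrite normr0.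
    by rewrite d0 mulr0 subrr.
have [c hc] := choice step.
exists c; split=> [i|]; first by case: (hc i).
rewrite -zm -z0 -(telescope_sumr (fun k => f (z k)) (leq0n m)) big_mkord.
by apply: eq_bigr => i _; rewrite (hc i).2 zm z0.
Qed.

(** Only the partial derivatives of f are known to exist.  As the points given by
    [coordinate_mean_value] tend to g t, the continuity of the partial derivatives
    does the work of total differentiability. *)
Lemma chain_rule (f : V -> R) (g : R -> V) (t : R) (h : 'I_m -> R) :
  (forall i x, derivable (f : V -> R^o) x (delta_mx 0 i : V)) ->
  (forall i, continuous (partial i f)) ->
  {for t, continuous g} ->
  (forall i, is_derive t (1 : R) (fun x => g x 0 i : R^o) (h i)) ->
  is_derive t (1 : R) (fun x => f (g x) : R^o) (\sum_i partial i f (g t) * h i).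
Proof.
move=> df cf cg dg.
have [c hc] := choice (fun r : R => coordinate_mean_value (g t) (g (r + t)) df).
have lim : (fun r : R => r^-1 *: ((f (g (r *: (1 : R) + t)) : R^o) - f (g t))) @ 0^' -->
    \sum_i partial i f (g t) * h i.
  rewrite (_ : (fun _ => _) = (fun r => \sum_i partial i f (c r i) *
      (r^-1 *: (g (r *: (1 : R) + t) 0 i - g t 0 i)))); last first.
    apply/funext => r; rewrite [r *: 1]mulr1 (hc r).2 scaler_sumr.
    by apply: eq_bigr => i _; rewrite [LHS]mulrCA.
  apply: cvg_finite_sum => i; apply: cvgM.
    apply: (@cvg_comp _ _ _ (fun r => c r i) (partial i f) _ (nbhs (g t))); last exact: cf.
    apply/cvgrPdist_lt => e e0.
    have /cvgrPdist_lt/(_ _ e0) ge := cg.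
    have shift0 : (fun r : R => r + t) @ 0^' --> t.
      rewrite -[X in _ --> X]add0r; apply: cvgD; last exact: cvg_cst.
      exact: cvg_within.
    near=> r; rewrite distrC; apply: le_lt_trans ((hc r).1 i) _; rewrite distrC.
    by near: r; exact: (shift0 _ ge).
  have [di <-] := dg i; exact: di.
apply: DeriveDef; first by apply/cvg_ex; eexists; exact: lim.
exact/cvg_lim.
Unshelve. all: by end_near. Qed.

Lemma compact_support_bounded (f : V -> R) : continuous f ->
  compact (closure [set x | f x != 0]) -> exists2 B, 0 <= B & forall x, `|f x| <= B.
Proof.
move=> cf cK.
have : compact (f @` closure [set x | f x != 0]).
  by apply: continuous_compact => //; exact: continuous_subspaceT.
move=> /compact_bounded[M [_ hM]].
exists (`|M| + 1) => [|x]; first by rewrite addr_ge0.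
have [->|fx0] := eqVneq (f x) 0; first by rewrite normr0 addr_ge0.
apply: hM; first by rewrite (le_lt_trans (ler_norm _))// ltrDl.
by exists x => //; exact: subset_closure.
Qed.

Lemma support_partial (f : V -> R) i :
  [set x | partial i f x != 0] `<=` closure [set x | f x != 0].
Proof.
move=> x /= px; apply: contrapT => nx; move/eqP: px; apply.
have : nbhs x (~` closure [set x | f x != 0]).
  by apply: open_nbhs_nbhs; split => //; exact/closed_openC/closed_closure.
rewrite nbhsE => -[U [oU Ux] UC].
have fU y : U y -> f y = 0.
  move=> Uy; apply/eqP; apply: contrapT => /negP fy; apply: (UC _ Uy).
  exact: subset_closure.
rewrite /partial.
have nU : \forall y \near x, (cst 0 : V -> R^o) y = (f : V -> R^o) y.
  apply: (@filterS _ (nbhs x) _ U); first by move=> y Uy /=; rewrite fU.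
  exact: open_nbhs_nbhs.
by rewrite -(near_eq_derive (delta_mx 0 i : V) nU) derive_cst.
Qed.

Lemma gradient_test_form (f : V -> R) : test_function f -> test_form (gradient f).
Proof.
move=> [sf cK]; split=> [i k|].
  have [_ /(_ i) [_ dk]] := sf k.+1.
  rewrite (_ : (fun x => gradient f x 0 i) = partial i f)//.
  by apply/funext => x; rewrite mxE.
apply: (subclosed_compact _ cK); first exact: closed_closure.
rewrite [X in _ `<=` X](closure_id _).1; last exact: closed_closure.
apply: closure_subset => x /= gx; apply: contrapT => nx; move/eqP: gx; apply.
apply/rowP => i; rewrite !mxE; apply/eqP; apply: contrapT => /negP px.
by apply: nx; exact: support_partial px.
Qed.

Lemma test_form_bounded (omega : V -> V) : test_form omega ->
  exists2 B, 0 < B & forall x, enorm (omega x) <= B.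
Proof.
move=> [so cK].
have /choice[B hB] i : exists B, 0 <= B /\ forall x, `|omega x 0 i| <= B.
  have [ci _] := so i 0%N.
  have [|B B0 hB] := @compact_support_bounded (fun x => omega x 0 i) ci.
    apply: (subclosed_compact _ cK); first exact: closed_closure.
    apply: closure_subset => x /=; apply: contraNneq => ->; by rewrite mxE.
  by exists B.
exists (1 + \sum_i B i) => [|x].
  by rewrite ltr_wpDr// sumr_ge0// => i _; case: (hB i).
apply: le_trans (enorm_le_sum _) _; apply: le_trans (_ : \sum_i B i <= _); last by rewrite lerDr.
by apply: ler_sum => i _; case: (hB i).
Qed.

Lemma test_function_lipschitz (f : V -> R) : test_function f ->
  exists C : R, forall a b, `|f b - f a| <= C * enorm (b - a).
Proof.
move=> tf; have [B B0 hB] := test_form_bounded (gradient_test_form tf).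
have df i x : derivable (f : V -> R^o) x (delta_mx 0 i : V).
  by have [_ /(_ i)[]] := tf.1 1%N.
exists (m%:R * B) => a b.
have [c [_ ->]] := coordinate_mean_value a b df.
apply: (le_trans (ler_norm_sum _ _ _)).
apply: (@le_trans _ _ (\sum_(i < m) B * enorm (b - a))); last first.
  by rewrite sumr_const card_ord -[leLHS]mulr_natl mulrA.
apply: ler_sum => i _; rewrite normrM ler_pM//.
  apply: le_trans (hB (c i)); apply: le_trans (coord_le_enorm _ i).
  by rewrite mxE.
by have := coord_le_enorm (b - a) i; rewrite !mxE.
Qed.

End SmoothFunctions.

(** * Length of an injective Lipschitz arc *)
Section CurveArea.
Context {R : realType} {m : nat}.
Notation V := 'rV[R]_m.
Notation H := (@hausdorff1 R m).
Notation lam := (@lebesgue_measure R).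
Variables (g : R -> V) (phi : V -> R) (a b : R).
Hypothesis ab : a < b.
Hypothesis g1 : forall s t, enorm (g s - g t) <= `|s - t|.
Hypothesis phiK : forall t, a <= t <= b -> phi (g t) = t.

Lemma curve_continuous : continuous g.
Proof.
move=> x; apply/cvgrPdist_lt => e e0; near=> y.
apply: (@le_lt_trans _ _ `|x - y|).
  by apply: rV_norm_le => // j; apply: le_trans (coord_le_enorm _ j) (g1 _ _).
by near: y; apply: (@cvgr_dist_lt _ _ _ (nbhs x) _ id x cvg_id).
Unshelve. all: by end_near. Qed.

Lemma arc_measurable s t : measurable (g @` `[s, t] : set (H1_space R m)).
Proof.
apply: compact_measurable_H1; apply: continuous_compact; last exact: segment_compact.
exact/continuous_subspaceT/curve_continuous.
Qed.

(** The inverse of the arc; the value [a] off the arc makes it measurable on the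
    whole space and keeps it out of the interval ]a, b]. *)
Definition arc_param (x : V) : measurableTypeR R := if `[< (g @` `[a, b]) x >] then phi x else a.

Lemma arc_paramK t : a <= t <= b -> arc_param (g t) = t.
Proof.
by move=> tab; rewrite /arc_param asboolT; [exact: phiK|exists t => //=; rewrite in_itv].
Qed.

Lemma arc_param_out x : ~ (g @` `[a, b]) x -> arc_param x = a.
Proof. by move=> xD; rewrite /arc_param asboolF. Qed.

(** The points of the arc with parameter above y form the difference of two compact
    sets, the arc and the image of the interval from a to y. *)
Lemma measurable_arc_param : measurable_fun setT (arc_param : H1_space R m -> measurableTypeR R).
Proof.
move=> _; apply: (measurability _ (RGenOInfty.measurableE R)) => //.
move=> /= _ [_ [y ->] <-]; rewrite setTI.
have [ya|ay] := ltP y a.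
  rewrite [X in measurable X](_ : _ = setT)//; apply/seteqP; split => // x _ /=.
  rewrite in_itv/= andbT; have [[t /= + <-]|xD] := pselect ((g @` `[a, b]) x).
    rewrite in_itv/= => tab; rewrite arc_paramK//.
    by move: tab => /andP[at_ _]; exact: lt_le_trans at_.
  by rewrite arc_param_out.
rewrite [X in measurable X](_ : _ = (g @` `[a, b]) `\` (g @` `[a, Num.min y b])).
  by apply: measurableD; exact: arc_measurable.
apply/seteqP; split => x /=; rewrite in_itv/= andbT.
  have [[t /= + <-]|xD] := pselect ((g @` `[a, b]) x); last first.
    by rewrite arc_param_out// => /lt_geF; rewrite ay.
  rewrite in_itv/= => tab; rewrite arc_paramK// => yt; split.
    by exists t => //=; rewrite in_itv.
  move=> [s /=]; rewrite in_itv/= le_min => /andP[as_ /andP[sy sb]] gst.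
  have := arc_paramK (t := s); rewrite as_ sb gst arc_paramK// => /(_ isT) ts.
  by move: yt; rewrite ts ltNge sy.
move=> [[t /= + <-]]; rewrite in_itv/= => tab nt; rewrite arc_paramK//.
rewrite ltNge; apply/negP => ty; apply: nt; exists t => //=.
by rewrite in_itv/= le_min ty; move: tab => /andP[-> ->].
Qed.

Lemma arc_param_preimage s t : a <= s -> t <= b ->
  arc_param @^-1` `]s, t] = g @` `]s, t].
Proof.
move=> as_ tb; apply/seteqP; split => x /=; rewrite ?in_itv/=.
  have [[u /= + <-]|xD] := pselect ((g @` `[a, b]) x); last first.
    by rewrite arc_param_out// => /andP[/lt_geF]; rewrite as_.
  by rewrite in_itv/= => uab; rewrite arc_paramK// => ust; exists u => //=; rewrite in_itv.
move=> [u /= + <-]; rewrite in_itv/= => /andP[su ut]; rewrite arc_paramK ?su//.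
by rewrite (ltW (le_lt_trans as_ su)) (le_trans ut).
Qed.

Lemma hausdorff1_arc_le s t : s <= t -> (H (g @` `[s, t]) <= (t - s)%:E)%E.
Proof.
move=> st; apply: (@hausdorff1_curve_le _ _ g id) => // c d _ cd _.
by apply: (le_trans (g1 _ _)); rewrite ger0_norm// subr_ge0.
Qed.

Lemma hausdorff1_set1 x : H [set g x] = 0%E.
Proof.
apply/eqP; rewrite eq_le hausdorff1_ge0 andbT.
have := hausdorff1_arc_le (lexx x); rewrite subrr; apply: le_trans.
by apply: le_hausdorff1 => _ ->; exists x => //=; rewrite in_itv/= lexx.
Qed.

Lemma hausdorff1_arc_oc s t : s <= t -> H (g @` `]s, t]) = H (g @` `[s, t]).
Proof.
move=> st; apply/eqP; rewrite eq_le; apply/andP; split.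
  by apply: le_hausdorff1; apply: image_subset; apply: subset_itvr; rewrite bnd_simp.
apply: (@le_trans _ _ (H (g @` `]s, t] `|` [set g s]))).
  apply: le_hausdorff1 => _ [u /= + <-]; rewrite in_itv/= le_eqVlt => /andP[/predU1P[->|su] ut].
    by right.
  by left; exists u => //=; rewrite in_itv/= su.
apply: (le_trans (outer_measureU2 (H1_outer R m) _ _)).
by rewrite [X in (_ + X)%E]hausdorff1_set1 adde0.
Qed.

(** The image of the length measure of the arc under the inverse of the arc.  It is
    at most Lebesgue measure since the arc is 1-Lipschitz. *)
Lemma arc_length_measure : exists nu : {finite_measure set (measurableTypeR R) -> \bar R},
  [/\ forall s t, a <= s -> s <= t -> t <= b -> nu `]s, t]%classic = H (g @` `[s, t]),
      nu `<< lam,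
      forall A : set (measurableTypeR R), measurable A ->
        nu A = H1 R m (arc_param @^-1` (A `&` `]a, b])) &
      forall K : R -> R, measurable_fun setT K -> (exists C, forall t, `|K t| <= C) ->
        nu.-integrable `]a, b] (EFin \o K) /\
        (\int[nu]_(t in `]a, b]) (K t)%:E =
         \int[H1 R m]_(x in arc_param @^-1` `]a, b]) (K (arc_param x))%:E)%E].
Proof.
pose P : {measure set (measurableTypeR R) -> \bar R} :=
  measure_function_pushforward__canonical__measure_function_Measure (H1 R m) measurable_arc_param.
have PE (A : set R) : P A = H (arc_param @^-1` A) by [].
pose mI : measurable (`]a, b]%classic : set (measurableTypeR R)) := measurable_itv _.
have Pst s t : a <= s -> s <= t -> t <= b -> P `]s, t]%classic = H (g @` `[s, t]).
  by move=> as_ st tb; rewrite PE arc_param_preimage// hausdorff1_arc_oc.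
have fI : (P `]a, b]%classic < +oo)%E.
  by rewrite Pst ?(ltW ab)// (le_lt_trans (hausdorff1_arc_le (ltW ab)))// ltry.
pose nu : {finite_measure set (measurableTypeR R) -> \bar R} := mfrestr mI fI.
have nuE (A : set R) : nu A = P (A `&` `]a, b]%classic) by [].
have nust s t : a <= s -> s <= t -> t <= b -> nu `]s, t]%classic = H (g @` `[s, t]).
  move=> as_ st tb; rewrite nuE setIidl ?Pst//.
  by apply: subset_itv; rewrite bnd_simp.
exists nu; split => //.
- apply: (@null_dominates_lebesgue _ nu 1) => // s t st; rewrite mul1r.
  change (P (`]s, t]%classic `&` `]a, b]%classic) <= (t - s)%:E)%E.
  pose s' := Num.max s a; pose t' := Num.min t b.
  have -> : `]s, t]%classic `&` `]a, b]%classic = `]s', t']%classic.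
    apply/seteqP; split => u /=; rewrite !in_itv/= gt_max le_min.
      by move=> [/andP[-> ->] /andP[-> ->]].
    by move=> /andP[/andP[-> ->] /andP[-> ->]].
  have [st'|st'] := leP s' t'.
    rewrite Pst ?le_max ?ge_min ?lexx ?orbT// (le_trans (hausdorff1_arc_le st'))//.
    by rewrite lee_fin lerB// ?ge_min ?le_max lexx.
  by rewrite set_itv_ge ?measure0 ?lee_fin ?subr_ge0 ?ltW// bnd_simp -leNgt ltW.
- move=> K mK [C KC].
  have bK (T : Type) (f : T -> R) (D : set T) : [bounded K (f x) | x in D].
    exists C; split; first exact: num_real.
    by move=> M CM x _ /=; rewrite (le_trans (KC _))// ltW.
  split.
    apply: measurable_bounded_integrable; [exact: mI| |exact: measurable_funTS|exact: (bK _ id)].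
    by change (P (`]a, b]%classic `&` `]a, b]%classic) < +oo)%E; rewrite setIid.
  rewrite -[RHS](@integral_pushforward _ _ _ _ _ _ measurable_arc_param (H1 R m) _ (EFin \o K))//.
  - transitivity (\int[P]_(t in `]a, b]) (K t)%:E)%E; last by [].
    apply: eq_measure_integral => A mA AI.
    by change (P (A `&` `]a, b]%classic) = P A); rewrite setIidl.
  - exact/measurable_EFinP.
  - have mpre : measurable (arc_param @^-1` `]a, b] : set (H1_space R m)).
      by rewrite -[X in measurable X]setTI; exact: measurable_arc_param.
    have mKp : measurable_fun (arc_param @^-1` `]a, b] : set (H1_space R m)) (K \o arc_param).
      exact: (measurable_funTS (measurableT_comp mK measurable_arc_param)).
    apply: (@measurable_bounded_integrable _ _ _ (H1 R m) (K \o arc_param) _ mpre) => //.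
    exact: (bK _ arc_param).
Qed.

End CurveArea.

Section CurveSpeed.
Context {R : realType} {m : nat}.
Notation V := 'rV[R]_m.
Notation H := (@hausdorff1 R m).
Notation lam := (@lebesgue_measure R).
Variables (g : R -> V) (phi : V -> R) (a b : R).
Hypothesis ab : a < b.
Hypothesis g1 : forall s t, enorm (g s - g t) <= `|s - t|.
Hypothesis phiK : forall t, a <= t <= b -> phi (g t) = t.

Lemma nondecreasing_is_derive_ge0 (u : R -> R) (t d : R) :
  a < t < b -> (forall x y, a <= x -> x <= y -> y <= b -> u x <= u y) ->
  is_derive t (1 : R) (u : R -> R^o) d -> 0 <= d.
Proof.
move=> /andP[at_ tb] und [du <-]; rewrite /derive.
apply: limr_ge => //.
near=> h; rewrite [h *: 1]mulr1.
have : `|h| < Num.min (t - a) (b - t).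
  near: h; apply: (@dnbhs0_lt R R) ; by rewrite lt_min !subr_gt0 at_ tb.
rewrite lt_min => /andP[h1 h2]; have h3 := ler_norm h; have h4 := ler_norm (- h).
rewrite normrN in h4.
have [h0|h0] := leP 0 h.
  apply: mulr_ge0; [by rewrite invr_ge0|rewrite subr_ge0 /shift /=; apply: und; lra].
rewrite -[_ *: _]mulrNN; apply: mulr_ge0.
  by rewrite oppr_ge0 invr_le0 ltW.
by rewrite oppr_ge0 subr_le0 /shift /=; apply: und; lra.
Unshelve. all: by end_near. Qed.

Lemma integrable_enorm (h : R -> V) (A : set R) : measurable A ->
  (forall i, measurable_fun setT (fun t => h t 0 i)) ->
  (forall i, lam.-integrable A (fun t => (h t 0 i)%:E)) ->
  measurable_fun setT (fun t => enorm (h t)) /\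
  lam.-integrable A (fun t => (enorm (h t))%:E).
Proof.
move=> mA mh ih.
have mn : measurable_fun setT (fun t => enorm (h t)).
  have md : measurable_fun setT (fun t => dotp (h t) (h t)).
    by apply: measurable_sum => i; apply: measurable_funM.
  exact: (measurableT_comp (continuous_measurable_fun (@sqrt_continuous R)) md).
split => //; apply: (@le_integrable _ _ _ lam A mA _ (fun t => (\sum_i `|(h t 0 i)%:E|)%E)).
- exact/measurable_EFinP/measurable_funTS.
- move=> t _ /=; rewrite sumEFin lee_fin; apply: le_trans (ler_norm _).
  by rewrite ger0_norm ?enorm_ge0//; exact: enorm_le_sum.
- by apply: integrable_sum => // i _; exact: integrable_abse.
Qed.

(** The area formula.  Let rho be the density of the length measure of the arc.  It
    is at least the speed, since the length between two parameters is at least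
    the chord.  Conversely, the chord is at most the integral of the speed, so
    [hausdorff1_curve_le] bounds the length of the arc by that integral.  Thus rho
    and the speed are comparable and have equal integrals. *)
Lemma curve_speed : exists (nu : {finite_measure set (measurableTypeR R) -> \bar R}) (h : R -> V),
  [/\ forall i, measurable_fun setT (fun t => h t 0 i),
      forall i, lam.-integrable `]a, b] (fun t => (h t 0 i)%:E),
      {ae lam, forall t, a < t < b -> forall i,
         is_derive t (1 : R) (fun x => g x 0 i : R^o) (h t 0 i)},
      (nu `<< lam /\
      forall A : set (measurableTypeR R), measurable A ->
        nu A = H1 R m (arc_param g phi a b @^-1` (A `&` `]a, b]))) &
      forall K : R -> R, measurable_fun setT K -> (exists C, forall t, `|K t| <= C) ->
        (\int[H1 R m]_(x in arc_param g phi a b @^-1` `]a, b]) (K (arc_param g phi a b x))%:E =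
         \int[lam]_(t in `]a, b]) (K t * enorm (h t))%:E)%E].
Proof.
have [nu [nuI nul nuA nuK]] := arc_length_measure ab g1 phiK.
have [rho [irho rhoE rhoD rhoK]] := finite_measure_density nul.
have gi1 i s t : `|g s 0 i - g t 0 i| <= 1 * `|s - t|.
  by rewrite mul1r; apply: le_trans (g1 s t); have := coord_le_enorm (g s - g t) i; rewrite !mxE.
have /choice[hh hhP] i := lipschitz_density ab (gi1 i).
pose h t : V := \row_i hh i t.
have hE i : (fun t => h t 0 i) = hh i by apply/funext => t; rewrite mxE.
have mh i : measurable_fun setT (fun t => h t 0 i) by rewrite hE; have [] := hhP i.
have ih i : lam.-integrable `]a, b] (fun t => (h t 0 i)%:E).
  have -> : (fun t => (h t 0 i)%:E) = EFin \o hh i by rewrite -hE.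
  by have [] := hhP i.
have hD : {ae lam, forall t, a < t < b -> forall i,
         is_derive t (1 : R) (fun x => g x 0 i : R^o) (h t 0 i)}.
  have : \forall t \ae lam, forall i, a < t < b -> is_derive t (1 : R) (fun x => g x 0 i : R^o) (hh i t).
    by apply: (filter_forall (ae_filter_ringOfSetsType lam)) => i; have [] := hhP i.
  apply: (@filterS _ _ (ae_filter_ringOfSetsType lam)) => t ht tab i.
  by rewrite mxE; exact: ht.
pose n t := enorm (h t).
have [mn inn] := integrable_enorm (measurable_itv `]a, b]) mh ih.
have nuIab s t : a <= s -> s <= t -> t <= b -> (nu `]s, t]%classic <= (t - s)%:E)%E.
  by move=> as_ st tb; rewrite nuI// (hausdorff1_arc_le g1).
(* the speed is at most the density of the length, since chords are shorter than arcs *)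
have n_le : {ae lam, forall t, a < t < b -> n t <= rho t}.
  move: hD rhoD; apply: filterS2; first exact: (ae_filter_ringOfSetsType lam).
  move=> t hD rhoD tab.
  have [n0|n0] := eqVneq (n t) 0.
    rewrite n0; apply: (nondecreasing_is_derive_ge0 tab _ rhoD) => x y ax xy yb.
    rewrite fine_le ?fin_num_measure//; apply: le_measure; rewrite ?inE//.
    by apply: subset_itvl; rewrite bnd_simp.
  (* in the direction e of the velocity, length minus displacement does not decrease *)
  pose e := (n t)^-1 *: h t.
  have e1 : enorm e = 1 by rewrite enormZ ger0_norm ?invr_ge0 ?enorm_ge0// mulVf.
  have enh : \sum_i e 0 i * h t 0 i = n t.
    change (dotp e (h t) = n t).
    by rewrite dotpZl -enorm_sqr expr2 mulrA mulVf// mul1r.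
  rewrite -enh -subr_ge0.
  have D : is_derive t (1 : R) (((fun x => fine (nu `]-oo, x]%classic)) : R -> R^o) -
      \sum_(i < m) (e 0 i \*: ((fun x => g x 0 i) : R -> R^o)))
      (rho t - \sum_(i < m) e 0 i *: h t 0 i).
    apply: is_deriveB; apply: is_derive_sum => i; apply: is_deriveZ; exact: hD.
  apply: (nondecreasing_is_derive_ge0 tab _ D) => x y ax xy yb.
  have dE z : (((fun x => fine (nu `]-oo, x]%classic)) : R -> R^o) -
      \sum_(i < m) (e 0 i \*: ((fun x => g x 0 i) : R -> R^o))) z = fine (nu `]-oo, z]%classic) - dotp e (g z).
    rewrite /= fctE; congr (_ - _).
    by rewrite fct_sumE.
  rewrite !dE.
  have nuxy : fine (nu `]-oo, y]%classic) = fine (nu `]-oo, x]%classic) + fine (nu `]x, y]%classic).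
    rewrite -fineD ?fin_num_measure// -measureU//.
      by rewrite -itv_bndbnd_setU// bnd_simp.
    by apply/seteqP; split => // z [/=]; rewrite !in_itv/= => zx /andP[/lt_geF]; rewrite zx.
  have : enorm (g y - g x) <= fine (nu `]x, y]%classic).
    rewrite -lee_fin fineK ?fin_num_measure// nuI//.
    exact: (hausdorff1_curve_ge xy (curve_continuous g1)).
  have := dotp_le e (g y - g x); rewrite e1 mul1r dotpDr dotpNr nuxy; lra.
have {}n_le : {ae lam, forall t, `]a, b]%classic t -> n t <= rho t}.
  have nb : {ae lam, forall t, t != b}.
    exists [set b]; split; [exact: measurable_set1|exact: lebesgue_measure_set1|].
    by move=> t /= /negP; rewrite negbK => /eqP.
  move: n_le nb; apply: filterS2; first exact: (ae_filter_ringOfSetsType lam).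
  move=> t nt tb /=; rewrite in_itv/= => /andP[at_ tb']; apply: nt.
  by rewrite at_ lt_neqAle tb tb'.
have n0 t : 0 <= n t by exact: enorm_ge0.
have mh' i : measurable_fun setT (fun t => (h t 0 i)%:E) by exact/measurable_EFinP.
have sub c d : a <= c -> d <= b -> `]c, d] `<=` `]a, b].
  by move=> ac db; apply: subset_itv; rewrite bnd_simp.
(* chords are bounded by the integral of the speed *)
have chord c d : a <= c -> c <= d -> d <= b ->
    ((enorm (g d - g c))%:E <= \int[lam]_(t in `]c, d]) (n t)%:E)%E.
  move=> ac cd db; have [->|d0] := eqVneq (enorm (g d - g c)) 0.
    by apply: integral_ge0 => t _; rewrite lee_fin enorm_ge0.
  pose e := (enorm (g d - g c))^-1 *: (g d - g c).
  have e1 : enorm e = 1 by rewrite enormZ ger0_norm ?invr_ge0 ?enorm_ge0// mulVf.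
  have ihcd i : lam.-integrable `]c, d] (fun t => (e 0 i * h t 0 i)%:E).
    suff : lam.-integrable `]c, d] (fun t => (e 0 i)%:E * (h t 0 i)%:E)%E by [].
    by apply: integrableZl => //; apply: integrableS (ih i) => //; exact: sub.
  have -> : (enorm (g d - g c))%:E = (\int[lam]_(t in `]c, d]) (\sum_i (e 0 i * h t 0 i)%:E))%E.
    rewrite (@integral_sum _ _ _ lam _ (measurable_itv `]c, d]) _ _ ihcd).
    transitivity ((\sum_i e 0 i * (g d 0 i - g c 0 i))%:E).
      congr EFin; have := enorm_sqr (g d - g c).
      have -> : \sum_i e 0 i * (g d 0 i - g c 0 i) = dotp e (g d - g c).
        by apply: eq_bigr => i _; rewrite !mxE.
      by rewrite dotpZl -enorm_sqr expr2 mulrA mulVf// mul1r.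
    rewrite -sumEFin; apply: eq_bigr => i _.
    have ihi : lam.-integrable `]c, d] (EFin \o hh i).
      by have [_ + _ _] := hhP i; apply: integrableS => //; exact: sub.
    have [_ _ -> // _] := hhP i.
    under eq_integral do rewrite EFinM.
    rewrite integralZl//; last by apply: integrableS (ih i) => //; exact: sub.
    rewrite EFinM /Rintegral fineK; last exact: integrable_fin_num.
    by congr (_ * _)%E; apply: eq_integral => t _; rewrite mxE.
  apply: le_integral => //.
  - by apply: integrable_sum => // i _; exact: ihcd.
  - by apply: integrableS inn => //; exact: sub.
  - move=> t _; rewrite sumEFin lee_fin; have := dotp_le e (h t); rewrite e1 mul1r; exact.
pose L x : R := \int[lam]_(t in `]a, x]) n t.
have intn c d : a <= c -> d <= b -> lam.-integrable `]c, d] (EFin \o n).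
  by move=> ac db; apply: integrableS inn => //; exact: sub.
have LE c d : a <= c -> c <= d -> d <= b -> (L d - L c)%:E = (\int[lam]_(t in `]c, d]) (n t)%:E)%E.
  move=> ac cd db; rewrite /L Rintegral_itvB ?bnd_simp//; last exact: intn.
  by rewrite /Rintegral fineK//; apply: integrable_fin_num => //; exact: intn.
have mrho : measurable_fun setT (EFin \o rho) by exact: measurable_int irho.
have nurho c d : a <= c -> d <= b ->
    (\int[lam]_(t in `]c, d]) `|(rho t)%:E|)%E = nu `]c, d]%classic.
  move=> ac db; rewrite rhoE//; apply: ae_eq_integral => //.
  - by apply: measurable_funTS; exact: measurableT_comp mrho.
  - exact: measurable_funTS.
  - apply: (@filterS _ _ (ae_filter_ringOfSetsType lam) _ _ _ n_le) => t nt tcd /=; rewrite ger0_norm//.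
    by apply: le_trans (nt _); [exact: n0|exact: sub tcd].
have Hle : (H (g @` `[a, b]) <= \int[lam]_(t in `]a, b]) (n t)%:E)%E.
  rewrite -LE ?(ltW ab)//; apply: hausdorff1_curve_le => [|c d ac cd db|c d ac cd db]; first exact: ltW.
    by rewrite -lee_fin LE// chord.
  rewrite -lee_fin LE//; apply: le_trans (nuIab _ _ ac cd db).
  rewrite -nurho//; apply: ae_ge0_le_integral => //.
  - by move=> t _; rewrite lee_fin.
  - exact/measurable_EFinP/measurable_funTS.
  - by apply: measurable_funTS; exact: measurableT_comp mrho.
  - apply: (@filterS _ _ (ae_filter_ringOfSetsType lam) _ _ _ n_le) => t nt tcd; rewrite lee_fin (le_trans _ (ler_norm _))//.
    by apply: nt; exact: sub tcd.
have irho' : lam.-integrable `]a, b] (EFin \o rho) by exact: integrableS irho.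
have eqn : ae_eq lam `]a, b]%classic (EFin \o rho) (EFin \o n).
  have mdiff : measurable_fun `]a, b] ((EFin \o rho) \- (EFin \o n))%E.
    by apply: emeasurable_funB; apply: measurable_funTS => //; exact/measurable_EFinP.
  have : ae_eq lam `]a, b]%classic ((EFin \o rho) \- (EFin \o n))%E (cst 0%E).
    apply/ae_eq_integral_abs => //.
    apply/eqP; rewrite eq_le integral_ge0 ?andbT//.
    rewrite (@ae_eq_integral _ _ _ lam _ ((EFin \o rho) \- (EFin \o n))%E)//.
    - rewrite integralB//.
      rewrite -rhoE// nuI ?(ltW ab)// lee_subel_addr ?add0e//.
    - exact: measurableT_comp mdiff.
    - by apply: (@filterS _ _ (ae_filter_ringOfSetsType lam) _ _ _ n_le) => t nt tab; rewrite /= ger0_norm// subr_ge0 nt.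
  by apply: (@filterS _ _ (ae_filter_ringOfSetsType lam)) => t h0 tab; have := h0 tab; rewrite /= -EFinB => -[] /subr0_eq ->.
exists nu, h; split => // K mK bK.
have [iK <-] := nuK _ mK bK; rewrite -rhoK//; apply: ae_eq_integral => //.
- by apply: emeasurable_funM; apply: measurable_funTS => //; exact/measurable_EFinP.
- by apply: measurable_funTS; apply/measurable_EFinP; exact: measurable_funM.
- by apply: (@filterS _ _ (ae_filter_ringOfSetsType lam) _ _ _ eqn) => t et tab; have := et tab; rewrite /= -EFinM => -[->].
Qed.

End CurveSpeed.

(** * The current of a simple curve *)
Section SimpleCurves.
Context {R : realType} {m : nat}.
Notation V := 'rV[R]_m.
Notation lam := (@lebesgue_measure R).
Implicit Types g : curve R m.

Lemma curve_lipschitz g s t : enorm (g s - g t) <= `|s - t|.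
Proof.
have gE r : g r = g (Num.max 0 r).
  by have [r0|r0] := ltP r 0; [rewrite curve_neg|].
rewrite (gE s) (gE t); apply: (le_trans (@curve_lip _ _ g _ _ _ _)); rewrite ?le_max ?lexx//.
rewrite ler_norml.
have : s <= t + `|s - t| by rewrite -lerBlDl ler_norm.
have : t <= s + `|s - t| by rewrite -lerBlDl distrC ler_norm.
have := normr_ge0 (s - t).
by move=> h0 h1 h2; have [s0|s0] := leP 0 s; have [t0|t0] := leP 0 t; apply/andP; split; lra.
Qed.

(** Suprema and infima of times at which the curve is at x are such times. *)
Lemma curve_close g s x : (forall e : R, 0 < e -> exists2 t, `|t - s| < e & g t = x) -> g s = x.
Proof.
move=> h; apply/eqP; rewrite -subr_eq0; apply/eqP/enorm_eq0/eqP.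
rewrite eq_le enorm_ge0 andbT; apply/ler_addgt0Pl => e e0; rewrite addr0.
have [t ts <-] := h _ e0.
by rewrite (le_trans (curve_lipschitz g s t))// distrC ltW.
Qed.

(** The interval is the one between the first departure [t0] and the last arrival
    [tinfty]; both are finite, and the curve rests outside of this interval. *)
Lemma simple_curve_arc g : nonconstant g -> simple_curve g -> exists a b,
  [/\ a < b, curve_image g = g @` `[a, b] &
      forall t, a <= t <= b -> curve_param g (g t) = t].
Proof.
move=> [s1 [s2 [s10 s20 gs12]]] sg.
pose S0 := [set t : R | 0 <= t /\ forall s, 0 <= s <= t -> g s = g 0].
pose Si := [set t : R | 0 <= t /\ forall s, t <= s -> g s = g t].
have [s s0 gs] : exists2 s, 0 <= s & g s <> g 0.
  have [e1|] := pselect (g s1 = g 0); last by exists s1.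
  by exists s2 => // e2; apply: gs12; rewrite e1 e2.
have S0s t : S0 t -> t <= s.
  move=> [t0 ht]; rewrite leNgt; apply/negP => st; apply: gs; apply: ht.
  by rewrite s0 ltW.
have supS : has_sup S0.
  split; last by exists s => t /S0s.
  exists 0; split => // r /andP[r0 r1]; congr (g _); apply/eqP; by rewrite eq_le r1.
have infS : has_inf Si.
  split; last by exists 0 => t [].
  have [t1 t10 ht] := curve_const g; exists t1; split => // r /ht //.
pose a := sup S0; pose b := inf Si.
have t0E : t0 g = a%:E by rewrite /t0 -/S0 ereal_sup_EFin//; [case: supS|case: supS].
have tiE : tinfty g = b%:E by rewrite /tinfty -/Si ereal_inf_EFin//; [case: infS|case: infS].
have a0 : 0 <= a.
  by apply: sup_upper_bound => //; split => // r /andP[r0 r1]; congr (g _); apply/eqP; rewrite eq_le r1.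
have lta r : 0 <= r -> r < a -> g r = g 0.
  move=> r0 ra; have ar : 0 < a - r by rewrite subr_gt0.
  have [t [t0' ht]] := sup_adherent ar supS; rewrite opprB addrC subrK => rt.
  by apply: ht; rewrite r0 ltW.
have ga : g a = g 0.
  have [-> //|an0] := eqVneq a 0.
  have {an0}a0' : 0 < a by rewrite lt_neqAle eq_sym an0.
  apply: curve_close => e e0; exists (a - Num.min (e / 2) (a / 2)).
    rewrite addrAC subrr add0r normrN ger0_norm ?le_min ?divr_ge0 ?(ltW e0)//.
    by rewrite gt_min; apply/orP; left; lra.
  apply: lta; first by rewrite subr_ge0 ge_min; apply/orP; right; lra.
  by rewrite gtrDl oppr_lt0 lt_min !divr_gt0.
have b0 : 0 <= b by apply: lb_le_inf => [|t []//]; case: infS.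
have [z hz] : exists z, forall r, b <= r -> g r = z.
  have [t1 [t10 ht1]] : Si !=set0 by case: infS.
  have gtb r : b < r -> g r = g t1.
    move=> br; have rb : 0 < r - b by rewrite subr_gt0.
    have [t [t0' ht]] := inf_adherent rb infS; rewrite addrC subrK => tr.
    rewrite (ht r (ltW tr)); have [/ht->//|/ltW/ht1->//] := leP t t1.
  exists (g t1) => r; rewrite le_eqVlt => /predU1P[<-|/gtb//].
  apply: curve_close => e e0; exists (b + e / 2); last by apply: gtb; lra.
  by rewrite addrAC subrr add0r ger0_norm; lra.
have ga' r : 0 <= r -> r <= a -> g r = g a.
  by move=> r0; rewrite le_eqVlt => /predU1P[->//|ra]; rewrite ga lta.
have ab : a < b.
  rewrite ltNge; apply/negP => ba; apply: gs12.
  have all0 r : 0 <= r -> g r = z.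
    by move=> r0; have [ra|/ltW ar] := leP r a; [rewrite ga'// hz|rewrite hz// (le_trans ba)].
  by rewrite !all0.
exists a, b; split => //.
  apply/seteqP; split => [_ [r /= + <-]|_ [r /= + <-]]; rewrite !in_itv/=.
    rewrite andbT => r0; have [ra|ar] := leP r a.
      by exists a; [rewrite /= in_itv/= lexx ltW|rewrite ga'].
    have [rb|/ltW br] := leP r b; first by exists r => //=; rewrite in_itv/= rb ltW.
    by exists b; [rewrite /= in_itv/= lexx ltW|rewrite !hz].
  by move=> /andP[ar _]; exists r => //=; rewrite in_itv/= (le_trans a0).
move=> t /andP[at_ tb]; rewrite /curve_param; set P := (X in get X).
have [] : P (get P) by apply: getPex; exists t; rewrite /P/= t0E tiE !lee_fin at_ tb.
set r := get P; rewrite t0E tiE !lee_fin => ar rb grt.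
have [rt|tr|//] := ltgtP r t.
  by have := sg r t; rewrite t0E tiE !lee_fin => /(_ ar rt tb); rewrite grt.
by have := sg t r; rewrite t0E tiE !lee_fin => /(_ at_ tr rb); rewrite grt.
Qed.

Lemma rV_cvg (T : Type) (F : set_system T) (f : T -> V) (l : V) : Filter F ->
  (forall i, f x 0 i @[x --> F] --> l 0 i) -> f x @[x --> F] --> l.
Proof.
move=> FF fl; apply/cvgrPdist_lt => e e0.
have e2 : 0 < e / 2 by rewrite divr_gt0.
have : \forall x \near F, forall i, `|l 0 i - f x 0 i| < e / 2.
  by apply: filter_forall => i; have /cvgrPdist_lt := fl i; exact.
apply: filterS => x hx; apply: (@le_lt_trans _ _ (e / 2)); last by lra.
by apply: rV_norm_le; [exact: ltW|move=> j; rewrite !mxE ltW].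
Qed.

Lemma derive1_coord (g : R -> V) (t : R) (h : V) :
  (forall i, is_derive t (1 : R) (fun x => g x 0 i : R^o) (h 0 i)) -> derive1 g t = h.
Proof.
move=> dg; apply/cvg_lim => //; apply: rV_cvg => i.
have [di] := dg i; rewrite /derive => E.
move: di; rewrite /derivable => /cvg_lim; rewrite E => di.
rewrite [X in X @ _ --> _](_ : _ = fun s => s^-1 *: ((g (s *: (1 : R) + t) 0 i : R^o) - g t 0 i)).
  by have [d1 <-] := dg i; exact: d1.
by apply/funext => s; rewrite !mxE [s *: 1]mulr1.
Qed.

(** All H^1-null sets are Caratheodory measurable. *)
Lemma measurable_H1_ae (D E : set (H1_space R m)) (F k : H1_space R m -> \bar R) :
  measurable E -> H1 R m E = 0%E ->
  (forall x, D x -> ~ E x -> F x = k x) ->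
  measurable_fun D k -> measurable_fun D F.
Proof.
move=> mE E0 Fk mk mD Y mY.
have -> : D `&` F @^-1` Y = ((D `&` k @^-1` Y) `\` E) `|` ((D `&` F @^-1` Y) `&` E).
  apply/seteqP; split => x.
    move=> [Dx Yx]; have [Ex|nEx] := pselect (E x); first by right.
    by left; split => //; split => //=; rewrite -Fk.
  by move=> [[[Dx Yx] nEx]|[]//]; split => //=; rewrite Fk.
apply: measurableU; first by apply: measurableD => //; exact: mk.
apply: measure_is_complete_caratheodory; by exists E; split => // x [].
Qed.

(** The change of variables [curve_speed] for the pairing K of omega with the
    normalized velocity.  At almost every parameter the velocity is the derivative
    from which [curve_direction] is computed. *)
Lemma curve_current_arc g : nonconstant g -> simple_curve g ->
  exists a b (h : R -> V), [/\ a < b,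
    forall i, lam.-integrable `]a, b] (fun t => (h t 0 i)%:E),
    {ae lam, forall t, a < t < b -> forall i,
       is_derive t (1 : R) (fun x => g x 0 i : R^o) (h t 0 i)},
    lam.-integrable `]a, b] (fun t => (enorm (h t))%:E) /\
    (\int[lam]_(t in `]a, b]) (enorm (h t))%:E <= hausdorff1 (curve_image g))%E &
    forall omega, test_form omega ->
      lam.-integrable `]a, b] (fun t => (dotp (omega (g t)) (h t))%:E) /\
      curve_current g omega = \int[lam]_(t in `]a, b]) dotp (omega (g t)) (h t)].
Proof.
move=> ncg sg; have [a [b [ab imE paramK]]] := simple_curve_arc ncg sg.
have g1 := @curve_lipschitz g.
have [nu [h [mh ih hD [nul nuA] HK]]] := curve_speed ab g1 paramK.
set psi := arc_param g (curve_param g) a b in nuA HK.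
have mpsi : measurable_fun setT (psi : H1_space R m -> measurableTypeR R).
  exact: measurable_arc_param.
pose n t := enorm (h t).
have [mn inn] := integrable_enorm (measurable_itv `]a, b]) mh ih.
have cg : continuous g := curve_continuous g1.
have im (K : R -> R) : measurable_fun setT K -> (exists C, forall t, `|K t| <= C) ->
    lam.-integrable `]a, b] (fun t => (K t * n t)%:E).
  move=> mK [C KC]; apply: (@le_integrable _ _ _ lam _ (measurable_itv _) _ (fun t => (C%:E * (n t)%:E)%E)).
  - by apply: measurable_funTS; apply/measurable_EFinP; exact: measurable_funM.
  - move=> t _ /=; rewrite lee_fin !normrM ler_wpM2r//.
    by rewrite (le_trans (KC t))// ler_norm.
  - exact: integrableZl.
have fD : (H1 R m (curve_image g) < +oo)%E.
  by rewrite imE; apply: (le_lt_trans (hausdorff1_arc_le g1 (ltW ab))); rewrite ltry.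
have mD : measurable (curve_image g : set (H1_space R m)).
  by rewrite imE; exact: (arc_measurable g1).
have preE : curve_image g `\ g a = psi @^-1` `]a, b].
  rewrite arc_param_preimage// imE; apply/seteqP; split => x.
    move=> [[t /= + <-] nga]; rewrite in_itv/= => /andP[at_ tb].
    exists t => //=; rewrite in_itv/= tb andbT lt_neqAle at_ andbT.
    by apply/eqP => ta; apply: nga; rewrite ta.
  move=> [t /= + <-]; rewrite in_itv/= => /andP[at_ tb]; split.
    by exists t => //=; rewrite in_itv/= tb ltW.
  move=> gta; have := paramK t; rewrite (ltW at_) tb gta => /(_ isT).
  by rewrite paramK ?lexx ?ltW// => ta; move: at_; rewrite ta ltxx.
exists a, b, h; split => //.
  split => //; have K1 : exists C : R, forall t : R, `|cst 1 t| <= C by exists 1 => t; rewrite normr1.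
  have := HK (cst 1) (@measurable_cst _ _ _ _ _ _) K1.
  under [X in _ = X -> _]eq_integral do rewrite mul1r.
  move=> <-; rewrite -preE.
  have mDa : measurable (curve_image g `\ g a : set (H1_space R m)).
    by apply: measurableD => //; apply: compact_measurable_H1; exact: compact_set1.
  rewrite -[leLHS]/(\int[H1 R m]_(x in curve_image g `\ g a) cst 1%E x)%E integral_cst// mul1e.
  by apply: le_hausdorff1 => x [].
move=> omega tom.
have [B B0 omB] := test_form_bounded tom.
pose K t := dotp (omega (g t)) ((n t)^-1 *: h t).
have mom i : measurable_fun setT (fun t => omega (g t) 0 i).
  apply: continuous_measurable_fun => t.
  apply: (@continuous_comp _ _ _ g (fun x => omega x 0 i)); first exact: cg.
  by have [co _] := tom.1 i 0%N; exact: co.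
have mK : measurable_fun setT K.
  apply: measurable_sum => i; apply: measurable_funM => //.
  rewrite (_ : (fun x => _) = (fun t => (n t)^-1 * h t 0 i)); last by apply/funext => t; rewrite mxE.
  apply: measurable_funM => //.
  rewrite (_ : (fun x => _) = (fun t => n t `^ (-1))); last first.
    by apply/funext => t; rewrite powR_inv1// enorm_ge0.
  exact: (measurableT_comp (measurable_powR (-1)) mn).
have n1 t : enorm ((n t)^-1 *: h t) <= 1.
  rewrite enormZ ger0_norm ?invr_ge0 ?enorm_ge0//.
  have [n0|n0] := eqVneq (n t) 0; first by rewrite [X in X^-1]n0 invr0 mul0r.
  by rewrite mulVf.
have bK : exists C, forall t, `|K t| <= C.
  exists B => t; apply: (le_trans (abs_dotp_le _ _)).
  by rewrite -[leRHS]mulr1 ler_pM ?enorm_ge0.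
(* off a null set of parameters, the integrand is a Borel function of the parameter *)
have [N0 [mN0 N00 hN0]] := hD.
have mN : measurable (N0 `|` [set b] : set (measurableTypeR R)).
  by apply: measurableU => //; exact: measurable_set1.
have N_0 : lam (N0 `|` [set b]) = 0%E.
  by rewrite null_set_setU//; exact: lebesgue_measure_set1.
pose E := psi @^-1` ((N0 `|` [set b]) `&` `]a, b]) `|` [set g a].
have mE1 : measurable (psi @^-1` ((N0 `|` [set b]) `&` `]a, b]) : set (H1_space R m)).
  by rewrite -[X in measurable X]setTI; apply: mpsi => //; exact: measurableI.
have mga : measurable ([set g a] : set (H1_space R m)).
  by apply: compact_measurable_H1; exact: compact_set1.
have ga0 : H1 R m [set g a] = 0%E by exact: (hausdorff1_set1 g1).
have mE : measurable (E : set (H1_space R m)) by exact: measurableU.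
have E0 : H1 R m E = 0%E.
  rewrite null_set_setU//; rewrite -nuA//.
  by have /null_content_dominatesP := nul; apply.
have FK x : curve_image g x -> ~ E x -> dotp (omega x) (curve_direction g x) * 1 = K (psi x).
  rewrite imE => -[t /= + <-]; rewrite in_itv/= => tab nE.
  have psit : psi (g t) = t by exact: arc_paramK.
  have ta : t != a by apply/eqP => ta; apply: nE; right; rewrite ta.
  have atb : a < t <= b by rewrite lt_neqAle eq_sym ta.
  have nN : ~ (N0 `|` [set b]) t.
    by move=> Nt; apply: nE; left; rewrite /= psit; split => //; rewrite /= in_itv.
  have tb : t != b by apply/eqP => tb; apply: nN; right.
  have ht : forall i, is_derive t (1 : R) (fun x => g x 0 i : R^o) (h t 0 i).
    have : ~ ~ (a < t < b -> forall i, is_derive t (1 : R) (fun x => g x 0 i : R^o) (h t 0 i)).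
      by move=> nh; apply: nN; left; apply: hN0.
    move=> /contrapT; apply; move: atb => /andP[-> ?]; by rewrite lt_neqAle tb.
  by rewrite mulr1 psit /K /curve_direction paramK// (derive1_coord ht).
have mKpsi : measurable_fun setT (fun x : H1_space R m => (K (psi x))%:E).
  by apply/measurable_EFinP; exact: (measurableT_comp mK mpsi).
(* where the speed vanishes, both sides are 0 *)
have Kn t : K t * n t = dotp (omega (g t)) (h t).
  rewrite /K dotpZr; have [n0|n0] := eqVneq (n t) 0; last by rewrite mulrAC mulVf// mul1r.
  by rewrite n0 mulr0 (enorm_eq0 n0) -(scale0r (0 : V)) dotpZr mul0r.
split.
  have := im _ mK bK; congr integrable; by apply/funext => t; rewrite Kn.
rewrite /curve_current asboolT// /tau /Rintegral.
transitivity (fine (\int[H1 R m]_(x in curve_image g) (K (psi x))%:E)).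
  congr fine; apply: ae_eq_integral; first exact: mD.
  - apply: (measurable_H1_ae mE E0 (k := fun x => (K (psi x))%:E)); last exact: measurable_funTS.
    by move=> x Dx nE; rewrite FK.
  - exact: measurable_funTS.
  - exists E; split => // x; apply: contra_notP => nE Dx; by rewrite FK.
rewrite (negligible_integral mga)//; last first.
  apply: (@measurable_bounded_integrable _ _ _ (H1 R m) (K \o psi) _ mD) => //.
    by apply: measurable_funTS; exact: (measurableT_comp mK mpsi).
  have [C KC] := bK; exists C; split; first exact: num_real.
  by move=> M CM x _ /=; rewrite (le_trans (KC _))// ltW.
rewrite preE HK//; congr fine; apply: eq_integral => t _; by rewrite Kn.
Qed.

(** The function f o g is Lipschitz, so it is the integral of its derivative, which
    the chain rule identifies with the integrand. *)
Lemma curve_current_gradient g : nonconstant g -> simple_curve g -> exists p q,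
  forall f, test_function f -> curve_current g (gradient f) = f q - f p.
Proof.
move=> ncg sg; have [a [b [h [ab ih hD _ IE]]]] := curve_current_arc ncg sg.
exists (g a), (g b) => f tf.
have [iI ->] := IE _ (gradient_test_form tf).
have g1 := @curve_lipschitz g.
have cpartial i : continuous (partial i f).
  by have [_ /(_ i)[_ []]] := tf.1 1%N.
have df i x : derivable (f : V -> R^o) x (delta_mx 0 i : V).
  by have [_ /(_ i)[]] := tf.1 1%N.
have cg : continuous g := curve_continuous g1.
have [C fC] := test_function_lipschitz tf.
have C1 s t : `|f (g s) - f (g t)| <= `|C| * `|s - t|.
  apply: (le_trans (fC _ _)); apply: (@le_trans _ _ (`|C| * enorm (g s - g t))).
    by rewrite ler_wpM2r ?enorm_ge0// ler_norm.
  by rewrite ler_wpM2l.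
have [k [mk ik kE kD]] := lipschitz_density ab C1.
rewrite kE ?(ltW ab)// /Rintegral; congr fine; apply: ae_eq_integral => //.
- exact: measurable_int iI.
- exact: measurable_int ik.
- have nb : {ae lam, forall t, t != b}.
    exists [set b]; split; [exact: measurable_set1|exact: lebesgue_measure_set1|].
    by move=> t /= /negP; rewrite negbK => /eqP.
  have hkD : {ae lam, forall t, a < t < b -> (forall i,
         is_derive t (1 : R) (fun x => g x 0 i : R^o) (h t 0 i)) /\
       is_derive t (1 : R) (fun x => f (g x) : R^o) (k t)}.
    move: hD kD; apply: filterS2; first exact: (ae_filter_ringOfSetsType lam).
    by move=> t h1 h2 tab; split; [exact: h1|exact: h2].
  move: hkD nb; apply: filterS2; first exact: (ae_filter_ringOfSetsType lam).
  move=> t hk tb /=; rewrite in_itv/= => /andP[at_ tb'].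
  have [|dh [dk kt]] := hk; first by rewrite at_ lt_neqAle tb.
  have [_ ct] := chain_rule df cpartial (cg t) dh.
  rewrite -kt ct; congr EFin; by apply: eq_bigr => i _; rewrite mxE.
Qed.

End SimpleCurves.

Section CurveCurrents.
Context {R : realType} {m : nat}.
Notation V := 'rV[R]_m.
Notation lam := (@lebesgue_measure R).
Implicit Types (g : curve R m) (omega : V -> V) (C : current1 R m).

Lemma partialZ i c (f : V -> R) : (forall x, derivable (f : V -> R^o) x (delta_mx 0 i : V)) ->
  partial i (fun x => c * f x) = (fun x => c * partial i f x).
Proof. by move=> df; apply/funext => x; rewrite /partial (deriveZ c (df x)). Qed.

Lemma differentiable_classZ k c (f : V -> R) :
  differentiable_class k f -> differentiable_class k (fun x => c * f x).
Proof.
elim: k f => [|k IH] f [cf df].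
  by split => // x; exact: (continuousM (@cst_continuous _ _ c x) (cf x)).
split=> [x|i]; first by exact: (continuousM (@cst_continuous _ _ c x) (cf x)).
have [dfi ci] := df i; split=> [x|]; first exact: (@derivableZ _ _ _ (f : _ -> R^o) c x _ (dfi x)).
by rewrite partialZ//; exact: IH.
Qed.

Lemma smooth_cst0 : smooth ((fun=> 0) : V -> R).
Proof.
elim=> [|k IH]; first by split => //; exact: cst_continuous.
split=> [|i]; first exact: cst_continuous.
split=> [x|]; first exact: derivable_cst.
by rewrite (_ : partial i _ = fun=> 0)//; apply/funext => x; exact: derive_cst.
Qed.

Lemma test_form0 : test_form ((fun=> 0) : V -> V).
Proof.
split=> [i|].
  by rewrite (_ : (fun x => _) = fun=> 0); [exact: smooth_cst0|apply/funext => x; rewrite mxE].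
rewrite (_ : [set x | _] = set0) ?closure0; first exact: compact0.
by apply/seteqP; split => // x /=; rewrite eqxx.
Qed.

Lemma test_formZ c omega : test_form omega -> test_form (fun x => c *: omega x).
Proof.
move=> [so co]; split=> [i k|].
  rewrite (_ : (fun x => _) = fun x => c * omega x 0 i); last by apply/funext => x; rewrite mxE.
  exact: differentiable_classZ (so i k).
apply: (subclosed_compact _ co); first exact: closed_closure.
by apply: closure_subset => x /=; apply: contraNneq => ->; rewrite scaler0.
Qed.

Lemma test_function0 : test_function ((fun=> 0) : V -> R).
Proof.
split; first exact: smooth_cst0.
rewrite (_ : [set x | _] = set0) ?closure0; first exact: compact0.
by apply/seteqP; split => // x /=; rewrite eqxx.
Qed.

Lemma gradient0 : gradient ((fun=> 0) : V -> R) = fun=> 0.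
Proof.
apply/funext => x; apply/rowP => i; rewrite !mxE; exact: derive_cst.
Qed.

Lemma mass1_ge0 C : C (fun=> 0) = 0 -> (0 <= mass1 C)%E.
Proof.
move=> C0; apply: ereal_sup_ubound; exists (fun=> 0); rewrite ?C0//.
by split; [exact: test_form0|move=> x; rewrite enorm0].
Qed.

Lemma mass0_ge0 C : C (fun=> 0) = 0 -> (0 <= mass0 (boundary C))%E.
Proof.
move=> C0; apply: ereal_sup_ubound; exists (fun=> 0); last by rewrite /boundary gradient0 C0.
by split; [exact: test_function0|move=> x; rewrite normr0].
Qed.

Lemma curve_current0 g : curve_current g (fun=> 0) = 0.
Proof.
rewrite /curve_current; case: ifP => // _; rewrite /tau.
rewrite (_ : (fun x => _) = fun=> 0); first by rewrite /Rintegral integral0.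
by apply/funext => x; rewrite -(scale0r (0 : V)) dotpZl !mul0r.
Qed.

Lemma curve_currentZ g c omega : nonconstant g -> simple_curve g -> test_form omega ->
  curve_current g (fun x => c *: omega x) = c * curve_current g omega.
Proof.
move=> ncg sg to; have [a [b [h [ab _ _ _ IE]]]] := curve_current_arc ncg sg.
have [iI ->] := IE _ to; have [_ ->] := IE _ (test_formZ c to).
by rewrite -RintegralZl//; apply: eq_Rintegral => t _; rewrite dotpZl.
Qed.

(** Divide omega by B, and change its sign if the pairing is negative, to get a
    competitor in the definition of the mass. *)
Lemma curve_current_le_mass1 g omega (B : R) : nonconstant g -> simple_curve g ->
  test_form omega -> 0 < B -> (forall x, enorm (omega x) <= B) ->
  (`|curve_current g omega|%:E <= B%:E * mass1 (curve_current g))%E.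
Proof.
move=> ncg sg to B0 oB; rewrite -lee_pdivrMl// -EFinM.
suff key (e : R) : `|e| = 1 -> ((B^-1 * (e * curve_current g omega))%:E <= mass1 (curve_current g))%E.
  have [I0|I0] := leP 0 (curve_current g omega).
    by have := key 1 (normr1 _); rewrite mul1r ger0_norm.
  by have := key (-1) (normrN1 _); rewrite mulN1r ltr0_norm.
move=> e1; rewrite mulrA -curve_currentZ//; apply: ereal_sup_ubound.
exists (fun x => (B^-1 * e) *: omega x) => //; split; first exact: test_formZ.
move=> x; rewrite enormZ normrM e1 mulr1 gtr0_norm ?invr_gt0//.
by rewrite ler_pdivrMl// mulr1.
Qed.

(** The pairing of a form of comass at most 1 with the velocity is at most the
    speed, and the speed integrates to at most the length of the image. *)
Lemma mass1_curve_le g : nonconstant g -> simple_curve g ->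
  (mass1 (curve_current g) <= hausdorff1 (curve_image g))%E.
Proof.
move=> ncg sg; have [a [b [h [ab _ _ [ih hH] IE]]]] := curve_current_arc ncg sg.
apply: ge_ereal_sup => _ [omega [to o1] <-]; apply: le_trans hH.
have [iI ->] := IE _ to.
rewrite /Rintegral fineK; last exact: integrable_fin_num.
apply: le_integral => // t _; rewrite lee_fin (le_trans (dotp_le _ _))//.
by rewrite -[leRHS]mul1r ler_wpM2r ?enorm_ge0.
Qed.

Lemma mass0_curve_le g : nonconstant g -> simple_curve g ->
  (mass0 (boundary (curve_current g)) <= 2%:E)%E.
Proof.
move=> ncg sg; have [p [q hpq]] := curve_current_gradient ncg sg.
apply: ge_ereal_sup => _ [f [tf f1] <-]; rewrite /boundary hpq// lee_fin.
have := f1 p; have := f1 q; rewrite !ler_norml => /andP[? ?] /andP[? ?]; lra.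
Qed.

End CurveCurrents.

(** * Reweighting a measure cell by cell *)
Section EqualIntegrals.
Context d (T : measurableType d) (R : realType) (mu : {measure set T -> \bar R}).

Lemma ae_impl (P Q : T -> Prop) : (forall x, P x -> Q x) ->
  {ae mu, forall x, P x} -> {ae mu, forall x, Q x}.
Proof.
by move=> PQ aP; near=> x; apply: PQ; near: x; exact: aP.
Unshelve. all: end_near. Qed.

Lemma ae_impl2 (P Q S : T -> Prop) : (forall x, P x -> Q x -> S x) ->
  {ae mu, forall x, P x} -> {ae mu, forall x, Q x} -> {ae mu, forall x, S x}.
Proof.
move=> PQS aP aQ; near=> x; apply: PQS; near: x; [exact: aP|exact: aQ].
Unshelve. all: end_near. Qed.

Local Open Scope ereal_scope.

Lemma ge0_le_eq_integral_ae (f h : T -> \bar R) :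
  measurable_fun setT f -> measurable_fun setT h ->
  (forall x, 0 <= f x) -> (forall x, 0 <= h x) ->
  {ae mu, forall x, f x <= h x} ->
  \int[mu]_x f x = \int[mu]_x h x -> \int[mu]_x h x < +oo ->
  {ae mu, forall x, f x = h x}.
Proof.
move=> mf mh f0 h0 fh Efh hy.
have ih : mu.-integrable setT h.
  by apply/integrableP; split => //; under eq_integral do rewrite gee0_abs//.
have if_ : mu.-integrable setT f.
  by apply/integrableP; split => //; under eq_integral do rewrite gee0_abs//; rewrite Efh.
have finh := integrable_ae measurableT ih.
have finf := integrable_ae measurableT if_.
have : ae_eq mu setT (h \- f) (cst 0).
  apply/ae_eq_integral_abs => //; first exact: emeasurable_funB.
  rewrite (@ae_eq_integral _ _ _ mu _ (h \- f))//.
  - rewrite integralB// Efh subee//; exact: integrable_fin_num.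
  - by apply: measurableT_comp => //; exact: emeasurable_funB.
  - exact: emeasurable_funB.
  - move: fh finf; apply: ae_impl2.
    by move=> x fx ff _; rewrite /= gee0_abs// sube_ge0//; apply/orP; left; exact: ff.
move=> E; have {E}E : {ae mu, forall x, h x - f x = 0}.
  by move: E; apply: ae_impl => x; exact.
have {finf}finh' : {ae mu, forall x, h x \is a fin_num /\ f x \is a fin_num}.
  move: finh finf; apply: ae_impl2.
  by move=> x hx fx; split; [exact: hx|exact: fx].
move: E finh'; apply: ae_impl2.
move=> x E [hx fx]; move: E hx fx; case: (h x) => // r; case: (f x) => // s.
by rewrite -EFinB => -[/subr0_eq ->].
Qed.

End EqualIntegrals.

Section Reweighting.
Context d (T : measurableType d) (R : realType).
Variables (A : (set T)^nat) (mA : forall k, measurable (A k)).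
Hypotheses (tA : trivIset setT A) (UA : \bigcup_k A k = setT).
Variables (eta : {measure set T -> \bar R}) (a : nat -> {nonneg R}).
Local Open Scope ereal_scope.

(** A measure with this property is determined by it, as the cells cover the space.
    Stating the property instead of using the explicit series [reweighting] lets
    nu be any finite measure structure. *)
Definition reweighted (nu : {measure set T -> \bar R}) :=
  forall k B, measurable B -> B `<=` A k -> nu B = (a k)%:num%:E * eta B.

Definition reweighting : set T -> \bar R :=
  mseries (fun k => mscale (a k) (mrestr eta (mA k))) 0.

HB.instance Definition _ := Measure.on reweighting.

Lemma reweightedP : reweighted reweighting.
Proof.
move=> k B mB BA.
transitivity (\sum_(j <oo) mscale (a j) (mrestr eta (mA j)) B) => //.
rewrite (@nneseriesD1 _ _ k)//=.
rewrite eseries0 ?adde0; last first.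
  move=> j _ jk; rewrite /mscale /= /mrestr.
  suff -> : B `&` A j = set0 by rewrite measure0 mule0.
  apply/seteqP; split => // x [/BA xk xj].
  by move: jk; rewrite (tA _ _ (ex_intro _ x (conj xj xk)))// eqxx.
by rewrite /mscale /= /mrestr (setIidl BA).
Qed.

Section Finite.
Hypothesis fin : \sum_(k <oo) ((a k)%:num%:E * eta (A k)) < +oo.

Let reweighting_fin : fin_num_fun reweighting.
Proof.
apply: lty_fin_num_fun; move: fin; congr (_ < _); apply: eq_eseriesr => k _.
by transitivity ((a k)%:num%:E * eta (setT `&` A k)) => //; rewrite setTI.
Qed.

HB.instance Definition _ :=
  Measure_isFinite.Build _ _ _ reweighting reweighting_fin.

Lemma reweighted_exists :
  exists nu : {finite_measure set T -> \bar R}, reweighted nu.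
Proof. by exists reweighting; exact: reweightedP. Qed.

End Finite.

Variables (nu : {measure set T -> \bar R}) (nuE : reweighted nu).

Lemma reweighted_ae (P : T -> Prop) :
  {ae eta, forall x, P x} -> {ae nu, forall x, P x}.
Proof.
move=> [N [mN N0 PN]]; apply: (@negligibleS _ _ _ nu (\bigcup_k (N `&` A k))).
  by move=> x /PN Nx; have [k _ Ak] : (\bigcup_k A k) x by [rewrite UA]; exists k.
apply: negligible_bigcup => k; exists (N `&` A k); split => //.
  exact: measurableI.
rewrite (nuE (measurableI _ _ mN (mA k)) (@subIsetr _ _ _)).
by rewrite (subset_measure0 _ mN (@subIsetl _ _ _))// ?mule0//; exact: measurableI.
Qed.

Lemma ge0_integral_reweighted_cell (f : T -> \bar R) k :
  measurable_fun setT f -> (forall x, 0 <= f x) ->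
  \int[nu]_(x in A k) f x = (a k)%:num%:E * \int[eta]_(x in A k) f x.
Proof.
move=> mf f0; rewrite (@eq_measure_integral _ _ _ _ (mscale (a k) eta)).
  by rewrite ge0_integral_mscale//; exact: measurable_funTS.
by move=> B mB BA; rewrite (nuE mB BA).
Qed.

Lemma integral_reweighted_cell (f : T -> \bar R) k : eta.-integrable setT f ->
  \int[nu]_(x in A k) f x = (a k)%:num%:E * \int[eta]_(x in A k) f x.
Proof.
move=> itf; have mf := measurable_int _ itf.
have itfk := integrableS measurableT (mA k) (@subsetT _ _) itf.
rewrite integralE [in RHS]integralE !ge0_integral_reweighted_cell//.
- rewrite [RHS]muleBr//; apply: fin_num_adde_defl; rewrite fin_numN.
  exact: integrable_neg_fin_num itfk.
- exact: measurable_funeneg.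
- exact: measurable_funepos.
Qed.

Lemma ge0_integral_cells (mu : {measure set T -> \bar R}) (f : T -> \bar R) :
  measurable_fun setT f -> (forall x, 0 <= f x) ->
  \int[mu]_x f x = \sum_(k <oo) \int[mu]_(x in A k) f x.
Proof.
move=> mf f0; rewrite -ge0_integral_bigcup ?UA//.
Qed.

Lemma ge0_integral_reweighted (f : T -> \bar R) :
  measurable_fun setT f -> (forall x, 0 <= f x) ->
  \int[nu]_x f x = \sum_(k <oo) ((a k)%:num%:E * \int[eta]_(x in A k) f x).
Proof.
move=> mf f0; rewrite ge0_integral_cells//; apply: eq_eseriesr => k _.
exact: ge0_integral_reweighted_cell.
Qed.

End Reweighting.

Section NonnegativeSeries.
Context {R : realType}.
Implicit Types v : nat -> R.

Lemma eseries_EFin v n : (\sum_(0 <= k < n) (v k)%:E)%E = (series v n)%:E.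
Proof. by rewrite sumEFin. Qed.

Lemma nneseries_le v (c : R) : (forall k, 0 <= v k) ->
  (forall n, series v n <= c) -> (\sum_(k <oo) (v k)%:E <= c%:E)%E.
Proof.
move=> v0 vc; apply: lime_le.
  by apply: is_cvg_nneseries => k _ _; rewrite lee_fin.
by apply: nearW => n; rewrite eseries_EFin lee_fin.
Qed.

Lemma nneseries_cvg v (s : R) : (forall k, 0 <= v k) ->
  (\sum_(k <oo) (v k)%:E = s%:E)%E -> series v @ \oo --> s.
Proof.
move=> v0 vs.
have : (\sum_(0 <= k < n) (v k)%:E)%E @[n --> \oo] --> s%:E.
  by rewrite -vs; apply: is_cvg_nneseries => k _ _; rewrite lee_fin.
move/fine_cvg; apply: cvg_trans; apply: near_eq_cvg; apply: nearW => n /=.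
by rewrite eseries_EFin.
Qed.

End NonnegativeSeries.

Section SeriesOfIntegrals.
Context d (T : measurableType d) (R : realType).
Variables (A : (set T)^nat) (mA : forall k, measurable (A k)).
Hypotheses (tA : trivIset setT A) (UA : \bigcup_k A k = setT).
Variable mu : {measure set T -> \bar R}.

Lemma ge0_integral_cells_cvg (h : T -> \bar R) :
  measurable_fun setT h -> (forall x, 0 <= h x)%E -> (\int[mu]_x h x < +oo)%E ->
  series (fun k => fine (\int[mu]_(x in A k) h x)%E) @ \oo -->
    fine (\int[mu]_x h x)%E.
Proof.
move=> mh h0 hoo; apply: nneseries_cvg.
  by move=> k; rewrite fine_ge0// integral_ge0.
have fin : (\int[mu]_x h x)%E \is a fin_num by rewrite ge0_fin_numE// integral_ge0.
rewrite fineK// (ge0_integral_cells mA tA UA)//.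
apply: eq_eseriesr => k _; rewrite fineK// ge0_fin_numE ?integral_ge0//.
apply: le_lt_trans hoo; apply: ge0_subset_integral => //.
Qed.

(** The series of the positive and of the negative parts converge separately. *)
Lemma Rintegral_cells_cvg (f : T -> R) : mu.-integrable setT (EFin \o f) ->
  series (fun k => \int[mu]_(x in A k) f x) @ \oo --> \int[mu]_x f x.
Proof.
move=> itf; have mf := measurable_int _ itf.
have pos := ge0_integral_cells_cvg (measurable_funepos mf) (funepos_ge0 _)
  (integral_funepos_lt_pinfty measurableT itf).
have neg := ge0_integral_cells_cvg (measurable_funeneg mf) (funeneg_ge0 _)
  (integral_funeneg_lt_pinfty measurableT itf).
rewrite /Rintegral integralE fineB; last 2 first.
- exact: (integrable_pos_fin_num measurableT itf).
- exact: (integrable_neg_fin_num measurableT itf).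
suff -> : series (fun k => \int[mu]_(x in A k) f x) =
    (fun n => series (fun k => fine (\int[mu]_(x in A k) (EFin \o f)^\+ x)%E) n -
      series (fun k => fine (\int[mu]_(x in A k) (EFin \o f)^\- x)%E) n).
  exact: cvgB pos neg.
apply/funext => n; rewrite /series/= -sumrB; apply: eq_bigr => k _.
have itfk := integrableS measurableT (mA k) (@subsetT _ _) itf.
rewrite /Rintegral integralE fineB//.
- exact: (integrable_pos_fin_num (mA k) itfk).
- exact: (integrable_neg_fin_num (mA k) itfk).
Qed.

End SeriesOfIntegrals.

(** * Reweightings of a good decomposition *)
Section GoodReweighting.
Context {R : realType} {m : nat}.
Notation G := (Gamma R m).
Notation V := 'rV[R]_m.
Variables (T : current1 R m) (eta : {finite_measure set G -> \bar R}).
Hypothesis good : good_decomposition eta T.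
Variables (A : (set G)^nat) (mA : forall k, measurable (A k)).
Hypotheses (tA : trivIset setT A) (UA : \bigcup_k A k = setT).
Implicit Types (omega : V -> V) (k : nat).

Let massI (g : G) : \bar R := mass1 (curve_current g).
Let massB (g : G) : \bar R := mass0 (boundary (curve_current g)).

Let massI_ge0 g : (0 <= massI g)%E.
Proof. exact: mass1_ge0 (curve_current0 g). Qed.

Let massB_ge0 g : (0 <= massB g)%E.
Proof. exact: mass0_ge0 (curve_current0 g). Qed.

Let massI_meas : measurable_fun setT massI.
Proof. by have [_ [_ [_ [[]]]]] := good. Qed.

Let massB_meas : measurable_fun setT massB.
Proof. by have [_ [_ [_ [_ []]]]] := good. Qed.

Let mass_T : mass1 T = (\int[eta]_g massI g)%E.
Proof. by have [_ [_ [_ [[_ _ h _] _]]]] := good. Qed.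

Let mass_bT : mass0 (boundary T) = (2%:E * eta setT)%E.
Proof. by have [_ [_ [_ [_ [_ -> h]]]]] := good. Qed.

Let ae_simple : {ae eta, forall g : G, nonconstant g /\ simple_curve g}.
Proof. by have [_ []] := good. Qed.

Lemma good_mass_lty : (\int[eta]_g massI g < +oo)%E.
Proof.
have [nT _] := good; move: nT; rewrite /normal_current mass_T; apply: le_lt_trans.
by rewrite leeDl// mass_bT mule_ge0// lee_fin.
Qed.

(** The inequality [mass1_curve_le] between functions with equal finite integrals. *)
Lemma good_mass_length : {ae eta, forall g : G, massI g = hausdorff1 (curve_image g)}.
Proof.
have [_ [_ [_ [[_ mH _ EH] _]]]] := good.
apply: ge0_le_eq_integral_ae => //.
- by move=> g; exact: hausdorff1_ge0.
- move: ae_simple; apply: ae_impl => g [ncg sg].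
  exact: mass1_curve_le.
- by rewrite -EH good_mass_lty.
Qed.

Lemma good_boundary_mass : {ae eta, forall g : G, massB g = 2%:E}.
Proof.
have [_ [_ [_ [_ [_ _ E2]]]]] := good.
have c2 : (\int[eta]_g (cst 2%:E) g = 2%:E * eta setT)%E by rewrite integral_cst.
apply: (@ge0_le_eq_integral_ae _ _ _ eta massB (cst 2%:E)) => //.
- by move=> g; rewrite lee_fin.
- move: ae_simple; apply: ae_impl => g [ncg sg].
  exact: mass0_curve_le.
- by rewrite c2 E2.
- by rewrite c2 lte_mul_pinfty// ?lee_fin//; exact: fin_num_fun_lty.
Qed.

Definition cell_mass k : R := fine (\int[eta]_(g in A k) massI g)%E.
Definition cell_measure k : R := fine (eta (A k)).
(** The factor 2 is the boundary mass of a single curve, so that the weights add up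
    to the mass of T plus the mass of its boundary. *)
Definition cell_weight k : R := cell_mass k + 2 * cell_measure k.
Definition cell_current k : current1 R m := curve_integral eta (A k).

Lemma cell_massE k : (\int[eta]_(g in A k) massI g = (cell_mass k)%:E)%E.
Proof.
rewrite /cell_mass fineK// ge0_fin_numE ?integral_ge0//.
by apply: le_lt_trans good_mass_lty; exact: ge0_subset_integral.
Qed.

Lemma cell_measureE k : eta (A k) = (cell_measure k)%:E.
Proof. by rewrite /cell_measure fineK// fin_num_measure. Qed.

Lemma cell_mass_ge0 k : 0 <= cell_mass k.
Proof. by rewrite fine_ge0// integral_ge0. Qed.

Lemma cell_measure_ge0 k : 0 <= cell_measure k.
Proof. exact: fine_ge0. Qed.

Lemma cell_weight_ge0 k : 0 <= cell_weight k.
Proof. by rewrite addr_ge0 ?cell_mass_ge0 ?mulr_ge0 ?cell_measure_ge0. Qed.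

Lemma test_form_integrable omega : test_form omega ->
  eta.-integrable setT (fun g => (curve_current g omega)%:E).
Proof. by move=> to; have [_ [_ [/(_ _ to)[]]]] := good. Qed.

Lemma curve_current_bound omega : test_form omega ->
  exists2 B : R, 0 < B & {ae eta, forall g : G,
    (`|(curve_current g omega)%:E| <= B%:E * massI g)%E}.
Proof.
move=> to; have [B B0 oB] := test_form_bounded to; exists B => //.
move: ae_simple; apply: ae_impl => g [ncg sg].
exact: curve_current_le_mass1.
Qed.

Lemma cell_current_bound omega : test_form omega ->
  exists2 B : R, 0 < B & forall k, `|cell_current k omega| <= B * cell_mass k.
Proof.
move=> to; have [B B0 oB] := curve_current_bound to; exists B => // k.
have io := integrableS measurableT (mA k) (@subsetT _ _) (test_form_integrable to).
rewrite -lee_fin EFinM -cell_massE /cell_current /curve_integral /Rintegral.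
rewrite -abse_EFin fineK; last exact: integrable_fin_num.
apply: le_trans (le_abse_integral _ _ _) _ => //; first exact: measurable_int io.
rewrite -ge0_integralZl//; last 2 first.
- exact: measurable_funTS.
- by rewrite lee_fin ltW.
apply: ae_ge0_le_integral => //.
- apply: measurableT_comp => //; exact: measurable_int io.
- by move=> g _; rewrite mule_ge0// lee_fin ltW.
- by apply: measurable_funeM; exact: measurable_funTS.
- by move: oB; apply: ae_impl => g + _.
Qed.

Definition total_weight : R := fine (mass1 T) + 2 * fine (eta setT).

Lemma cell_weight_cvg : series cell_weight @ \oo --> total_weight.
Proof.
have hM : series cell_mass @ \oo --> fine (mass1 T).
  rewrite mass_T; apply: ge0_integral_cells_cvg => //; exact: good_mass_lty.
have hE : series cell_measure @ \oo --> fine (eta setT).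
  apply: nneseries_cvg; first exact: cell_measure_ge0.
  rewrite fineK ?fin_num_measure// -UA measure_bigcup//.
  transitivity (\sum_(k <oo) eta (A k))%E.
    by apply: eq_eseriesr => k _; rewrite cell_measureE.
  by apply: eq_eseriesl => k; rewrite in_setT.
rewrite (_ : series _ = series cell_mass + (2 : R) *: series cell_measure); last first.
  by apply/funext => n; rewrite /series/= big_split/= -mulr_sumr.
by apply: cvgD => //; apply: cvgZr.
Qed.

Variables (a : nat -> {nonneg R}) (nu : {finite_measure set G -> \bar R}).
Variable c : R.
Hypotheses (nuE : reweighted A eta a nu)
  (abal : forall omega, test_form omega ->
    series (fun k => ((a k)%:num - 1) * cell_current k omega) @ \oo --> (0 : R))
  (abnd : forall n, series (fun k => (a k)%:num * cell_weight k) n <= c).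

Let mass_nu :
  (\int[nu]_g massI g = \sum_(k <oo) ((a k)%:num * cell_mass k)%:E)%E.
Proof.
rewrite (ge0_integral_reweighted mA tA UA nuE)//.
by apply: eq_eseriesr => k _; rewrite cell_massE EFinM.
Qed.

Let measure_nu : (nu setT = \sum_(k <oo) ((a k)%:num * cell_measure k)%:E)%E.
Proof.
rewrite -UA measure_bigcup//.
transitivity (\sum_(k <oo) nu (A k))%E.
  by apply: eq_eseriesl => k; rewrite in_setT.
by apply: eq_eseriesr => k _; rewrite (nuE (mA k) (@subset_refl _ _)) EFinM -cell_measureE.
Qed.

Let weight_nu : (\int[nu]_g massI g + 2%:E * nu setT <= c%:E)%E.
Proof.
rewrite mass_nu measure_nu -nneseriesZl; last first.
  by move=> k _; rewrite lee_fin mulr_ge0// cell_measure_ge0.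
rewrite -nneseriesD; last 2 first.
- by move=> k _ _; rewrite lee_fin mulr_ge0// cell_mass_ge0.
- by move=> k _ _; rewrite -EFinM lee_fin !mulr_ge0// cell_measure_ge0.
under eq_eseriesr.
  move=> k _; rewrite -EFinM -EFinD mulrCA -mulrDr.
  over.
apply: nneseries_le abnd => k; exact: mulr_ge0 (cell_weight_ge0 k).
Qed.

Let mass_nu_lty : (\int[nu]_g massI g < +oo)%E.
Proof.
apply: le_lt_trans (le_lt_trans weight_nu (ltry c)).
by rewrite leeDl// mule_ge0// lee_fin.
Qed.

Let massI_integrable : nu.-integrable setT massI.
Proof.
apply/integrableP; split => //.
by under eq_integral do rewrite gee0_abs//.
Qed.

Let boundary_nu : (\int[nu]_g massB g = 2%:E * nu setT)%E.
Proof.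
transitivity (\int[nu]_g (cst 2%:E) g)%E; last by rewrite integral_cst.
apply: ae_eq_integral => //.
by move: (reweighted_ae mA UA nuE good_boundary_mass); apply: ae_impl => g + _.
Qed.

Let massB_integrable : nu.-integrable setT massB.
Proof.
apply/integrableP; split => //.
under eq_integral do rewrite gee0_abs//.
by rewrite boundary_nu lte_mul_pinfty// ?lee_fin//; exact: fin_num_fun_lty.
Qed.

Let current_integrable omega : test_form omega ->
  nu.-integrable setT (fun g => (curve_current g omega)%:E).
Proof.
move=> to; have [B B0 oB] := curve_current_bound to.
have mo := measurable_int _ (test_form_integrable to).
apply/integrableP; split => //.
apply: (@le_lt_trans _ _ (B%:E * \int[nu]_g massI g)%E); last first.
  by rewrite lte_mul_pinfty// ?lee_fin// ltW.
rewrite -ge0_integralZl//; last by rewrite lee_fin ltW.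
apply: ae_ge0_le_integral => //.
- exact: measurableT_comp.
- by move=> g _; rewrite mule_ge0// lee_fin ltW.
- exact: measurable_funeM.
- by move: (reweighted_ae mA UA nuE oB); apply: ae_impl => g + _.
Qed.

(** The equations sum_k (a_k - 1) I_k = 0 say that the contributions of the cells have
    the same sum for nu as for [eta]. *)
Let current_nu omega : test_form omega -> T omega = curve_integral nu setT omega.
Proof.
move=> to; have [_ [_ [/(_ _ to)[io ->] _]]] := good.
have heta := Rintegral_cells_cvg mA tA UA io.
have hnu := Rintegral_cells_cvg mA tA UA (current_integrable to).
have hnuE : series (fun k => \int[nu]_(g in A k) curve_current g omega) =
    (fun n => series (fun k => ((a k)%:num - 1) * cell_current k omega) n +
      series (fun k => cell_current k omega) n).
  apply/funext => n; rewrite /series/= -big_split/=; apply: eq_bigr => k _.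
  rewrite mulrBl mul1r subrK /Rintegral (integral_reweighted_cell mA nuE)//.
  rewrite fineM//; apply: integrable_fin_num => //.
  exact: integrableS measurableT (mA k) (@subsetT _ _) io.
have : series (fun k => \int[nu]_(g in A k) curve_current g omega) @ \oo -->
    (0 + curve_integral eta setT omega).
  by rewrite hnuE; exact: (cvgD (abal to) heta).
by rewrite add0r => h; exact: (cvg_unique _ h hnu).
Qed.

(** The mass is a supremum of linear functionals, and T is the superposition of the
    I_g with respect to nu. *)
Let mass_le : (mass1 T <= \int[nu]_g massI g)%E.
Proof.
apply: ge_ereal_sup => _ [omega [to o1] <-].
have io := current_integrable to.
rewrite current_nu// /curve_integral /Rintegral fineK; last exact: integrable_fin_num.
apply: le_integral => // g _; apply: ereal_sup_ubound.
by exists omega.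
Qed.

Let boundary_le : (mass0 (boundary T) <= \int[nu]_g massB g)%E.
Proof.
apply: ge_ereal_sup => _ [f [tf f1] <-].
have to := gradient_test_form tf; have io := current_integrable to.
rewrite /boundary current_nu// /curve_integral /Rintegral fineK; last exact: integrable_fin_num.
apply: le_integral => // g _; apply: ereal_sup_ubound.
by exists f.
Qed.

Let total_weightE : (total_weight%:E = mass1 T + mass0 (boundary T))%E.
Proof.
rewrite /total_weight EFinD EFinM mass_bT !fineK//; first exact: fin_num_measure.
by rewrite mass_T ge0_fin_numE ?integral_ge0// good_mass_lty.
Qed.

Lemma total_weight_min : total_weight <= c.
Proof.
rewrite -lee_fin total_weightE (le_trans _ weight_nu)//.
by rewrite leeD// -boundary_nu.
Qed.

(** The two masses of T are at most the two integrals, and the sums of both sides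
    agree, so each inequality is an equality. *)
Lemma good_reweighted : c = total_weight -> good_decomposition nu T.
Proof.
move=> cS.
have Mfin : mass1 T \is a fin_num.
  by rewrite mass_T ge0_fin_numE ?integral_ge0// good_mass_lty.
have Nfin : mass0 (boundary T) \is a fin_num.
  by rewrite mass_bT fin_numM// fin_num_measure.
have le : (\int[nu]_g massI g + \int[nu]_g massB g <= mass1 T + mass0 (boundary T))%E.
  by rewrite -total_weightE -cS boundary_nu.
have EM : mass1 T = (\int[nu]_g massI g)%E.
  apply/eqP; rewrite eq_le mass_le/= -(leeD2rE _ _ Nfin).
  by rewrite (le_trans _ le)// leeD2l.
have EN : mass0 (boundary T) = (\int[nu]_g massB g)%E.
  apply/eqP; rewrite eq_le boundary_le/= -(leeD2lE _ _ Mfin).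
  by rewrite (le_trans _ le)// leeD2r.
have [nT [_ [_ [[_ mH _ _] _]]]] := good.
split => //; split; first exact: (reweighted_ae mA UA nuE).
split; first by move=> omega to; split; [exact: current_integrable|exact: current_nu].
split; last by split => //; exact: boundary_nu.
split => //; apply: ae_eq_integral => //.
by move: (reweighted_ae mA UA nuE good_mass_length); apply: ae_impl => g + _.
Qed.

End GoodReweighting.

(** * Extreme points of linear systems in countably many unknowns *)
Section ExtremePoint.
Context {R : realType}.
Implicit Types u v w : nat -> R.

(** Each J in [fam] is the sequence of coefficients of one linear equation.  The
    unknown u is compared with the known solution w, since the convergence of the
    series of the differences is all that is asked for. *)
Definition admissible w (fam : set (nat -> R)) u :=
  [/\ forall k, 0 <= u k, forall k, w k = 0 -> u k = 0 &
      forall J, fam J -> series (fun k => (u k - w k) * J k) @ \oo --> (0 : R)].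

(** Closed conditions on finitely many coordinates pass to cluster points of the
    product topology. *)
Lemma cluster_le (U : nat -> prod_topology (fun _ : nat => (R : topologicalType)))
    p (G : prod_topology (fun _ : nat => (R : topologicalType)) -> R) (c : R) :
  cluster (U n @[n --> \oo]) p -> continuous G ->
  (forall n, G (U n) <= c + n.+1%:R^-1) -> G p <= c.
Proof.
move=> clp cG h; apply/ler_addgt0Pl => e e0.
have cD : closed [set u | G u <= e + c].
  by apply: (@preimage_closed _ _ G [set r | r <= e + c]) => //; exact: closed_le.
apply: cD; move=> B nB; apply: clp => //.
have := near_infty_natSinv_lt (PosNum e0).
apply: filterS => n /= nl.
by rewrite (le_trans (h n))// addrC lerD2r ltW.
Qed.

Lemma continuous_coord_sum (F : nat -> R -> R) n : (forall k, continuous (F k)) ->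
  continuous (fun u : prod_topology (fun _ : nat => (R : topologicalType)) =>
    \sum_(0 <= k < n) F k (u k)).
Proof.
set PT := prod_topology _ => cF.
have cG k : continuous (fun u : PT => F k (u k)).
  move=> u.
  by apply: (continuous_comp (@proj_continuous nat (fun _ => (R : topologicalType)) k u)); exact: cF.
elim: n => [|n IH] u.
  have -> : (fun u : PT => \sum_(0 <= k < 0) F k (u k)) = cst 0.
    by apply/funext => f; rewrite big_geq.
  exact: cst_continuous.
have -> : (fun u : PT => \sum_(0 <= k < n.+1) F k (u k)) =
    (fun u : PT => \sum_(0 <= k < n) F k (u k) + F n (u n)).
  by apply/funext => f; rewrite big_nat_recr.
exact: (cvgD (IH u) (cG n u)).
Qed.

Lemma small_multiple u v n : (forall k, 0 <= u k) ->
  (forall k, v k != 0 -> 0 < u k) ->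
  exists2 e, 0 < e & forall k, (k < n)%N -> e * `|v k| <= u k.
Proof.
move=> u0 vu; elim: n => [|n [e e0 IH]]; first by exists 1.
have [vn0|vn0] := eqVneq (v n) 0.
  exists e => // k; rewrite ltnS leq_eqVlt => /predU1P[->|/IH//].
  by rewrite vn0 normr0 mulr0.
have un := vu _ vn0.
exists (Num.min e (u n / `|v n|)).
  by rewrite lt_min e0/= divr_gt0// normr_gt0.
move=> k; rewrite ltnS leq_eqVlt => /predU1P[->|/IH].
  by rewrite -ler_pdivlMr ?normr_gt0// ge_min lexx orbT.
by apply: le_trans; rewrite ler_wpM2r// ge_min lexx.
Qed.

Lemma series_finite_support (a : nat -> R) N n : (forall k, a k != 0 -> (k < N)%N) ->
  (N <= n)%N -> \sum_(0 <= k < n) a k = \sum_(0 <= k < N) a k.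
Proof.
move=> aN Nn; rewrite (big_cat_nat (n := N))//= [X in _ + X]big1_seq ?addr0//.
move=> k; rewrite mem_index_iota => /andP[_ /andP[Nk _]].
by apply/eqP; apply: contraTT Nk => /aN; rewrite ltnNge.
Qed.

(** Let S be the sum of w, r_k = sum_(j >= k) w_j and phi_k = S + 1/sqrt(r_k).  The
    functional Psi(u) = sum_k u_k (phi_k - u_k) is strictly concave, and it is
    minimized over the admissible u with sum at most S.

    Its value at w is finite, because
    w_k / sqrt(r_k) <= 2 (sqrt(r_k) - sqrt(r_(k+1))) telescopes.  On the other hand
    sum_(k >= n) u_k <= sqrt(r_n) Psi(u), so along a minimizing sequence the tails
    are uniformly small.  A cluster point p in the compact product of the intervals
    from 0 to S therefore solves the equations, and it is a minimizer.

    Let v be a finite relation between the coefficients, supported where p is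
    positive.  For small e > 0 both p + e v and p - e v are admissible, and as no
    admissible sequence has sum below S, the sum of v is zero.  So p + e v and
    p - e v compete with p, but the average of their values under Psi is
    Psi(p) - e^2 sum_k v_k^2. *)
Lemma extreme_point w (fam : set (nat -> R)) :
  (forall k, 0 <= w k) -> cvgn (series w) ->
  (forall J, fam J -> exists C, forall k, `|J k| <= C) ->
  (forall u c, admissible w fam u -> (forall n, series u n <= c) ->
     limn (series w) <= c) ->
  exists u, [/\ admissible w fam u, forall n, series u n <= limn (series w) &
    forall v N, (forall k, v k != 0 -> (k < N)%N /\ 0 < u k) ->
      (forall J, fam J -> \sum_(0 <= k < N) v k * J k = 0) ->
      forall k, v k = 0].
Proof.
move=> w0 cw Jbd Hmin; set S := limn (series w) in Hmin *.
pose r k : R := S - series w k.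
have wS n : series w n <= S.
  apply: nondecreasing_cvgn_le => //; apply: nondecreasing_series => k _ _; exact: w0.
have r0 k : 0 <= r k by rewrite subr_ge0.
have rS k : r k - r k.+1 = w k.
  by rewrite /r /series/= big_nat_recr//=; lra.
have S0 : 0 <= S by have := wS 0%N; rewrite /series/= big_geq.
have rni : {homo r : n m / (n <= m)%N >-> m <= n}.
  by apply/nonincreasing_seqP => k; rewrite -subr_ge0 rS.
have rcv : r @ \oo --> (0 : R).
  by rewrite -(subrr S); apply: cvgB => //; exact: cvg_cst.
pose phi k := S + (Num.sqrt (r k))^-1.
pose Psi u n : R := \sum_(0 <= k < n) u k * (phi k - u k).
pose K c := [set u | [/\ admissible w fam u, forall n, series u n <= S &
                         forall n, Psi u n <= c]].
have le1 u : (forall k, 0 <= u k) -> (forall n, series u n <= S) -> forall k, u k <= S.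
  move=> u0 uS k; apply: le_trans (uS k.+1).
  by rewrite /series/= big_nat_recr//= lerDr sumr_ge0.
(* w_k = r_k - r_(k+1) makes the part of Psi(w) with 1/sqrt(r_k) telescope *)
have Kw : K (S * S + 2 * Num.sqrt S) w.
  split => //.
    split => // J _; rewrite [series _](_ : _ = fun=> 0); first exact: cvg_cst.
    by apply/funext => n; rewrite /series/= big1// => k _; rewrite subrr mul0r.
  move=> n; apply: (@le_trans _ _ (S * series w n + 2 * (Num.sqrt S - Num.sqrt (r n)))).
    rewrite /Psi /series/=; elim: n => [|n IH].
      by rewrite !big_geq// mulr0 add0r mulr_ge0// subr_ge0 ler_wsqrtr// /r /series/= big_geq// subr0.
    rewrite big_nat_recr//= [in leRHS]big_nat_recr//=.
    have h : w n * (Num.sqrt (r n))^-1 <= 2 * (Num.sqrt (r n) - Num.sqrt (r n.+1)).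
      have le12 : Num.sqrt (r n.+1) <= Num.sqrt (r n) by rewrite ler_wsqrtr// rni.
      have [rn0|rn0] := eqVneq (Num.sqrt (r n)) 0.
        by rewrite [X in X^-1]rn0 invr0 mulr0 mulr_ge0// subr_ge0.
      have rn1 : 0 < Num.sqrt (r n) by rewrite lt_neqAle eq_sym rn0 sqrtr_ge0.
      rewrite ler_pdivrMr// -rS -{1}(sqr_sqrtr (r0 n)) -{1}(sqr_sqrtr (r0 n.+1)).
      have := sqrtr_ge0 (r n.+1).
      nra.
    have := sqr_ge0 (w n); rewrite /phi. nra.
  rewrite lerD//; first by rewrite ler_wpM2l.
  by rewrite ler_wpM2l// gerBl sqrtr_ge0.
pose C := [set c | exists u, K c u].
have term0 u k : (forall k, 0 <= u k) -> (forall n, series u n <= S) ->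
    u k * (Num.sqrt (r k))^-1 <= u k * (phi k - u k).
  move=> u0 uS; rewrite ler_wpM2l//; have := le1 _ u0 uS k; rewrite /phi; lra.
have termp u k : (forall k, 0 <= u k) -> (forall n, series u n <= S) ->
    0 <= u k * (phi k - u k).
  move=> u0 uS; apply: le_trans (term0 _ _ u0 uS).
  by rewrite mulr_ge0// invr_ge0 sqrtr_ge0.
have Clb c : C c -> 0 <= c.
  by move=> [u [_ _ /(_ 0%N)]]; rewrite /Psi big_geq.
have Cinf : has_inf C.
  by split; [exists (S * S + 2 * Num.sqrt S), w|exists 0 => c /Clb].
set cs := inf C.
have cs0 : 0 <= cs by apply: lb_le_inf; [case: Cinf|move=> c /Clb].
have ex n : exists u, K (cs + n.+1%:R^-1) u.
  have /(inf_adherent) : 0 < n.+1%:R^-1 :> R by rewrite invr_gt0.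
  move=> /(_ _ Cinf)[c [u [Ku uS uP]] /ltW cl]; exists u; split => // k.
  exact: le_trans (uP k) cl.
have {ex}[U UK] := choice ex.
pose box := [set f : prod_topology (fun _ : nat => (R : topologicalType)) |
   forall i, `[0, S]%classic (f i)].
have cbox : compact box.
  apply: (@tychonoff nat (fun _ => (R : topologicalType)) (fun _ => `[0, S]%classic)).
  by move=> i; exact: segment_compact.
have Ubox n : box (U n).
  by move=> i/=; rewrite in_itv/=; have [[u0 _ _] uS _] := UK n; rewrite u0 le1.
have [p [pbox clp]] : box `&` cluster ((U : nat -> prod_topology (fun _ : nat => (R : topologicalType))) n @[n --> \oo]) !=set0.
  by apply: cbox; exists 0%N => // n _; exact: Ubox.
have p0 k : 0 <= p k by have := pbox k; rewrite /= in_itv/= => /andP[].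
have pS n : series p n <= S.
  apply: (cluster_le clp (@continuous_coord_sum (fun _ x => x) n (fun _ x => (cvg_id : x @[x --> x] --> x)))).
  by move=> k; have [_ uS _] := UK k; rewrite (le_trans (uS n))// lerDl.
have pPsi n : Psi p n <= cs.
  have cF k : continuous (fun x : R => x * (phi k - x)).
    by move=> x; apply: cvgM => //; apply: cvgB => //; exact: cvg_cst.
  by apply: (cluster_le clp (@continuous_coord_sum (fun k x => x * (phi k - x)) n cF)) => k; have [_ _ ] := UK k; exact.
have pw k : w k = 0 -> p k = 0.
  move=> wk; apply/eqP; rewrite eq_le p0 andbT.
  apply: (cluster_le clp (@proj_continuous nat (fun _ => (R : topologicalType)) k)) => n.
  by have [[_ /(_ _ wk) uw _] _ _] := UK n; rewrite /proj uw add0r.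
(* a bound on the functional controls the tails *)
have tail u c n m : K c u -> (n <= m)%N -> \sum_(n <= k < m) u k <= Num.sqrt (r n) * c.
  move=> [[u0 uw _] uS uP] nm.
  apply: (@le_trans _ _ (\sum_(n <= k < m) Num.sqrt (r n) * (u k * (phi k - u k)))).
    apply: ler_sum_nat => k /andP[nk km].
    apply: (@le_trans _ _ (Num.sqrt (r n) * (u k * (Num.sqrt (r k))^-1))); last first.
      by rewrite ler_wpM2l ?sqrtr_ge0// term0.
    have [rk0|rk0] := eqVneq (r k) 0.
      rewrite uw ?mul0r ?mulr0//; apply/eqP; rewrite eq_le w0 andbT -rS rk0 sub0r oppr_le0; exact: r0.
    have rk1 : 0 < Num.sqrt (r k) by rewrite sqrtr_gt0 lt_neqAle eq_sym rk0 r0.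
    rewrite mulrA ler_pdivlMr// mulrC ler_wpM2r//.
    by rewrite ler_wsqrtr// rni.
  rewrite -mulr_sumr ler_wpM2l ?sqrtr_ge0//; apply: le_trans (uP m).
  by rewrite /Psi [leRHS](big_cat_nat (n := n))//= lerDr sumr_ge0// => k _; exact: termp.
have wtail n m : (n <= m)%N -> \sum_(n <= k < m) w k <= r n.
  move=> nm; have := wS m; rewrite /r /series/= (big_cat_nat (n := n))//=; lra.
(* the truncated equations hold up to an error that depends on n and c only *)
have rep u c J B n : K c u -> fam J -> (forall k, `|J k| <= B) ->
    `|\sum_(0 <= k < n) (u k - w k) * J k| <= B * (Num.sqrt (r n) * c + r n).
  move=> Ku fJ JB; have [[u0 uw uJ] uS uP] := Ku.
  have B0 : 0 <= B by apply: le_trans (JB 0%N).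
  apply/ler_addgt0Pr => e e0.
  have /cvgrPdist_le/(_ _ e0)[m _ hm] := uJ _ fJ.
  have := hm (maxn m n) (leq_maxl _ _); rewrite sub0r normrN.
  set M := maxn m n => h.
  rewrite /series/= (big_cat_nat (n := n)) ?leq_maxr//= in h.
  set x := \sum_(0 <= k < n) _ in h *; set y := \sum_(_ <= k < _) _ in h.
  have hy : `|y| <= B * (Num.sqrt (r n) * c + r n).
    apply: (le_trans (ler_norm_sum _ _ _)).
    apply: (@le_trans _ _ (\sum_(n <= k < M) (u k + w k) * B)).
      apply: ler_sum => k _; rewrite normrM ler_pM//.
      by apply: (le_trans (ler_normB _ _)); rewrite !ger0_norm.
    rewrite -mulr_suml mulrC ler_wpM2l// big_split/= lerD//.
      by apply: tail => //; exact: leq_maxr.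
    by apply: wtail; exact: leq_maxr.
  have : `|x| <= `|x + y| + `|y| by rewrite -{1}(addrK y x) ler_normB.
  lra.
have pJ J : fam J -> series (fun k => (p k - w k) * J k) @ \oo --> (0 : R).
  move=> fJ; have [B JB] := Jbd _ fJ.
  have bnd n : `|\sum_(0 <= k < n) (p k - w k) * J k| <= B * (Num.sqrt (r n) * (cs + 1) + r n).
    have cF k : continuous (fun x : R => (x - w k) * J k).
      by move=> x; apply: cvgM; [apply: cvgB => //|]; exact: cvg_cst.
    apply: (cluster_le (G := fun u => `|\sum_(0 <= k < n) (u k - w k) * J k|) clp).
      move=> u.
      exact: (cvg_norm (@continuous_coord_sum (fun k x => (x - w k) * J k) n cF u)).
    move=> k; apply: le_trans (rep _ _ _ _ _ (UK k) fJ JB) _.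
    rewrite -[leLHS]addr0 lerD ?invr_ge0// ler_wpM2l ?(le_trans _ (JB 0%N))//.
    by rewrite lerD2r ler_wpM2l ?sqrtr_ge0// lerD2l invf_le1// ler1n.
  apply/norm_cvg0P; apply: (@squeeze_cvgr _ _ _ _ (fun=> 0) (fun n => B * (Num.sqrt (r n) * (cs + 1) + r n))).
  - by apply: nearW => n; rewrite normr_ge0 bnd.
  - exact: cvg_cst.
  - rewrite [X in _ --> X](_ : _ = B * (Num.sqrt 0 * (cs + 1) + 0)); last by rewrite sqrtr0 mul0r add0r mulr0.
    apply: cvgM; first exact: cvg_cst.
    apply: cvgD => //; apply: cvgM; last exact: cvg_cst.
    exact: (cvg_comp _ _ rcv (@sqrt_continuous R 0)).
have padm : admissible w fam p by split.
exists p; split => // v N vN vJ.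
apply: contrapT => /existsNP[k0 /eqP vk0].
have [e e0 ev] := @small_multiple p v N p0 (fun k h => (vN k h).2).
have {}ev k : e * `|v k| <= p k.
  have [/ev//|Nk] := ltnP k N.
  rewrite (_ : v k = 0) ?normr0 ?mulr0//; apply/eqP; apply: contraTT Nk => /vN[].
  by rewrite ltnNge.
have vsupp k : v k != 0 -> (k < N)%N by move=> /vN[].
pose q (s : R) k := p k + s * v k.
have qadm s : `|s| = e -> admissible w fam (q s).
  move=> se; split.
  - move=> k; have : - (s * v k) <= p k by rewrite (le_trans (ler_norm _))// normrN normrM se.
    by rewrite /q; lra.
  - move=> k wk; rewrite /q pw//; have [->|/vN[_]] := eqVneq (v k) 0; first by rewrite mulr0 addr0.
    by rewrite pw// ltxx.
  - move=> J fJ; have := pJ _ fJ; apply: cvg_trans; apply: near_eq_cvg.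
    exists N => // n /= Nn; rewrite /series/=.
    transitivity (\sum_(0 <= k < n) (p k - w k) * J k + s * \sum_(0 <= k < n) v k * J k).
      rewrite (@series_finite_support (fun k => v k * J k) N)// ?vJ ?mulr0 ?addr0//.
      by move=> k vJk; apply: vsupp; apply: contraNneq vJk => ->; rewrite mul0r.
    rewrite mulr_sumr -big_split/=; apply: eq_bigr => k _; rewrite /q; ring.
have qsum s n : `|s| = e -> series (q s) n <= S + s * \sum_(0 <= k < N) v k.
  move=> se; have [q0 _ _] := qadm _ se.
  apply: (@le_trans _ _ (series (q s) (maxn n N))).
    by apply: nondecreasing_series (leq_maxl _ _) => k _ _; exact: q0.
  rewrite /series/= /q big_split/= -mulr_sumr (@series_finite_support v N) ?leq_maxr//.
  by rewrite lerD2r pS.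
have ee : `|e| = e by rewrite gtr0_norm.
have eN : `|- e| = e by rewrite normrN.
have sv0 : \sum_(0 <= k < N) v k = 0.
  have := Hmin _ _ (qadm _ ee) (fun n => qsum _ n ee).
  have := Hmin _ _ (qadm _ eN) (fun n => qsum _ n eN).
  set x := \sum_(_ <= k < _) _ => h1 h2; apply/eqP; rewrite eq_le; apply/andP; split; nra.
have {}qsum s n : `|s| = e -> series (q s) n <= S.
  by move=> se; have := qsum s n se; rewrite sv0 mulr0 addr0.
pose V := \sum_(0 <= k < N) v k ^+ 2.
have V0 : 0 < V.
  rewrite /V (bigD1_seq k0)/= ?mem_index_iota ?iota_uniq//; last by case: (vN _ vk0).
  by rewrite ltr_pwDl ?exprn_even_gt0// sumr_ge0// => k _; exact: sqr_ge0.
(* cs is the infimum, so large partial sums at any competitor come close to it *)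
have qPsi s d : 0 < d -> `|s| = e -> exists n, forall m, (n <= m)%N -> cs - d < Psi (q s) m.
  move=> d0 se; have [[q0 _ _] qS] := (qadm _ se, fun n => qsum s n se).
  apply/not_existsP => h.
  suff : C (cs - d).
    by move=> /(inf_lbound Cinf.2); rewrite -/cs; lra.
  exists (q s); split => // [|n]; first exact: qadm.
  rewrite leNgt; apply/negP => hn; apply: (h n) => m nm; apply: (lt_le_trans hn).
  by rewrite /Psi [leRHS](big_cat_nat (n := n))//= lerDl sumr_ge0// => k _; exact: termp.
have d0 : 0 < e ^+ 2 * V by rewrite mulr_gt0// exprn_gt0.
have [n1 h1] := qPsi e _ d0 ee.
have [n2 h2] := qPsi (- e) _ d0 eN.
pose n := maxn N (maxn n1 n2).
have {}h1 := h1 n (leq_trans (leq_maxl n1 n2) (leq_maxr _ _)).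
have {}h2 := h2 n (leq_trans (leq_maxr n1 n2) (leq_maxr _ _)).
have : Psi (q e) n + Psi (q (- e)) n = 2 * Psi p n - 2 * (e ^+ 2 * V).
  rewrite /V -(@series_finite_support (fun k => v k ^+ 2) N n) ?leq_maxl//; last first.
    by move=> k; rewrite expf_eq0/= => /vsupp.
  rewrite /Psi -big_split/= !mulr_sumr -sumrB; apply: eq_bigr => k _; rewrite /q; ring.
have := pPsi n; lra.
Qed.

End ExtremePoint.

(** * Extremal reweightings *)
Section ExtremalReweighting.
Context {R : realType} {m : nat}.
Notation G := (Gamma R m).
Notation V := 'rV[R]_m.
Variables (T : current1 R m) (eta : {finite_measure set G -> \bar R}).
Hypothesis good : good_decomposition eta T.
Variables (A : (set G)^nat) (mA : forall k, measurable (A k)).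
Hypotheses (tA : trivIset setT A) (UA : \bigcup_k A k = setT).

Notation W := (cell_weight eta A).
Notation I := (cell_current eta A).

(** [extreme_point] in the unknowns u_k = a_k W_k.  In these, the equation given by
    a test form omega has the coefficients I_k(omega) / W_k, which are bounded
    because I_k(omega) is at most a multiple of L_k.  If W_k = 0 then I_k = 0, so
    that the value 0 of the quotient does no harm. *)
Lemma extremal_reweighting :
  exists (a : nat -> {nonneg R}) (nu : {finite_measure set G -> \bar R}),
  [/\ reweighted A eta a nu, good_decomposition nu T &
    forall (v : nat -> R) (n : nat),
      (forall k, v k != 0 -> (k < n)%N /\ (0 < nu (A k))%E) ->
      (forall omega, test_form omega -> \sum_(0 <= k < n) v k * I k omega = 0) ->
      forall k, v k = 0].
Proof.
pose fam : set (nat -> R) :=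
  [set J | exists2 omega, test_form omega & J = fun k => I k omega / W k].
have Wcvg := cell_weight_cvg good mA tA UA.
have Wlim : limn (series W) = total_weight T eta by exact: (cvg_lim (@Rhausdorff R) Wcvg).
have W0 := cell_weight_ge0 eta A.
have famB J : fam J -> exists C, forall k, `|J k| <= C.
  move=> [omega to ->]; have [B B0 IB] := cell_current_bound good mA to.
  exists B => k; have [->|Wk] := eqVneq (W k) 0; first by rewrite invr0 mulr0 normr0 ltW.
  have Wp : 0 < W k by rewrite lt_neqAle eq_sym Wk W0.
  rewrite normrM normfV (gtr0_norm Wp) ler_pdivrMr// (le_trans (IB k))//.
  by rewrite ler_pM2l// /cell_weight lerDl mulr_ge0// cell_measure_ge0.
have I0 omega k : test_form omega -> W k = 0 -> I k omega = 0.
  move=> to Wk; have [B B0 IB] := cell_current_bound good mA to.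
  have L0 : cell_mass eta A k = 0.
    have := cell_mass_ge0 eta A k; have := cell_measure_ge0 eta A k.
    by move: Wk; rewrite /cell_weight; lra.
  by have := IB k; rewrite L0 mulr0 normr_le0 => /eqP.
pose coef (u : nat -> R) (u0 : forall k, 0 <= u k) k : {nonneg R} :=
  NngNum (divr_ge0 (u0 k) (W0 k)).
have key u c : admissible W fam u -> (forall n, series u n <= c) ->
    exists (a : nat -> {nonneg R}) (nu : {finite_measure set G -> \bar R}),
    [/\ forall k, (a k)%:num * W k = u k, reweighted A eta a nu,
     (forall omega, test_form omega ->
       series (fun k => ((a k)%:num - 1) * I k omega) @ \oo --> (0 : R)) &
     forall n, series (fun k => (a k)%:num * W k) n <= c].
  move=> [u0 uW ufam] uc; pose a := coef u u0; exists a.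
  have aW k : (a k)%:num * W k = u k.
    rewrite /a /coef /=; have [Wk|Wk] := eqVneq (W k) 0.
      by rewrite Wk mulr0 uW.
    by rewrite divfK.
  have [nu nuE] : exists nu : {finite_measure set G -> \bar R}, reweighted A eta a nu.
    apply: (reweighted_exists mA tA).
    apply: (@le_lt_trans _ _ (c%:E)); last exact: ltry.
    apply: (@le_trans _ _ (\sum_(k <oo) ((a k)%:num * cell_measure eta A k)%:E)%E).
      apply: lee_nneseries => [k _ _|k _]; first by rewrite mule_ge0// lee_fin.
      by rewrite EFinM -cell_measureE.
    apply: nneseries_le => [k|n]; first by rewrite mulr_ge0// cell_measure_ge0.
    apply: le_trans (uc n); apply: ler_sum => k _.
    rewrite -aW ler_wpM2l// /cell_weight.
    have := cell_mass_ge0 eta A k; have := cell_measure_ge0 eta A k; lra.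
  exists nu; split => //; last first.
    by move=> n; under eq_fun do rewrite aW.
  move=> omega to.
  have := ufam _ (ex_intro2 _ _ omega to erefl).
  suff -> : (fun k => (u k - W k) * (I k omega / W k)) =
    (fun k => ((a k)%:num - 1) * I k omega) by [].
  apply/funext => k; rewrite -aW; have [Wk|Wk] := eqVneq (W k) 0; first by rewrite (I0 _ _ to Wk) mul0r !mulr0.
  by field.
have Wmin u c : admissible W fam u -> (forall n, series u n <= c) ->
    limn (series W) <= c.
  move=> uadm uc; have [a [nu [_ nuE abal abnd]]] := key u c uadm uc.
  by rewrite Wlim; exact: (total_weight_min good mA tA UA nuE abal abnd).
have [u [uadm ub uext]] := extreme_point W0 (cvgP _ Wcvg) famB Wmin.
have [a [nu [aW nuE abal abnd]]] := key _ _ uadm ub.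
exists a, nu; split => //.
  exact: (good_reweighted good mA tA UA nuE abal abnd Wlim).
move=> v n vsupp vI k.
have nuA j : nu (A j) = ((a j)%:num * cell_measure eta A j)%:E.
  by rewrite (nuE _ _ (mA j) (@subset_refl _ _)) EFinM -cell_measureE.
have Wpos j : v j != 0 -> 0 < W j /\ 0 < u j.
  move=> /vsupp[_]; rewrite nuA lte_fin.
  rewrite -aW => aE.
  have aj : 0 < (a j)%:num.
    by rewrite lt_neqAle eq_sym; apply/andP; split => //; apply: contraTneq aE => ->; rewrite mul0r ltxx.
  have Wj : 0 < W j.
    move: aE; rewrite pmulr_rgt0// /cell_weight => E0.
    have := cell_mass_ge0 eta A j; lra.
  by split => //; exact: mulr_gt0.
have vW : v k * W k = 0.
  apply: (uext (fun j => v j * W j) n) => [j vWj|J [omega to ->]].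
    have vj : v j != 0 by apply: contraNneq vWj => ->; rewrite mul0r.
    by split; [have [] := vsupp j vj|have [] := Wpos j vj].
  rewrite -[RHS](vI _ to); apply: eq_bigr => j _.
  have [->|vj] := eqVneq (v j) 0; first by rewrite !mul0r.
  by have [Wj _] := Wpos j vj; field; rewrite gt_eqF.
apply/eqP/negPn/negP => vk; have [Wk _] := Wpos k vk.
by move/eqP: vW; rewrite mulf_eq0 (negbTE vk) gt_eqF.
Qed.

End ExtremalReweighting.

(** * Cells given by the end points *)
Section EndpointCells.
Context {R : realType} {m : nat}.
Notation G := (Gamma R m).
Notation V := 'rV[R]_m.

(** Uniform convergence on compact sets implies pointwise convergence. *)
Lemma evaluation_continuous (t : R) : continuous (fun g : curve R m => g t : V).
Proof.
move=> g; pose h : curve R m -> {family compact, R -> V} := @curve_to_fun R m.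
have hg : h x @[x --> g] --> h g by exact: (@initial_continuous _ _ (@curve_to_fun R m) g).
have hF : Filter (h x @[x --> g]) := fmap_filter h (nbhs_filter g).
have hp := @pointwise_cvg_compact_family R V (h x @[x --> g]) (h g) hF hg.
exact: (proj1 (@pointwise_cvgP R V (h x @[x --> g]) (h g) hF) hp t).
Qed.

Lemma measurable_evaluation (t : R) (y : V) : measurable ([set g | g t = y] : set G).
Proof.
rewrite -[X in measurable X]setCK; apply: measurableC; apply: sub_sigma_algebra.
rewrite /= (_ : ~` _ = (fun g : curve R m => g t : V) @^-1` (~` [set y]))//.
have ec : continuous (fun g : curve R m => g t : V) by exact: evaluation_continuous.
move/continuousP: ec; apply.
by rewrite openC; exact: (@accessible_closed_set1 V (hausdorff_accessible (@norm_hausdorff _ V))).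
Qed.

(** Eventually constant curves attain their limit, so integer times suffice; this
    makes the end point a countable condition. *)
Lemma pinftyE (g : curve R m) (y : V) :
  pinfty g = y <-> exists n : nat, forall k, g (n + k)%:R = y.
Proof.
have [t0 t00 gt0] := curve_const g.
have -> : pinfty g = g t0.
  apply: (@cvg_lim V (@norm_hausdorff _ V)); apply: cvg_near_cst.
  by near=> t; apply: gt0; near: t; apply: nbhs_pinfty_ge; exact: num_real.
have [n nt0] : exists n : nat, t0 <= n%:R.
  by exists (Num.truncn t0).+1; rewrite ltW// truncnS_gt.
split=> [<-|[p gp]].
  by exists n => k; apply: gt0; rewrite (le_trans nt0)// ler_nat leq_addr.
by rewrite -(gp n); apply/esym/gt0; rewrite (le_trans nt0)// ler_nat leq_addl.
Unshelve. all: end_near. Qed.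

Lemma measurable_Gamma_between (x y : V) : measurable (Gamma_between x y : set G).
Proof.
apply: measurableI; first exact: measurable_evaluation.
rewrite [X in measurable X](_ : _ =
    \bigcup_n \bigcap_k ([set g | g (n + k)%:R = y] : set G)).
  apply: bigcup_measurable => n _; apply: bigcap_measurable => [|k _]; last exact: measurable_evaluation.
  by exists 0%N.
apply/seteqP; split=> g.
  by move/pinftyE => [n gn]; exists n => // k _; exact: gn.
by move=> [n _ gn]; apply/pinftyE; exists n => k; exact: gn.
Qed.

Variables (M N : option nat) (x y : nat -> V).
Hypotheses (x_distinct : {in in_range M &, injective x})
  (y_distinct : {in in_range N &, injective y}).

(** The partial inverse [pickle_inv] is injective where it is defined, unlike
    [unpickle]; hence no cell is listed twice. *)
Definition endpoint_cell (k : nat) : set G :=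
  if pickle_inv k is Some (i, j) then
    if in_range M i && in_range N j then Gamma_between (x i) (y j) else set0
  else set0.

Definition cells (k : nat) : set G :=
  if k is k'.+1 then endpoint_cell k' else ~` \bigcup_k endpoint_cell k.

Definition cell_index (i j : nat) : nat := (pickle (i, j)).+1.

Lemma cell_index_eq i j i' j' :
  (cell_index i j == cell_index i' j') = ((i == i') && (j == j')).
Proof. by rewrite eqSS (inj_eq (pcan_inj pickleK)). Qed.

Lemma cells_index i j : in_range M i -> in_range N j ->
  cells (cell_index i j) = Gamma_between (x i) (y j).
Proof. by move=> Mi Nj; rewrite /= /endpoint_cell pickleK_inv Mi Nj. Qed.

Lemma measurable_endpoint_cell k : measurable (endpoint_cell k).
Proof.
rewrite /endpoint_cell; case: (pickle_inv k) => [[i j]|]//.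
by case: ifP => // _; exact: measurable_Gamma_between.
Qed.

Lemma measurable_cells k : measurable (cells k).
Proof.
case: k => [|k]; last exact: measurable_endpoint_cell.
apply: measurableC; apply: bigcup_measurable => k _.
exact: measurable_endpoint_cell.
Qed.

Lemma endpoint_cell_inj k k' (g : G) :
  endpoint_cell k g -> endpoint_cell k' g -> k = k'.
Proof.
rewrite /endpoint_cell.
case E : (pickle_inv k) => [[i j]|]//; case E' : (pickle_inv k') => [[i' j']|]//.
case: ifP => // /andP[Mi Nj] [gi gj]; case: ifP => // /andP[Mi' Nj'] [gi' gj'].
have := @pickle_invK (nat * nat)%type k; have := @pickle_invK (nat * nat)%type k'.
rewrite E E' /= => <- <-.
by rewrite (x_distinct Mi Mi' (etrans (esym gi) gi')) (y_distinct Nj Nj' (etrans (esym gj) gj')).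
Qed.

Lemma trivIset_cells : trivIset setT cells.
Proof.
move=> [|k] [|k'] _ _ [g []]//=.
- by move=> ng gk'; exfalso; apply: ng; exists k'.
- by move=> gk ng; exfalso; apply: ng; exists k.
- by move=> gk gk'; congr S; exact: endpoint_cell_inj gk gk'.
Qed.

Lemma bigcup_cells : \bigcup_k cells k = setT.
Proof.
apply/seteqP; split => // g _.
have [[k _ gk]|ng] := pselect ((\bigcup_k endpoint_cell k) g).
  by exists k.+1.
by exists 0%N.
Qed.

End EndpointCells.

Lemma sum_indicator_eq (R : pzRingType) (f : nat -> R) j n : (j < n)%N ->
  \sum_(0 <= k < n) (k == j)%:R * f k = f j.
Proof.
move=> jn; rewrite big_mkord (bigD1 (Ordinal jn))//= eqxx mul1r big1 ?addr0//.
by move=> i; rewrite -val_eqE /= => /negbTE ->; rewrite mul0r.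
Qed.

Theorem theorem3p3 (R : realType) (m : nat) (X : set 'rV[R]_m)
    (M N : option nat) (x y : nat -> 'rV[R]_m) (w' w : nat -> {posnum R})
    (X_compact : compact X)
    (X_convex : convex_set (X : set (convex_lmodType 'rV[R]_m)))
    (xX : forall i, in_range M i -> X (x i))
    (yX : forall j, in_range N j -> X (y j))
    (x_distinct : {in in_range M &, injective x})
    (y_distinct : {in in_range N &, injective y})
    (equal_mass : (\sum_(0 <= i <oo | in_range M i) ((w' i)%:num)%:E =
                   \sum_(0 <= j <oo | in_range N j) ((w j)%:num)%:E)%E)
    (finite_mass : (\sum_(0 <= j <oo | in_range N j) ((w j)%:num)%:E < +oo)%E)
    (T : current1 R m)
    (T_path : transport_path (atomic_measure M w' x) (atomic_measure N w y) T)
    (eta : {finite_measure set (Gamma R m) -> \bar R})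
    (eta_good : good_decomposition eta T) :
  exists eta_inf : {finite_measure set (Gamma R m) -> \bar R},
    better_decomposition M N x y eta_inf T /\
    decomposition_le M N x y eta_inf eta.
Proof.
pose A := cells M N x y.
have mA := @measurable_cells R m M N x y : forall k, measurable (A k).
have [a [nu [nuE nu_good ext]]] := extremal_reweighting eta_good mA
  (trivIset_cells x_distinct y_distinct) (bigcup_cells M N x y).
have nuI k omega : test_form omega ->
    curve_integral nu (A k) omega = (a k)%:num * curve_integral eta (A k) omega.
  move=> to; have io := test_form_integrable eta_good to.
  rewrite /curve_integral /Rintegral (integral_reweighted_cell mA nuE)// fineM//.
  apply: integrable_fin_num => //.
  exact: integrableS measurableT (mA k) (@subsetT _ _) io.
exists nu; split; last first.
  move=> i j Mi Nj; exists (a (cell_index i j))%:num => // omega to.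
  by rewrite -(cells_index x y Mi Nj); exact: (nuI (cell_index i j) omega to).
split=> // i1 i2 j1 j2 Mi1 Mi2 Nj1 Nj2 lti ltj relS.
(* S_{i,j}(nu) is the multiple q_k of I_k, and q_k vanishes only if nu (A_k) does *)
pose q k : R := if (0 < nu (A k))%E then (fine (nu (A k)))^-1 * (a k)%:num else 0.
have SE i j omega : in_range M i -> in_range N j -> test_form omega ->
    S_current x y nu i j omega =
    q (cell_index i j) * cell_current eta A (cell_index i j) omega.
  move=> Mi Nj to; rewrite /S_current /q -(cells_index x y Mi Nj).
  by rewrite -/A; case: ifP => _; [rewrite nuI// mulrA|rewrite mul0r].
have q0 k : q k = 0 -> nu (A k) = 0%E.
  move=> qk; apply/eqP; rewrite eq_le measure_ge0 andbT leNgt.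
  apply/negP => nuk; move: qk; rewrite /q nuk => /eqP; rewrite mulf_eq0 invr_eq0.
  case/orP => [|/eqP ak].
    by rewrite gt_eqF// fine_gt0// nuk/= -ge0_fin_numE ?fin_num_measure.
  by move: nuk; rewrite (nuE _ _ (mA k) (@subset_refl _ _)) ak mul0e ltxx.
pose k11 := cell_index i1 j1; pose k12 := cell_index i1 j2.
pose k21 := cell_index i2 j1; pose k22 := cell_index i2 j2.
(* the coefficients of the assumed relation between the S_{i,j}, in terms of the I_k *)
pose v k : R := ((k == k11)%:R - (k == k12)%:R - (k == k21)%:R + (k == k22)%:R) * q k.
(* any number above the four indices would do *)
pose n := (k11 + k12 + k21 + k22).+1.
have v0 : forall k, v k = 0.
  apply: (ext v n) => [k vk|omega to].
    split.
      rewrite ltnS; move: vk; rewrite /v.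
      case: (eqVneq k k11) => [-> _|_]; first by rewrite -!addnA leq_addr.
      case: (eqVneq k k12) => [-> _|_]; first by rewrite (addnC k11) -!addnA leq_addr.
      case: (eqVneq k k21) => [-> _|_]; first by rewrite (addnC _ k21) -!addnA leq_addr.
      case: (eqVneq k k22) => [-> _|_]; first by rewrite leq_addl.
      by rewrite !subr0 addr0 mul0r eqxx.
    by move: vk; rewrite /v /q; case: ifP => // _; rewrite mulr0 eqxx.
  pose f k : R := q k * cell_current eta A k omega.
  have := relS _ to; rewrite !SE// -/k11 -/k12 -/k21 -/k22 -!/(f _) => rel.
  have lk11 : (k11 < n)%N by rewrite ltnS -!addnA leq_addr.
  have lk12 : (k12 < n)%N by rewrite ltnS (addnC k11) -!addnA leq_addr.
  have lk21 : (k21 < n)%N by rewrite ltnS (addnC _ k21) -!addnA leq_addr.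
  have lk22 : (k22 < n)%N by rewrite ltnS leq_addl.
  rewrite -[RHS]rel -(sum_indicator_eq f lk11) -(sum_indicator_eq f lk12).
  rewrite -(sum_indicator_eq f lk21) -(sum_indicator_eq f lk22).
  rewrite -!sumrB -big_split/=; apply: eq_bigr => k _.
  by rewrite /v /f; ring.
have ni : (i1 == i2) = false by rewrite ltn_eqF.
have nj : (j1 == j2) = false by rewrite ltn_eqF.
have ni' : (i2 == i1) = false by rewrite eq_sym.
have nj' : (j2 == j1) = false by rewrite eq_sym.
have Q : [/\ q k11 = 0, q k12 = 0, q k21 = 0 & q k22 = 0].
  split.
  - have := v0 k11; rewrite /v /k11 /k12 /k21 /k22 !cell_index_eq !eqxx ni nj /=.
    by rewrite !subr0 addr0 mul1r.
  - have := v0 k12; rewrite /v /k11 /k12 /k21 /k22 !cell_index_eq !eqxx ni nj' /=.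
    by rewrite sub0r !subr0 addr0 mulN1r => /eqP; rewrite oppr_eq0 => /eqP.
  - have := v0 k21; rewrite /v /k11 /k12 /k21 /k22 !cell_index_eq !eqxx ni' nj /=.
    by rewrite !subr0 sub0r addr0 mulN1r => /eqP; rewrite oppr_eq0 => /eqP.
  - have := v0 k22; rewrite /v /k11 /k12 /k21 /k22 !cell_index_eq !eqxx ni' nj' /=.
    by rewrite !subr0 add0r mul1r.
have [/q0 h1 /q0 h2 /q0 h3 /q0 h4] := Q.
by rewrite -(cells_index x y Mi1 Nj1) -(cells_index x y Mi1 Nj2) -(cells_index x y Mi2 Nj1) -(cells_index x y Mi2 Nj2).
Qed.
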